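(* Let $G_\alpha$ be a two-round four-player game of the form described below, with $\omega^*(G_\alpha)=1-\varepsilon$, and output sets $\mathcal{A},\mathcal{S},\mathcal{B},\mathcal{C}$. Then there is an absolute constant $c>0$ such that \[\omega^*(G_\alpha^l)\le\left(1-\frac{\varepsilon}{2}\right)^{c\,\frac{\varepsilon^2\alpha^4 l}{\log(|\mathcal{A}|\cdot|\mathcal{S}|\cdot|\mathcal{B}|\cdot|\mathcal{C}|)}},\] and for $\eta>0$ and $t=(1-\varepsilon+\eta)l$, \[\omega^*(G_\alpha^{t/l})\le\left(1-\frac{\eta}{2}\right)^{c\,\frac{\eta^2\alpha^4 l}{\log(|\mathcal{A}|\cdot|\mathcal{S}|\cdot|\mathcal{B}|\cdot|\mathcal{C}|)}}.\]
   Context: Game form: players Alice, Barlie, Bob, Charlie; finite sets. Initially Alice and Barlie share an arbitrary entangled state. Round 1 (no communication): Alice gets $x$, Barlie gets $u$, they output $a\in\mathcal{A}$, $s\in\mathcal{S}$. Barlie then applies an arbitrary channel and distributes his registers between Bob and Charlie, who do not communicate afterwards. Round 2: Bob gets $y$, Charlie gets $z$, and they output $b\in\mathcal{B}$, $c\in\mathcal{C}$. The game is won iff $\mathsf{V}_1(x,u,a,s)\cdot\mathsf{V}_2(x,u,y,z,a,s,b,c)=1$ for given predicates $\mathsf V_1,\mathsf V_2$. The input distribution $\mathsf{P}_{XUYZ}$ satisfies: (i) $\mathsf{P}_{XU}$ is a product distribution and $U$ is independent of $(Y,Z)$ (jointly with $X$, i.e. $\mathsf P_{XUYZ}=\mathsf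 P_U\mathsf P_{XYZ}$); (ii) $Y,Z$ take values in the alphabet of $X$ together with a symbol $\perp$, with $\mathsf{P}_{XYZ}(x,x,x)=(1-\alpha)^2\mathsf{P}_X(x)$, $\mathsf{P}_{XYZ}(x,\perp,x)=\mathsf{P}_{XYZ}(x,x,\perp)=\alpha(1-\alpha)\mathsf{P}_X(x)$, $\mathsf{P}_{XYZ}(x,\perp,\perp)=\alpha^2\mathsf{P}_X(x)$, where $\alpha\in(0,1)$. $\omega^*$ denotes quantum value. $G_\alpha^l$ is $l$ parallel copies with i.i.d. inputs (each player receives all its $l$ inputs at once; round 1 of all copies, then Barlie's distribution, then round 2 of all copies), won iff all copies are won; $G_\alpha^{t/l}$ is won iff at least $t$ copies are won. *)

(* Defs.v *)
From HB Require Import structures.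
From mathcomp Require Import all_boot all_order all_algebra.
From mathcomp Require Import classical_sets reals exp.
From mathcomp Require Import complex mxtens.
Set Implicit Arguments. Unset Strict Implicit. Unset Printing Implicit Defensive.
Import Order.TTheory GRing.Theory Num.Theory.
Local Open Scope ring_scope.

Section Quantum.
Variable R : realType.
Local Notation C := (complex R).

Definition adjmx m n (M : 'M[C]_(m, n)) : 'M[C]_(n, m) := (map_mx Num.conj M)^T.

Definition psdmx n (M : 'M[C]_n) : Prop :=
  adjmx M = M /\ forall v : 'cV[C]_n, 0 <= (adjmx v *m M *m v) 0 0.

Definition densitymx n (rho : 'M[C]_n) : Prop := psdmx rho /\ \tr rho = 1.

Definition povm (I O : finType) n (E : I -> O -> 'M[C]_n) : Prop :=
  (forall i o, psdmx (E i o)) /\ (forall i, \sum_(o : O) E i o = 1%:M).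

(* Quantum instruments given by Kraus operators: for each input u, outcome s
   and Kraus index k < m, an operator K u s k : H_in -> H_out, with
   sum_{s,k} K^dagger K = Id (trace preservation). *)
Definition instrument (I O : finType) nin nout m
  (K : I -> O -> 'I_m -> 'M[C]_(nout, nin)) : Prop :=
  forall u, \sum_(s : O) \sum_(k < m) adjmx (K u s k) *m K u s k = 1%:M.

End Quantum.

(* A general two-round four-player game: inputs x,u (round 1), y,z (round 2),
   outputs a,s (round 1), b,c (round 2), distribution P, winning predicate W. *)

(* Winning probability of the strategy:
   - rho : shared state on H_A (dim nA) (x) H_Barlie (dim nB),
   - Alice's POVMs EA x a on H_A,
   - Barlie's instruments K u s k : H_Barlie -> H_Bob (x) H_Charlie (dims nb, nc),
   - Bob's POVMs EB y b on H_Bob, Charlie's POVMs EC z c on H_Charlie. *)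
Definition win_prob (R : realType) (X U Y Z A S B C : finType)
  (P : X -> U -> Y -> Z -> R)
  (W : X -> U -> Y -> Z -> A -> S -> B -> C -> bool)
  (nA nB nb nc m : nat) (rho : 'M[complex R]_(nA * nB))
  (EA : X -> A -> 'M[complex R]_nA)
  (K : U -> S -> 'I_m -> 'M[complex R]_(nb * nc, nB))
  (EB : Y -> B -> 'M[complex R]_nb) (EC : Z -> C -> 'M[complex R]_nc) : R :=
  \sum_(x : X) \sum_(u : U) \sum_(y : Y) \sum_(z : Z) P x u y z *
   \sum_(a : A) \sum_(s : S) \sum_(b : B) \sum_(c : C)
     (W x u y z a s b c)%:R *
     complex.Re (\tr ((EA x a *t (EB y b *t EC z c)) *m
        \sum_(k < m) ((1%:M : 'M[complex R]_nA) *t K u s k) *m rho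
                    *m adjmx ((1%:M : 'M[complex R]_nA) *t K u s k))).

Definition qvalue (R : realType) (X U Y Z A S B C : finType)
  (P : X -> U -> Y -> Z -> R)
  (W : X -> U -> Y -> Z -> A -> S -> B -> C -> bool) : R :=
  sup [set r : R | exists (nA nB nb nc m : nat)
        (rho : 'M[complex R]_(nA * nB))
        (EA : X -> A -> 'M[complex R]_nA)
        (K : U -> S -> 'I_m -> 'M[complex R]_(nb * nc, nB))
        (EB : Y -> B -> 'M[complex R]_nb) (EC : Z -> C -> 'M[complex R]_nc),
        [/\ densitymx rho, povm EA, instrument K, povm EB & povm EC] /\
        r = win_prob P W rho EA K EB EC].

(* The input distribution of G_alpha: Y, Z take values in option X
   (None = the symbol "bot"). *)
Definition Galpha_dist (R : realType) (X U : finType) (PX : X -> R) (PU : U -> R)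
  (alpha : R) (x : X) (u : U) (y z : option X) : R :=
  PU u * PX x *
  ((if y is Some y' then (y' == x)%:R * (1 - alpha) else alpha) *
   (if z is Some z' then (z' == x)%:R * (1 - alpha) else alpha)).

Definition Galpha_pred (X U A S B C : finType)
  (V1 : X -> U -> A -> S -> bool)
  (V2 : X -> U -> option X -> option X -> A -> S -> B -> C -> bool)
  x u y z a s b c : bool := V1 x u a s && V2 x u y z a s b c.

Definition rep_dist (R : realType) (X U Y Z : finType) (l : nat)
  (P : X -> U -> Y -> Z -> R)
  (x : {ffun 'I_l -> X}) (u : {ffun 'I_l -> U})
  (y : {ffun 'I_l -> Y}) (z : {ffun 'I_l -> Z}) : R :=
  \prod_(i < l) P (x i) (u i) (y i) (z i).

Definition nwon (X U Y Z A S B C : finType) (l : nat)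
  (W : X -> U -> Y -> Z -> A -> S -> B -> C -> bool)
  (x : {ffun 'I_l -> X}) (u : {ffun 'I_l -> U})
  (y : {ffun 'I_l -> Y}) (z : {ffun 'I_l -> Z})
  (a : {ffun 'I_l -> A}) (s : {ffun 'I_l -> S})
  (b : {ffun 'I_l -> B}) (c : {ffun 'I_l -> C}) : nat :=
  #|[set i : 'I_l | W (x i) (u i) (y i) (z i) (a i) (s i) (b i) (c i)]|.

Definition rep_all (X U Y Z A S B C : finType) (l : nat)
  (W : X -> U -> Y -> Z -> A -> S -> B -> C -> bool)
  (x : {ffun 'I_l -> X}) (u : {ffun 'I_l -> U})
  (y : {ffun 'I_l -> Y}) (z : {ffun 'I_l -> Z})
  (a : {ffun 'I_l -> A}) (s : {ffun 'I_l -> S})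
  (b : {ffun 'I_l -> B}) (c : {ffun 'I_l -> C}) : bool :=
  nwon W x u y z a s b c == l.

Definition rep_thr (R : realType) (X U Y Z A S B C : finType) (l : nat) (t : R)
  (W : X -> U -> Y -> Z -> A -> S -> B -> C -> bool)
  (x : {ffun 'I_l -> X}) (u : {ffun 'I_l -> U})
  (y : {ffun 'I_l -> Y}) (z : {ffun 'I_l -> Z})
  (a : {ffun 'I_l -> A}) (s : {ffun 'I_l -> S})
  (b : {ffun 'I_l -> B}) (c : {ffun 'I_l -> C}) : bool :=
  t <= (nwon W x u y z a s b c)%:R.

Arguments rep_dist {R X U Y Z} l P x u y z.
Arguments rep_all {X U Y Z A S B C} l W x u y z a s b c.
Arguments rep_thr {R X U Y Z A S B C} l t W x u y z a s b c.

(* Main.v *)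
Require Import Defs.
From HB Require Import structures.
From mathcomp Require Import all_boot all_order all_algebra.
From mathcomp Require Import classical_sets reals exp.
From mathcomp Require Import complex mxtens spectral.
From mathcomp Require Import boolp.
From mathcomp Require Import ring lra.
Set Implicit Arguments. Unset Strict Implicit. Unset Printing Implicit Defensive.
Import Order.TTheory GRing.Theory Num.Theory.
Local Open Scope ring_scope.

(* A strategy for the repeated game that wins many coordinates is turned into a
   strategy for one copy. Replace the winning indicator by the payoff
   (1 + W) / 2 and let M n be the expectation of the n-th power of the total
   payoff, that is, a sum over n-tuples T of coordinates of expected products
   of payoffs. For fixed T and fixed outputs on T, the players' inputs are put
   in superposition in private registers, except for the data on T, a public
   coin turning each question of Bob and of Charlie into bottom with
   probability alpha / 2, and the question of Alice wherever a public coin has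
   not hidden it. This is where anchoring enters: the public data make the
   private inputs of the four parties independent. By Uhlmann's theorem and the
   superadditivity of relative entropy, each party can locally move from a
   superposed to a fixed input at a coordinate i outside of T, at a squared
   distance whose sum over i is at most - p ln p, where p is the norm of the
   (subnormalised) state. Hence on average over i a single copy of the game can be
   played inside the state, and the payoff at i is at most
   p (1 + omega) / 2 up to that error. Summing over T and the outputs
   yields a recursion M (n + 1) <= l (1 - eps / 2 + eta / 4) M n, valid while n
   and - ln (M n) are small; against M n >= q (l (1 - (eps - eta) / 2))^n it
   bounds the probability q of winning (1 - eps + eta) l coordinates. *)

(** * Vectors, matrices and spectral decompositions *)

(** Conditioning on winning the coordinates in T would require that event to be likely for every T
    and all outputs. Subnormalised states avoid this: an unlikely pair of tuple and outputs carries
    little weight, and concavity of - p ln p bounds the summed error by its value at the average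
    weight per pair. There are (l N)^n pairs, N being the product of the alphabet sizes; this is how
    the logarithm of the alphabets enters the rate. Transport to fixed inputs is used in both
    directions: forward to play a single copy inside the state, backward to compare the norm of the
    starting state with the average norm that the recursion is about. Alice and Barlie are moved
    where both coins at i hide the question, an event of probability alpha^2 / 4; Bob is moved while
    Charlie sees bottom, which costs 1 / alpha on top of the 1 / alpha of his own flag. Both losses
    are of order alpha^(-2), so the argument gives alpha^2 in the exponent, and alpha^4 is smaller.
    The slack eta / 4 of the recursion is spent as eta / 16 on the parameter th, eta / 16 on the
    coordinates in T and eta / 8 on the transport error, whence th = eta / 48. *)

Section SquaredNorm.
Variable R : realType.
Local Notation C := (complex R).
Local Notation "x %:C" := (real_complex R x).

Definition sqn (z : C) : R := complex.Re z ^+ 2 + complex.Im z ^+ 2.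

Lemma sqn_ge0 z : 0 <= sqn z.
Proof. by rewrite addr_ge0 ?sqr_ge0. Qed.

Lemma sqn0 : sqn 0 = 0.
Proof. by rewrite /sqn /= expr0n addr0. Qed.

Lemma sqn_eq0 z : sqn z = 0 -> z = 0.
Proof.
case: z => a b; rewrite /sqn /= => /eqP; rewrite paddr_eq0 ?sqr_ge0 //.
by rewrite !sqrf_eq0 => /andP[/eqP-> /eqP->].
Qed.

Lemma sqnM x y : sqn (x * y) = sqn x * sqn y.
Proof. by case: x y => a b [c d]; rewrite /sqn /=; ring. Qed.

Lemma sqnN x : sqn (- x) = sqn x.
Proof. by case: x => a b; rewrite /sqn /=; ring. Qed.

Lemma sqn_real r : sqn r%:C = r ^+ 2.
Proof. by rewrite /sqn /= expr0n addr0. Qed.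

Lemma sqn_conj z : sqn (Num.conj z) = sqn z.
Proof. by case: z => a b; rewrite /sqn /= sqrrN. Qed.

Lemma conj_mul z : Num.conj z * z = (sqn z)%:C.
Proof. by rewrite mulrC -normCK add_Re2_Im2. Qed.

Lemma conj_realC (r : R) : Num.conj r%:C = r%:C.
Proof. exact: conjc_real. Qed.

(** On real and imaginary parts p, q the gap is [t^-1] times the square of t p - q. A small [t]
    keeps the factor of the main term close to 1 and charges [t^-1] to the error. *)
Lemma sqnD_le t x y : 0 < t ->
  sqn (x + y) <= (1 + t) * sqn x + (1 + t^-1) * sqn y.
Proof.
move=> t0; case: x y => a b [c d]; rewrite /sqn /=.
have key p q : (p + q) ^+ 2 <= (1 + t) * p ^+ 2 + (1 + t^-1) * q ^+ 2.
  rewrite -subr_ge0.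
  have -> : (1 + t) * p ^+ 2 + (1 + t^-1) * q ^+ 2 - (p + q) ^+ 2
    = t^-1 * (t * p - q) ^+ 2 by field; rewrite gt_eqF.
  by rewrite mulr_ge0 ?sqr_ge0 // invr_ge0 ltW.
have := key a c; have := key b d; lra.
Qed.

Definition nrm (I : finType) (v : I -> C) : R := \sum_i sqn (v i).

Lemma nrm_ge0 (I : finType) (v : I -> C) : 0 <= nrm v.
Proof. by apply: sumr_ge0 => i _; apply: sqn_ge0. Qed.

Lemma nrmN (I : finType) (v : I -> C) : nrm (fun i => - v i) = nrm v.
Proof. by apply: eq_bigr => i _; rewrite sqnN. Qed.

Lemma nrmD_le (I : finType) t (v w : I -> C) : 0 < t ->
  nrm (fun i => v i + w i) <= (1 + t) * nrm v + (1 + t^-1) * nrm w.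
Proof.
by move=> t0; rewrite !mulr_sumr -big_split ler_sum // => i _; apply: sqnD_le.
Qed.

Definition app (K I : finType) (L : K -> I -> C) (v : I -> C) : K -> C :=
  fun k => \sum_i L k i * v i.

Definition contr (K I : finType) (L : K -> I -> C) : Prop :=
  forall v, nrm (app L v) <= nrm v.

End SquaredNorm.

Section Adjoint.
Variable R : realType.
Local Notation C := (complex R).
Local Notation "x %:C" := (real_complex R x).

Lemma adjmxE m n (M : 'M[C]_(m, n)) i j : adjmx M i j = Num.conj (M j i).
Proof. by rewrite !mxE. Qed.

Lemma adjmxM m n p (A : 'M[C]_(m, n)) (B : 'M[C]_(n, p)) :
  adjmx (A *m B) = adjmx B *m adjmx A.
Proof. by rewrite /adjmx map_mxM trmx_mul. Qed.

Lemma adjmxK m n (A : 'M[C]_(m, n)) : adjmx (adjmx A) = A.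
Proof. by apply/matrixP=> i j; rewrite !adjmxE conjCK. Qed.

Lemma adjmxB m n (A B : 'M[C]_(m, n)) : adjmx (A - B) = adjmx A - adjmx B.
Proof. by apply/matrixP=> i j; rewrite !mxE rmorphB. Qed.

Lemma adjmx1 n : adjmx (1%:M : 'M[C]_n) = 1%:M.
Proof. by rewrite /adjmx map_mx1 trmx1. Qed.

Lemma adjmx_sum (I : finType) m n (F : I -> 'M[C]_(m, n)) :
  adjmx (\sum_i F i) = \sum_i adjmx (F i).
Proof. by rewrite /adjmx !raddf_sum. Qed.

Lemma adjmx_tens m n p q (A : 'M[C]_(m, n)) (B : 'M[C]_(p, q)) :
  adjmx (A *t B) = adjmx A *t adjmx B.
Proof. by rewrite /adjmx map_mxT trmx_tens. Qed.

Definition rdiag n (f : 'I_n -> R) : 'M[C]_n := diag_mx (\row_i (f i)%:C).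

Lemma rdiagE n (f : 'I_n -> R) i j : rdiag f i j = (f i)%:C *+ (i == j).
Proof. by rewrite !mxE. Qed.

Lemma mul_rdiag_mx n p (f : 'I_n -> R) (A : 'M[C]_(n, p)) i j :
  (rdiag f *m A) i j = (f i)%:C * A i j.
Proof. by rewrite mul_diag_mx !mxE. Qed.

Lemma mul_mx_rdiag n p (f : 'I_n -> R) (A : 'M[C]_(p, n)) i j :
  (A *m rdiag f) i j = A i j * (f j)%:C.
Proof. by rewrite mul_mx_diag !mxE. Qed.

Lemma rdiagM n (f g : 'I_n -> R) :
  rdiag f *m rdiag g = rdiag (fun i => f i * g i).
Proof.
apply/matrixP=> i j; rewrite mul_rdiag_mx !rdiagE rmorphM /=.
by rewrite mulrnAr.
Qed.

Lemma adj_rdiag n (f : 'I_n -> R) : adjmx (rdiag f) = rdiag f.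
Proof.
apply/matrixP=> i j; rewrite adjmxE !rdiagE eq_sym rmorphMn /= conj_realC.
by case: eqP => // ->.
Qed.

Definition fro m n (M : 'M[C]_(m, n)) : R := \sum_i \sum_j sqn (M i j).

Lemma froE m n (M : 'M[C]_(m, n)) : (fro M)%:C = \tr (adjmx M *m M).
Proof.
rewrite /fro /mxtrace exchange_big rmorph_sum; apply: eq_bigr => j _.
rewrite mxE rmorph_sum; apply: eq_bigr => i _.
by rewrite adjmxE conj_mul.
Qed.

Lemma fro_ge0 m n (M : 'M[C]_(m, n)) : 0 <= fro M.
Proof. by do 2![apply: sumr_ge0 => ? _]; apply: sqn_ge0. Qed.

Lemma fro_adj m n (M : 'M[C]_(m, n)) : fro (adjmx M) = fro M.
Proof.
rewrite /fro exchange_big; apply: eq_bigr => i _; apply: eq_bigr => j _.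
by rewrite adjmxE sqn_conj.
Qed.

Lemma fro_isom m n p (U : 'M[C]_(m, n)) (M : 'M[C]_(n, p)) :
  adjmx U *m U = 1%:M -> fro (U *m M) = fro M.
Proof.
move=> UU; apply: (@complexI R); rewrite !froE adjmxM mulmxA.
by rewrite -(mulmxA (adjmx M)) UU mulmx1.
Qed.

Lemma fro_isomr m n p (U : 'M[C]_(m, n)) (M : 'M[C]_(p, m)) :
  U *m adjmx U = 1%:M -> fro (M *m U) = fro M.
Proof.
by move=> UU; rewrite -fro_adj adjmxM fro_isom ?adjmxK // fro_adj.
Qed.

Definition contrmx m n (V : 'M[C]_(m, n)) : Prop :=
  forall p (M : 'M[C]_(n, p)), fro (V *m M) <= fro M.

(** Expand the squared norm of M - V Y with [Y] = V^dagger M: it is [fro M] - 2 [fro Y] +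
    [fro (V *m Y)], and the last term is at most [fro Y]. *)
Lemma contrmx_adj m n (V : 'M[C]_(m, n)) : contrmx V -> contrmx (adjmx V).
Proof.
move=> cV p M; set Y := adjmx V *m M.
have h : fro (M - V *m Y) = fro M - 2 * fro Y + fro (V *m Y).
  apply: (@complexI R); rewrite raddfD raddfB /= rmorphM /= !froE.
  rewrite adjmxB mulmxBr !mulmxBl !raddfB /=.
  have -> : \tr (adjmx M *m (V *m Y)) = \tr (adjmx Y *m Y).
    by rewrite /Y !adjmxM adjmxK !mulmxA.
  have -> : \tr (adjmx (V *m Y) *m M) = \tr (adjmx Y *m Y).
    by rewrite adjmxM -mulmxA.
  by rewrite rmorph_nat; ring.
have := fro_ge0 (M - V *m Y); rewrite h; have := cV _ Y; lra.
Qed.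

Lemma contrmxM m n p (V : 'M[C]_(m, n)) (W : 'M[C]_(n, p)) :
  contrmx V -> contrmx W -> contrmx (V *m W).
Proof.
by move=> cV cW q M; rewrite -mulmxA (le_trans (cV _ _)).
Qed.

End Adjoint.

Section Spectral.
Variable R : realType.
Local Notation C := (complex R).
Local Notation "x %:C" := (real_complex R x).

Section One.
Variable n : nat.
Implicit Types G H : 'M[C]_n.

Definition ev G (i : 'I_n) : R := complex.Re (spectral_diag G 0 i).
Definition evec G : 'M[C]_n := spectralmx G.

Lemma evec_unitl G : evec G *m adjmx (evec G) = 1%:M.
Proof.
have /unitarymxP := spectral_unitarymx G.
by rewrite /adjmx map_trmx.
Qed.

Lemma evec_unitr G : adjmx (evec G) *m evec G = 1%:M.
Proof. exact: (mulmx1C (evec_unitl G)). Qed.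

Lemma psd_spec G : psdmx G -> G = adjmx (evec G) *m rdiag (ev G) *m evec G.
Proof.
case=> hG _; have hH : G \is hermsymmx.
  by apply/is_hermitianmxP; rewrite expr0 scale1r -[LHS]hG /adjmx map_trmx.
have /orthomx_spectralP Geq := hermitian_normalmx hH.
have E : invmx (evec G) = adjmx (evec G).
  by rewrite /adjmx map_trmx; exact: invmx_unitary (spectral_unitarymx G).
have Ed : diag_mx (spectral_diag G) = rdiag (ev G).
  congr diag_mx; apply/matrixP=> i j; rewrite mxE ord1.
  have /mxOverP/(_ 0 j) := hermitian_spectral_diag_real hH.
  by move=> /RRe_real.
have Geq2 : G = invmx (evec G) *m diag_mx (spectral_diag G) *m evec G.
  exact: Geq.
rewrite E in Geq2.
rewrite Ed in Geq2.
exact: Geq2.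
Qed.

Lemma psd_diag G : psdmx G -> evec G *m G *m adjmx (evec G) = rdiag (ev G).
Proof.
move=> /psd_spec {2}->.
by rewrite !mulmxA evec_unitl mul1mx -mulmxA evec_unitl mulmx1.
Qed.

Lemma ev_ge0 G i : psdmx G -> 0 <= ev G i.
Proof.
move=> pG; have := psd_diag pG; case: pG => _ pG.
move=> /matrixP/(_ i i); rewrite rdiagE eqxx mulr1n.
have -> : (evec G *m G *m adjmx (evec G)) i i
   = (adjmx (adjmx (row i (evec G))) *m G *m adjmx (row i (evec G))) 0 0.
  rewrite adjmxK -!row_mul !mxE; apply: eq_bigr => j _.
  by rewrite !mxE.
by move=> h; have := pG (adjmx (row i (evec G))); rewrite h ler0c.
Qed.

Lemma ev_tr G : psdmx G -> \tr G = (\sum_i ev G i)%:C.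
Proof.
move=> pG; rewrite {1}(psd_spec pG) mxtrace_mulC mulmxA evec_unitl mul1mx.
rewrite rmorph_sum; apply: eq_bigr => i _.
by rewrite rdiagE eqxx.
Qed.

Lemma psd_gram m (M : 'M[C]_(m, n)) : psdmx (adjmx M *m M).
Proof.
split; first by rewrite adjmxM adjmxK.
move=> v.
have -> : adjmx v *m (adjmx M *m M) *m v = adjmx (M *m v) *m (M *m v).
  by rewrite adjmxM !mulmxA.
rewrite mxE sumr_ge0 // => i _.
by rewrite adjmxE conj_mul ler0c sqn_ge0.
Qed.

Lemma psd_factor G : psdmx G -> exists M : 'M[C]_n, G = adjmx M *m M.
Proof.
move=> pG; exists (rdiag (fun i => Num.sqrt (ev G i)) *m evec G).
rewrite adjmxM adj_rdiag mulmxA -(mulmxA (adjmx _)) rdiagM.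
have -> : rdiag (fun i => Num.sqrt (ev G i) * Num.sqrt (ev G i)) = rdiag (ev G).
  by apply/matrixP=> i j; rewrite !rdiagE -expr2 sqr_sqrtr // ev_ge0.
exact: psd_spec.
Qed.

(** The squared overlaps of two eigenbases form a doubly stochastic matrix, and tr f(G) g(H) is the
    sum of [ovl G H i j] f([ev G i]) g([ev H j]). Inequalities between noncommuting matrices thus
    reduce to scalar ones, one for each pair (i, j). *)
Definition ovl G H i j : R := sqn ((evec G *m adjmx (evec H)) i j).

Lemma ovl_ge0 G H i j : 0 <= ovl G H i j.
Proof. exact: sqn_ge0. Qed.

Lemma sum_sqn_row (U : 'M[C]_n) i : U *m adjmx U = 1%:M ->
  \sum_j sqn (U i j) = 1.
Proof.
move=> /matrixP/(_ i i); rewrite !mxE eqxx => h; apply: (@complexI R).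
rewrite rmorph_sum rmorph1; move: h; rewrite mulr1n => <-.
by apply: eq_bigr => j _; rewrite adjmxE mulrC conj_mul.
Qed.

Lemma ovl_row G H i : \sum_j ovl G H i j = 1.
Proof.
apply: sum_sqn_row; rewrite adjmxM adjmxK mulmxA -(mulmxA (evec G)).
by rewrite evec_unitr mulmx1 evec_unitl.
Qed.

Lemma ovlC G H i j : ovl G H i j = ovl H G j i.
Proof.
rewrite /ovl.
have -> : evec H *m adjmx (evec G) = adjmx (evec G *m adjmx (evec H)).
  by rewrite adjmxM adjmxK.
by rewrite adjmxE sqn_conj.
Qed.

Lemma ovl_col G H j : \sum_i ovl G H i j = 1.
Proof. by rewrite -[RHS](ovl_row H G j); apply: eq_bigr => i _; apply: ovlC. Qed.

Lemma ovl_id G i j : ovl G G i j = (i == j)%:R.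
Proof. by rewrite /ovl evec_unitl mxE -(rmorph_nat (real_complex R)) sqn_real; case: eqP; rewrite ?expr0n ?expr1n. Qed.

Lemma diag_ovl G H j : psdmx G ->
  (evec H *m G *m adjmx (evec H)) j j = (\sum_i ev G i * ovl G H i j)%:C.
Proof.
move=> /psd_spec {1}->.
have -> : evec H *m (adjmx (evec G) *m rdiag (ev G) *m evec G) *m adjmx (evec H)
  = adjmx (evec G *m adjmx (evec H)) *m (rdiag (ev G) *m (evec G *m adjmx (evec H))).
  by rewrite adjmxM adjmxK !mulmxA.
rewrite mxE rmorph_sum; apply: eq_bigr => i _.
by rewrite mul_rdiag_mx adjmxE mulrCA conj_mul -rmorphM.
Qed.

End One.
End Spectral.

(** * Uhlmann's theorem and relative entropy *)

Section Divergence.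
Variable R : realType.
Local Notation C := (complex R).
Local Notation "x %:C" := (real_complex R x).

(* The Hellinger-type divergence Tr (sqrt G - sqrt H)^2. *)
Definition gd n (G H : 'M[C]_n) : R :=
  \sum_i \sum_j ovl G H i j * (Num.sqrt (ev G i) - Num.sqrt (ev H j)) ^+ 2.

Lemma gd_ge0 n (G H : 'M[C]_n) : 0 <= gd G H.
Proof.
by do 2![apply: sumr_ge0 => ? _]; rewrite mulr_ge0 ?sqr_ge0 ?ovl_ge0.
Qed.

Lemma gdC n (G H : 'M[C]_n) : gd G H = gd H G.
Proof.
rewrite /gd exchange_big; apply: eq_bigr => i _; apply: eq_bigr => j _.
by rewrite ovlC -sqrrN opprB.
Qed.

Lemma diag_gram0 m n (A : 'M[C]_(m, n)) f :
  adjmx A *m A = rdiag f -> forall i j, f j = 0 -> A i j = 0.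
Proof.
move=> /matrixP h i j fj; have := h j j; rewrite rdiagE fj eqxx mulr1n mxE.
under eq_bigr => k _ do rewrite adjmxE conj_mul.
rewrite -rmorph_sum => /(@complexI R) /eqP.
rewrite psumr_eq0 => [/allP/(_ i (mem_index_enum i))/eqP /sqn_eq0 //|k _].
exact: sqn_ge0.
Qed.

(** In the eigenbasis of the Gram matrix the columns of M are orthogonal; dividing each by its norm
    gives the partial isometry [W]. The last clause says that W^dagger W fixes the range of the
    diagonal factor. *)
Lemma polar m n (M : 'M[C]_(m, n)) : exists W : 'M[C]_(m, n),
  let G := adjmx M *m M in
  [/\ contrmx W,
      M = W *m rdiag (fun i => Num.sqrt (ev G i)) *m evec G &
      adjmx W *m W *m rdiag (fun i => Num.sqrt (ev G i))
        = rdiag (fun i => Num.sqrt (ev G i))].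
Proof.
set G := adjmx M *m M; have pG : psdmx G := psd_gram M.
set s := fun i => Num.sqrt (ev G i).
have ss i : s i * s i = ev G i by rewrite -expr2 sqr_sqrtr // ev_ge0.
set M' := M *m adjmx (evec G).
have gM' : adjmx M' *m M' = rdiag (ev G).
  by rewrite -psd_diag // /M' adjmxM adjmxK /G !mulmxA.
(* By the convention 0^-1 = 0 the zero columns of [M'] stay zero, so [W] is a contraction even when
   it is not an isometry. *)
pose W := M' *m rdiag (fun i => (s i)^-1).
have Ws : W *m rdiag s = M'.
  apply/matrixP=> i j; rewrite /W -mulmxA rdiagM mul_mx_rdiag.
  have [sj|sj] := eqVneq (s j) 0; last by rewrite mulVf // mulr1.
  by rewrite (diag_gram0 gM') ?mul0r // -ss sj mul0r.
have gW : adjmx W *m W = rdiag (fun i => (s i != 0)%:R).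
  rewrite /W adjmxM adj_rdiag mulmxA -(mulmxA (rdiag _)) gM' !rdiagM.
  apply/matrixP=> i j; rewrite !rdiagE -ss; congr (_%:C *+ _).
  have [->|h] := eqVneq (s i) 0; first by rewrite invr0 !mul0r.
  by rewrite mulrA mulVf // mul1r mulfV.
have idP : rdiag (fun i => (s i != 0)%:R * (s i != 0)%:R)
    = rdiag (fun i => (s i != 0)%:R) :> 'M[C]_n.
  by apply/matrixP=> i j; rewrite !rdiagE; case: (s i != 0); rewrite ?mul0r ?mul1r.
clearbody W; exists W; split.
- move=> p N; have -> : fro (W *m N) = fro (rdiag (fun i => (s i != 0)%:R) *m N).
    apply: (@complexI R); rewrite !froE !adjmxM adj_rdiag !mulmxA.
    rewrite -(mulmxA (adjmx N) (adjmx W)) gW -(mulmxA (adjmx N) (rdiag _) (rdiag _)) rdiagM.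
    by rewrite idP.
  apply: ler_sum => i _; apply: ler_sum => j _; rewrite mul_rdiag_mx sqnM.
  rewrite sqn_real ler_piMl ?sqn_ge0 //.
  by case: (s i != 0); rewrite ?expr0n ?expr1n.
- by rewrite Ws /M' -mulmxA evec_unitr mulmx1.
- rewrite gW rdiagM; apply/matrixP=> i j; rewrite !rdiagE.
  congr (_%:C *+ _); rewrite -/(s i).
  by have [->|_] := eqVneq (s i) 0; rewrite ?mulr0 ?mul1r.
Qed.

Lemma mxBE m n (A B : 'M[C]_(m, n)) i j : (A - B) i j = A i j - B i j.
Proof. by rewrite !mxE. Qed.

(** In its uses X changes one eigenbasis into the other and D, D' hold square roots of eigenvalues.
    The entries of X D - D' X are then overlap amplitudes times differences of these roots, which is
    how [gd] arises. *)
Lemma polar_move m m' n (W : 'M[C]_(m, n)) (Z : 'M[C]_(m', n))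
    (D D' E X : 'M[C]_n) : adjmx W *m W *m D = D ->
  Z *m X *m adjmx W *m (W *m D *m E) - Z *m D' *m (X *m E)
    = Z *m ((X *m D - D' *m X) *m E).
Proof.
move=> WD; have -> : Z *m X *m adjmx W *m (W *m D *m E)
    = Z *m (X *m (adjmx W *m W *m D) *m E) by rewrite !mulmxA.
have -> : Z *m D' *m (X *m E) = Z *m (D' *m X *m E) by rewrite !mulmxA.
by rewrite WD -mulmxBr -mulmxBl.
Qed.

(* With polar decompositions M = W |M| and N = Z |N|, the contraction is
   Z W^dagger, which attains the overlap tr (|M| |N|) of the two purifications. *)
Lemma uhlmann m m' n (M : 'M[C]_(m, n)) (N : 'M[C]_(m', n)) :
  exists V : 'M[C]_(m', m), [/\ contrmx V,
    fro (V *m M - N) <= gd (adjmx M *m M) (adjmx N *m N) &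
    fro (adjmx V *m N - M) <= gd (adjmx M *m M) (adjmx N *m N)].
Proof.
have [W [cW Meq gW]] := polar M; have [Z [cZ Neq gZ]] := polar N.
move: Meq Neq gW gZ; set G := adjmx M *m M; set H := adjmx N *m N.
set DG := rdiag _; set DH := rdiag _ => Meq Neq gW gZ.
pose X := evec G *m adjmx (evec H).
have cu p (U : 'M[C]_p) : adjmx U *m U = 1%:M -> contrmx U.
  by move=> h q A; rewrite fro_isom.
have cX' : contrmx (adjmx X).
  apply: cu; rewrite adjmxK /X adjmxM adjmxK mulmxA.
  by rewrite -(mulmxA (evec G)) evec_unitr mulmx1 evec_unitl.
have XE : adjmx X *m evec G = evec H.
  by rewrite /X adjmxM adjmxK -mulmxA evec_unitr mulmx1.
have XE' : X *m evec H = evec G.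
  by rewrite /X -mulmxA evec_unitr mulmx1.
exists (Z *m adjmx X *m adjmx W); split.
- apply: contrmxM; last exact: contrmx_adj.
  by apply: contrmxM; [exact: cZ | exact: cX'].
- have -> : Z *m adjmx X *m adjmx W *m M - N
     = Z *m ((adjmx X *m DG - DH *m adjmx X) *m evec G).
    by move: (polar_move Z DH (evec G) (adjmx X) gW); rewrite XE -Meq -Neq.
  apply: (le_trans (cZ _ _)); rewrite fro_isomr ?evec_unitl //.
  rewrite gdC; apply: ler_sum => j _; apply: ler_sum => i _.
  rewrite mxBE mul_mx_rdiag mul_rdiag_mx.
  rewrite ovlC /ovl -/X adjmxE mulrC -mulrBl -rmorphB sqnM sqn_conj sqn_real.
  by rewrite -sqrrN opprB mulrC.
- have -> : adjmx (Z *m adjmx X *m adjmx W) *m N - M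
     = W *m ((X *m DH - DG *m X) *m evec H).
    rewrite !adjmxM !adjmxK mulmxA.
    by move: (polar_move W DG (evec H) X gZ); rewrite XE' -Meq -Neq.
  apply: (le_trans (cW _ _)); rewrite fro_isomr ?evec_unitl //.
  apply: ler_sum => i _; apply: ler_sum => j _.
  rewrite mxBE mul_mx_rdiag mul_rdiag_mx mulrC -mulrBl -rmorphB.
  by rewrite sqnM sqn_real -sqrrN opprB mulrC.
Qed.

(** This is tr G ln G, minus the entropy, and [cross G H] is tr G ln H, so that their difference is
    the relative entropy. Since [ln] is 0 at 0, that reading is correct only if the support of G
    lies in that of H, which is extracted from [mxle] below. *)
Definition Ent n (G : 'M[C]_n) : R := \sum_i ev G i * ln (ev G i).

Definition cross n (G H : 'M[C]_n) : R :=
  \sum_j complex.Re ((evec H *m G *m adjmx (evec H)) j j) * ln (ev H j).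

Lemma crossE n (G H : 'M[C]_n) : psdmx G ->
  cross G H = \sum_i \sum_j ovl G H i j * (ev G i * ln (ev H j)).
Proof.
move=> pG; rewrite exchange_big; apply: eq_bigr => j _ /=.
rewrite diag_ovl // mulr_suml; apply: eq_bigr => i _.
by rewrite mulrA (mulrC (ovl _ _ _ _)).
Qed.

Lemma cross_id n (G : 'M[C]_n) : psdmx G -> cross G G = Ent G.
Proof.
move=> pG; rewrite crossE //; apply: eq_bigr => i _.
rewrite (bigD1 i) //= ovl_id eqxx mul1r big1 ?addr0 // => j ji.
by rewrite ovl_id eq_sym (negbTE ji) mul0r.
Qed.

Lemma cross_sum n (I : finType) (p : I -> R) (G : I -> 'M[C]_n) H :
  cross (\sum_i (p i)%:C *: G i) H = \sum_i p i * cross (G i) H.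
Proof.
rewrite /cross; under [RHS]eq_bigr do rewrite mulr_sumr.
rewrite exchange_big; apply: eq_bigr => j _ /=.
rewrite mulmx_sumr mulmx_suml summxE raddf_sum mulr_suml /=.
apply: eq_bigr => i _.
rewrite -scalemxAr -scalemxAl mxE mulrA; congr (_ * _).
by case: (_ j j) => a b /=; rewrite mul0r subr0.
Qed.

Lemma EntE n (G H : 'M[C]_n) :
  Ent G = \sum_i \sum_j ovl G H i j * (ev G i * ln (ev G i)).
Proof.
by apply: eq_bigr => i _; rewrite -mulr_suml ovl_row mul1r.
Qed.

Definition mxle n (G H : 'M[C]_n) : Prop := forall v : 'cV[C]_n,
  complex.Re ((adjmx v *m G *m v) 0 0) <= complex.Re ((adjmx v *m H *m v) 0 0).

Lemma form_spec n (G : 'M[C]_n) (v : 'cV[C]_n) : psdmx G ->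
  complex.Re ((adjmx v *m G *m v) 0 0)
    = \sum_i ev G i * sqn ((evec G *m v) i 0).
Proof.
move=> /psd_spec h; rewrite {1}h.
have -> : adjmx v *m (adjmx (evec G) *m rdiag (ev G) *m evec G) *m v
   = adjmx (evec G *m v) *m (rdiag (ev G) *m (evec G *m v)).
  by rewrite adjmxM !mulmxA.
rewrite mxE raddf_sum; apply: eq_bigr => i _ /=.
by rewrite mul_rdiag_mx adjmxE mulrCA conj_mul -rmorphM.
Qed.

Lemma evec_adj_col n (G H : 'M[C]_n) i j :
  (evec G *m col j (adjmx (evec H))) i 0 = (evec G *m adjmx (evec H)) i j.
Proof. by rewrite !mxE; apply: eq_bigr => k _; rewrite !mxE. Qed.

(** Test the domination on the [j]-th eigenvector of H: the right side vanishes, so each of the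
    nonnegative terms on the left does. *)
Lemma mxle_supp n (G H : 'M[C]_n) c i j : psdmx G -> psdmx H ->
  mxle ((c : R)%:C *: G) H -> 0 < c -> ev H j = 0 -> ovl G H i j * ev G i = 0.
Proof.
move=> pG pH le c0 hj; have := le (col j (adjmx (evec H))).
rewrite [leRHS]form_spec // -scalemxAr -scalemxAl.
rewrite [X in complex.Re X]mxE.
have -> (z : C) : complex.Re (c%:C * z) = c * complex.Re z.
  by case: z => a b /=; rewrite mul0r subr0.
rewrite form_spec // [leRHS](_ : _ = 0); last first.
  apply: big1 => k _; rewrite evec_adj_col evec_unitl mxE.
  by have [->|] := eqVneq k j; rewrite ?hj ?mul0r // sqn0 mulr0.
move=> le0; apply/eqP; rewrite eq_le; apply/andP; split; last first.
  by rewrite mulr_ge0 ?ovl_ge0 ?ev_ge0.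
rewrite -(ler_pM2l c0) mulr0 (le_trans _ le0) // ler_pM2l //.
rewrite (bigD1 i) //= evec_adj_col -/(ovl G H i j) mulrC lerDl.
by apply: sumr_ge0 => k _; rewrite mulr_ge0 ?sqn_ge0 ?ev_ge0.
Qed.

Lemma sum_ovl_l n (G H : 'M[C]_n) (f : 'I_n -> R) :
  \sum_i \sum_j ovl G H i j * f i = \sum_i f i.
Proof. by apply: eq_bigr => i _; rewrite -mulr_suml ovl_row mul1r. Qed.

Lemma sum_ovl_r n (G H : 'M[C]_n) (f : 'I_n -> R) :
  \sum_i \sum_j ovl G H i j * f j = \sum_j f j.
Proof.
by rewrite exchange_big; apply: eq_bigr => i _; rewrite -mulr_suml ovl_col mul1r.
Qed.

Lemma ln_le_subr1 (x : R) : 0 < x -> ln x <= x - 1.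
Proof. by move=> x0; have := expR_ge1Dx (ln x); rewrite lnK ?posrE //; lra. Qed.

(** With x, y the square roots of a, b this is ln (y / x) <= y / x - 1 multiplied by 2 x^2. Passing
    to square roots before linearising leaves exactly the term (x - y)^2. *)
Lemma kl_hellinger (a b : R) : 0 <= a -> 0 < b ->
  (Num.sqrt a - Num.sqrt b) ^+ 2 + a - b <= a * ln a - a * ln b.
Proof.
rewrite le0r => /orP[/eqP-> | a0] b0.
  rewrite !mul0r subrr sqrtr0 sub0r sqrrN sqr_sqrtr ?(ltW b0) // addr0 subrr //.
set x := Num.sqrt a; set y := Num.sqrt b.
have x0 : 0 < x by rewrite sqrtr_gt0.
have y0 : 0 < y by rewrite sqrtr_gt0.
have ea : a = x ^+ 2 by rewrite sqr_sqrtr ?ltW.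
have eb : b = y ^+ 2 by rewrite sqr_sqrtr ?ltW.
rewrite ea eb !lnXn // -mulrBr.
have : ln (y / x) <= y / x - 1 by apply: ln_le_subr1; rewrite divr_gt0.
rewrite ln_div ?posrE // => h.
have : x ^+ 2 * (ln y - ln x) <= x ^+ 2 * (y / x - 1).
  by rewrite ler_wpM2l ?sqr_ge0.
have -> : x ^+ 2 * (y / x - 1) = x * y - x ^+ 2 by field; rewrite gt_eqF.
move=> h2.
have -> : (x - y) ^+ 2 + x ^+ 2 - y ^+ 2 = - ((x * y - x ^+2) *+ 2) by ring.
have -> : x ^+ 2 * (ln x *+ 2 - ln y *+ 2)
  = - ((x ^+ 2 * (ln y - ln x)) *+ 2) by ring.
by rewrite lerN2 lerMn2r h2 orbT.
Qed.

(** The function a ln a lies above its tangent at c b. For b = 1 this is the tangent at c, the form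
    that later linearises - p ln p. *)
Lemma kl_scaled (a b c : R) : 0 <= a -> 0 < b -> 0 < c ->
  a * ln c + a - c * b <= a * ln a - a * ln b.
Proof.
rewrite le0r => /orP[/eqP-> | a0] b0 c0.
  by rewrite !mul0r subrr !add0r oppr_le0 mulr_ge0 // ltW.
have : ln (c * b / a) <= c * b / a - 1.
  by apply: ln_le_subr1; rewrite divr_gt0 // mulr_gt0.
rewrite ln_div ?posrE ?mulr_gt0 // lnM ?posrE // => h.
have : a * (ln c + ln b - ln a) <= a * (c * b / a - 1) by rewrite ler_wpM2l // ltW.
have -> : a * (c * b / a - 1) = c * b - a by field; rewrite gt_eqF.
lra.
Qed.

(** [kl_hellinger] holds for each pair of eigenvalues and is averaged with the weights [ovl]. Up to
    a difference of traces, the squared distance in Uhlmann's theorem is thus paid for by a relative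
    entropy. *)
Lemma Ent_cross_gd n (G H : 'M[C]_n) c : psdmx G -> psdmx H ->
  mxle ((c : R)%:C *: G) H -> 0 < c ->
  gd G H + \sum_i ev G i - \sum_j ev H j <= Ent G - cross G H.
Proof.
move=> pG pH le c0; rewrite (EntE G H) crossE // -(sum_ovl_l G H (ev G)).
rewrite -(sum_ovl_r G H (ev H)) -!sumrB -big_split -sumrB /=.
apply: ler_sum => i _; rewrite -!sumrB -big_split -sumrB /=.
apply: ler_sum => j _; rewrite -!mulrBr -mulrDr -mulrBr.
have := ev_ge0 j pH; rewrite le0r => /orP[/eqP hj|hj].
  have h0 := mxle_supp i pG pH le c0 hj.
  rewrite hj (@ln0 R 0) // sqrtr0 !subr0 sqr_sqrtr ?ev_ge0 //.
  by rewrite mulrDr h0 addr0 mulrA h0 mul0r.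
apply: ler_wpM2l; first exact: ovl_ge0.
by rewrite mulrBr; apply: kl_hellinger => //; apply: ev_ge0.
Qed.

(** Klein's inequality after rescaling H by the trace t of G: [kl_scaled] is used with c = t, and
    the remainder t - t tr H is nonnegative. *)
Lemma Ent_cross_ge n (G H : 'M[C]_n) c : psdmx G -> psdmx H ->
  mxle ((c : R)%:C *: G) H -> 0 < c -> \sum_j ev H j <= 1 ->
  (\sum_i ev G i) * ln (\sum_i ev G i) <= Ent G - cross G H.
Proof.
move=> pG pH le c0 trH; set t := \sum_i ev G i.
have : 0 <= t by apply: sumr_ge0 => i _; apply: ev_ge0.
rewrite le0r => /orP[/eqP t0|t0].
  have h i : ev G i = 0.
    apply/eqP; move: (t0) => /eqP; rewrite psumr_eq0; last by move=> k _; apply: ev_ge0.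
    by move=> /allP/(_ i (mem_index_enum i)).
  rewrite t0 mul0r /Ent crossE // !big1 ?subrr // => i _; last by rewrite h mul0r.
  by apply: big1 => j _; rewrite h mul0r mulr0.
have : t * ln t + t - t * (\sum_j ev H j) <= Ent G - cross G H.
  rewrite (EntE G H) crossE // -(sum_ovl_r G H (ev H)) mulr_sumr.
  rewrite {1 3}/t -(sum_ovl_l G H (ev G)) mulr_suml -big_split -!sumrB /=.
  apply: ler_sum => i _; rewrite mulr_suml mulr_sumr -big_split -!sumrB /=.
  apply: ler_sum => j _; set o := ovl G H i j; rewrite -mulrBr.
  have -> : o * ev G i * ln t + o * ev G i - t * (o * ev H j)
    = o * (ev G i * ln t + ev G i - t * ev H j) by ring.
  have := ev_ge0 j pH; rewrite le0r => /orP[/eqP hj|hj].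
    have h0 := mxle_supp i pG pH le c0 hj.
    by rewrite hj (@ln0 R 0) // !mulr0 !subr0 mulrDr !mulrA h0 !mul0r addr0.
  apply: ler_wpM2l; first exact: ovl_ge0.
  by apply: kl_scaled => //; apply: ev_ge0.
have : t * (\sum_j ev H j) <= t * 1 by rewrite ler_wpM2l // ltW.
lra.
Qed.

(* If G <= H then G's eigenvalue l on a unit eigenvector e satisfies
   l <e, H^-1 e> <= 1, by testing l |e><e| <= H against H^-1 e. *)
Lemma ev_mul_inv_le n (G H : 'M[C]_n) i : psdmx G -> psdmx H -> mxle G H ->
  ev G i * (\sum_j ovl G H i j / ev H j) <= 1.
Proof.
move=> pG pH le; pose e := adjmx (row i (evec G)).
pose w := evec H *m e.
have sw j : sqn (w j 0) = ovl G H i j.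
  rewrite ovlC /w /e /ovl; congr (sqn _); rewrite !mxE; apply: eq_bigr => k _.
  by rewrite !adjmxE mxE.
pose v := adjmx (evec H) *m (rdiag (fun j => (ev H j)^-1) *m w).
set t := \sum_j _.
have vH : complex.Re ((adjmx v *m H *m v) 0 0) = t.
  rewrite form_spec //; apply: eq_bigr => j _.
  rewrite /v mulmxA evec_unitl mul1mx mul_rdiag_mx sqnM sqn_real sw.
  have [->|h] := eqVneq (ev H j) 0; first by rewrite invr0 !mul0r mulr0.
  by field.
have vG : ev G i * t ^+ 2 <= complex.Re ((adjmx v *m G *m v) 0 0).
  rewrite form_spec // (bigD1 i) //= ler_wpDr //.
    by apply: sumr_ge0 => k _; rewrite mulr_ge0 ?sqn_ge0 ?ev_ge0.
  rewrite ler_wpM2l ?ev_ge0 // le_eqVlt; apply/orP; left.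
  have -> : (evec G *m v) i 0 = t%:C; last by rewrite sqn_real.
  have -> : (evec G *m v) i 0 = (adjmx e *m v) 0 0.
    by rewrite /e adjmxK -row_mul !mxE.
  have -> : adjmx e *m v = adjmx w *m (rdiag (fun j => (ev H j)^-1) *m w).
    by rewrite /v /w adjmxM !mulmxA.
  rewrite mxE rmorph_sum; apply: eq_bigr => j _.
  by rewrite mul_rdiag_mx adjmxE mulrCA conj_mul -rmorphM sw mulrC.
have : ev G i * t ^+ 2 <= t by rewrite (le_trans vG) // -vH.
have : 0 <= t by apply: sumr_ge0 => j _; rewrite mulr_ge0 ?ovl_ge0 ?invr_ge0 ?ev_ge0.
rewrite le0r => /orP[/eqP->|t0]; first by rewrite mulr0.
by rewrite expr2 mulrA -[leRHS]mul1r ler_pM2r.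
Qed.

(** This usually rests on the operator monotonicity of the logarithm. Here ln x <= x - 1, applied to
    each ratio of eigenvalues, reduces it to tr G^2 H^-1 <= tr G, which is [ev_mul_inv_le] summed
    over the eigenvectors of G. *)
Lemma Ent_le_cross n (G H : 'M[C]_n) : psdmx G -> psdmx H -> mxle G H ->
  Ent G <= cross G H.
Proof.
move=> pG pH le; rewrite -subr_le0.
have le1 : mxle ((1 : R)%:C *: G) H by rewrite scale1r.
apply: (@le_trans _ _ (\sum_i ev G i * (ev G i * (\sum_j ovl G H i j / ev H j))
   - \sum_i ev G i)); last first.
  rewrite subr_le0 ler_sum // => i _.
  by rewrite -[leRHS]mulr1 ler_wpM2l ?ev_ge0 // ev_mul_inv_le.
rewrite (EntE G H) crossE // -(sum_ovl_l G H (ev G)) -!sumrB.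
apply: ler_sum => i _; rewrite !mulr_sumr -!sumrB; apply: ler_sum => j _.
have := ev_ge0 j pH; rewrite le0r => /orP[/eqP hj|hj].
  have h0 := mxle_supp i pG pH le1 ltr01 hj.
  by rewrite hj (@ln0 R 0) // invr0 !mulr0 mulrA h0 mul0r !subr0.
have := ev_ge0 i pG; rewrite le0r => /orP[/eqP ->|hi].
  by rewrite !mul0r !mulr0 !subr0.
set o := ovl _ _ _ _; rewrite -!mulrBr.
have -> : ev G i * (ev G i * (o / ev H j)) - o * ev G i
   = o * (ev G i * (ev G i / ev H j - 1)) by ring.
rewrite ler_wpM2l ?ovl_ge0 // ler_wpM2l ?ev_ge0 //.
by rewrite -ln_div ?posrE // ln_le_subr1 // divr_gt0.
Qed.

End Divergence.

(** * Superposed product inputs *)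

Section ProductMeasure.
Variable R : realType.

Definition isprob (V : finType) (p : V -> R) : Prop :=
  (forall v, 0 <= p v) /\ \sum_v p v = 1.

Definition dirac (V : finType) (v : V) : V -> R := fun v' => (v' == v)%:R.

Lemma isprob_dirac (V : finType) (v : V) : isprob (dirac v).
Proof.
split=> [w|]; first by rewrite ler0n.
by rewrite (bigD1 v) //= /dirac eqxx big1 ?addr0 // => w /negbTE ->.
Qed.

Lemma sum_dirac (V : finType) (v : V) (f : V -> R) :
  \sum_w dirac v w * f w = f v.
Proof.
rewrite (bigD1 v) //= /dirac eqxx mul1r big1 ?addr0 // => w /negbTE ->.
by rewrite mul0r.
Qed.

Variables (l : nat) (V : finType).
Implicit Types (p q : 'I_l -> V -> R) (x y w c : {ffun 'I_l -> V}).

Definition pm p x : R := \prod_j p j (x j).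

Definition upd x i v : {ffun 'I_l -> V} := [ffun j => if j == i then v else x j].

Definition updp p i m : 'I_l -> V -> R := fun j => if j == i then m else p j.

Definition mix (D : pred 'I_l) x y : {ffun 'I_l -> V} :=
  [ffun j => if D j then x j else y j].

Lemma pm_ge0 p x : (forall j, isprob (p j)) -> 0 <= pm p x.
Proof. by move=> hp; apply: prodr_ge0 => j _; case: (hp j). Qed.

Lemma sum_pm_prod p (a : 'I_l -> V -> R) :
  \sum_x pm p x * (\prod_j a j (x j)) = \prod_j \sum_v p j v * a j v.
Proof.
rewrite bigA_distr_bigA; apply: eq_bigr => x _; exact/esym/big_split.
Qed.

Lemma sum_pm p : (forall j, isprob (p j)) -> \sum_x pm p x = 1.
Proof.
move=> hp; transitivity (\sum_x pm p x * \prod_(j < l) 1).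
  by apply: eq_bigr => x _; rewrite big1_eq mulr1.
rewrite (sum_pm_prod p (fun _ _ => 1)); apply: big1 => j _.
by under eq_bigr do rewrite mulr1; case: (hp j).
Qed.

Lemma sum_pm_const p (r : R) : (forall j, isprob (p j)) -> \sum_x pm p x * r = r.
Proof. by move=> hp; rewrite -mulr_suml sum_pm // mul1r. Qed.

Lemma sum_pm_marg p i (f : V -> R) : (forall j, isprob (p j)) ->
  \sum_x pm p x * f (x i) = \sum_v p i v * f v.
Proof.
move=> hp; have := sum_pm_prod p (fun j v => if j == i then f v else 1).
rewrite [RHS](bigD1 i) //= eqxx [X in _ * X]big1 ?mulr1; last first.
  by move=> j /negbTE ->; under eq_bigr do rewrite mulr1; case: (hp j).
move=> <-; apply: eq_bigr => x _; congr (_ * _).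
by rewrite (bigD1 i) //= eqxx big1 ?mulr1 // => j /negbTE ->.
Qed.

Lemma mixK D x y : mix D (mix D x y) (mix D y x) = x.
Proof. by apply/ffunP=> j; rewrite !ffunE; case: (D j). Qed.

(** Exchanging the coordinates outside [D] between two independent samples preserves their joint
    law, because the marginals agree there. Resampling one coordinate and fixing a set of
    coordinates both follow from it. *)
Lemma sum_swap p q D (H : {ffun 'I_l -> V} -> {ffun 'I_l -> V} -> R) :
  (forall j, ~~ D j -> p j = q j) ->
  \sum_x \sum_y pm p x * pm q y * H x y
    = \sum_x \sum_y pm p x * pm q y * H (mix D x y) (mix D y x).
Proof.
move=> pq; rewrite !pair_bigA /=.
pose g (xy : {ffun 'I_l -> V} * {ffun 'I_l -> V}) :=
  (mix D xy.1 xy.2, mix D xy.2 xy.1).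
have gK : involutive g by case=> x y; rewrite /g /= !mixK.
rewrite (reindex_inj (inv_inj gK)); apply: eq_bigr => -[x y] _ /=.
congr (_ * _); rewrite /pm -!big_split; apply: eq_bigr => j _ /=.
rewrite !ffunE; case: ifPn => // /pq ->; exact: mulrC.
Qed.

Lemma sum_resample p i (F : {ffun 'I_l -> V} -> R) : (forall j, isprob (p j)) ->
  \sum_x pm p x * F x = \sum_x pm p x * \sum_v p i v * F (upd x i v).
Proof.
move=> hp; pose D j := j != i.
have E x : F x = \sum_y pm p y * F x by rewrite sum_pm_const.
under eq_bigr => x _ do rewrite E mulr_sumr.
under eq_bigr => x _ do under eq_bigr => y _ do rewrite mulrA.
rewrite (@sum_swap p p D (fun x _ => F x)) //; apply: eq_bigr => x _.
under eq_bigr => y _ do rewrite -mulrA.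
rewrite -mulr_sumr; congr (_ * _).
rewrite -(@sum_pm_marg p i (fun v => F (upd x i v))) //.
apply: eq_bigr => y _; congr (_ * F _); apply/ffunP=> j; rewrite !ffunE /D.
by case: eqVneq => [->|].
Qed.

Lemma pm_dirac_supp q D c x : (forall j, D j -> q j = dirac (c j)) ->
  pm q x != 0 -> forall j, D j -> x j = c j.
Proof.
move=> hq /prodf_neq0 h j Dj; have := h j isT.
by rewrite hq // /dirac; have [//|_] := eqVneq (x j) (c j); rewrite eqxx.
Qed.

Lemma sum_fix p q D c (h : {ffun 'I_l -> V} -> R) :
  (forall j, isprob (p j)) -> (forall j, ~~ D j -> q j = p j) ->
  (forall j, D j -> q j = dirac (c j)) ->
  \sum_x pm q x * h x = \sum_x pm p x * h (mix D c x).
Proof.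
move=> hp qp qc.
have hq j : isprob (q j).
  by case: (boolP (D j)) => [/qc -> | /qp -> //]; apply: isprob_dirac.
have E x : pm q x * h x = pm q x * h (mix D c x).
  have [->|nz] := eqVneq (pm q x) 0; first by rewrite !mul0r.
  congr (_ * h _); apply/ffunP=> j; rewrite ffunE; case: ifP => // Dj.
  exact: (pm_dirac_supp qc nz Dj).
under eq_bigr => x _ do rewrite E.
transitivity (\sum_x \sum_y pm q x * pm p y * h (mix D c x)).
  apply: eq_bigr => x _; under eq_bigr => y _ do rewrite -mulrA mulrCA.
  by rewrite sum_pm_const.
rewrite (@sum_swap q p D (fun x _ => h (mix D c x))) // exchange_big.
apply: eq_bigr => y _ /=; under eq_bigr => x _ do rewrite -mulrA.
have E2 x : h (mix D c (mix D x y)) = h (mix D c y).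
  by congr h; apply/ffunP=> j; rewrite !ffunE; case: (D j).
under eq_bigr => x _ do rewrite E2.
exact: sum_pm_const.
Qed.

Lemma pm_updp p i m x :
  pm (updp p i m) x = m (x i) * \prod_(j | j != i) p j (x j).
Proof.
rewrite /pm (bigD1 i) //= /updp eqxx; congr (_ * _).
by apply: eq_bigr => j /negbTE ->.
Qed.

Lemma pm_updp_sum p i m x :
  pm (updp p i m) x = \sum_v m v * pm (updp p i (dirac v)) x.
Proof.
under eq_bigr => v _ do rewrite pm_updp mulrA.
rewrite -mulr_suml pm_updp; congr (_ * _).
rewrite -[LHS](sum_dirac (x i) m); apply: eq_bigr => v _.
by rewrite mulrC /dirac eq_sym.
Qed.

Lemma updp_prob p i m : (forall j, isprob (p j)) -> isprob m ->
  forall j, isprob (updp p i m j).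
Proof. by move=> hp hm j; rewrite /updp; case: ifP. Qed.

End ProductMeasure.

(** * Entropy of an ensemble whose coordinates are revealed one by one *)

Section Telescope.
Variable R : realType.
Local Notation C := (complex R).
Local Notation "x %:C" := (real_complex R x).

Lemma psd_sum n (I : finType) (p : I -> R) (G : I -> 'M[C]_n) :
  (forall i, 0 <= p i) -> (forall i, psdmx (G i)) ->
  psdmx (\sum_i (p i)%:C *: G i).
Proof.
move=> p0 pG; split.
  rewrite adjmx_sum; apply: eq_bigr => i _; case: (pG i) => e _.
  rewrite -[in RHS]e.
  by apply/matrixP=> a b; rewrite !mxE rmorphM /= conj_realC.
move=> v; rewrite mulmx_sumr mulmx_suml summxE sumr_ge0 // => i _.
rewrite -scalemxAr -scalemxAl mxE mulr_ge0 ?ler0c //.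
by case: (pG i).
Qed.

Lemma Re_realM (c : R) (z : C) : complex.Re (c%:C * z) = c * complex.Re z.
Proof. by case: z => a b /=; rewrite mul0r subr0. Qed.

Lemma sum_ev n (G : 'M[C]_n) : psdmx G -> \sum_i ev G i = complex.Re (\tr G).
Proof. by move=> pG; rewrite ev_tr. Qed.

Lemma form_sum n (I : finType) (p : I -> R) (G : I -> 'M[C]_n) (v : 'cV[C]_n) :
  complex.Re ((adjmx v *m (\sum_i (p i)%:C *: G i) *m v) 0 0)
  = \sum_i p i * complex.Re ((adjmx v *m G i *m v) 0 0).
Proof.
rewrite mulmx_sumr mulmx_suml summxE raddf_sum; apply: eq_bigr => i _ /=.
by rewrite -scalemxAr -scalemxAl mxE Re_realM.
Qed.

Lemma form_ge0 n (G : 'M[C]_n) (v : 'cV[C]_n) : psdmx G ->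
  0 <= complex.Re ((adjmx v *m G *m v) 0 0).
Proof. by case=> _ /(_ v); rewrite lecE => /andP[]. Qed.

Lemma tr_sum n (I : finType) (p : I -> R) (G : I -> 'M[C]_n) :
  complex.Re (\tr (\sum_i (p i)%:C *: G i))
  = \sum_i p i * complex.Re (\tr (G i)).
Proof.
rewrite (raddf_sum (@mxtrace C n)) raddf_sum; apply: eq_bigr => i _ /=.
by rewrite mxtraceZ Re_realM.
Qed.

(* The relative entropies of the members of an ensemble with respect to its
   average add up to the concavity defect of the entropy. *)
Lemma Ent_mixture n (V : finType) (p : V -> R) (G : V -> 'M[C]_n) :
  isprob p -> (forall v, psdmx (G v)) ->
  \sum_v p v * gd (\sum_u (p u)%:C *: G u) (G v)
    <= \sum_v p v * Ent (G v) - Ent (\sum_u (p u)%:C *: G u).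
Proof.
move=> [p0 p1] pG; pose H := \sum_u (p u)%:C *: G u; rewrite -/H.
have pH : psdmx H by apply: psd_sum.
rewrite -(cross_id pH) {3}/H cross_sum -sumrB.
have h v : p v * (gd H (G v) + complex.Re (\tr (G v)) - complex.Re (\tr H))
     <= p v * Ent (G v) - p v * cross (G v) H.
  have := p0 v; rewrite le0r => /orP[/eqP->|pv]; first by rewrite !mul0r subrr.
  rewrite -mulrBr ler_pM2l // gdC -!sum_ev //.
  apply: (Ent_cross_gd (c := p v)) => // w.
  rewrite /H form_sum -scalemxAr -scalemxAl mxE Re_realM (bigD1 v) //=.
  rewrite lerDl sumr_ge0 // => u _; rewrite mulr_ge0 //; exact: form_ge0.
apply: le_trans (ler_sum _ (fun v _ => h v)).
rewrite le_eqVlt; apply/orP; left; apply/eqP.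
under [RHS]eq_bigr => v _ do rewrite -addrA mulrDr mulrBr.
rewrite big_split /= sumrB -(mulr_suml _ _ _ (complex.Re _)) p1 mul1r.
by rewrite /H tr_sum subrr addr0.
Qed.

Variables (l n : nat) (V : finType) (p : 'I_l -> V -> R).
Hypothesis hp : forall j, isprob (p j).
Variable rho : {ffun 'I_l -> V} -> 'M[C]_n.
Hypothesis prho : forall x, psdmx (rho x).

Definition lt_pred (k : nat) : pred 'I_l := fun j => (j < k)%N.

(** The conditional average given the first [k] coordinates, which are the only ones read from [w].
    For random [w] it is a martingale in [k]. *)
Definition avg k w : 'M[C]_n :=
  \sum_x (pm p x)%:C *: rho (mix (lt_pred k) w x).

Lemma psd_avg k w : psdmx (avg k w).
Proof. by apply: psd_sum => // x; apply: pm_ge0. Qed.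

Lemma sum_C (I : finType) (F : I -> R) : (\sum_i F i)%:C = \sum_i (F i)%:C.
Proof. exact: rmorph_sum. Qed.

Lemma avg_step (i : 'I_l) w :
  avg i w = \sum_v (p i v)%:C *: avg i.+1 (upd w i v).
Proof.
apply/matrixP=> a b; apply/eqP; rewrite eq_complex.
(* Resampling is stated for real sums, so the identity is proved for a real-linear [g] and then used
   with the real and the imaginary part. *)
have key (g : C -> R) : (forall (r : R) z, g (r%:C * z) = r * g z) ->
    (forall (I : finType) (F : I -> C), g (\sum_i F i) = \sum_i g (F i)) ->
    g (avg i w a b) = g ((\sum_v (p i v)%:C *: avg i.+1 (upd w i v)) a b).
  move=> gM gS; rewrite /avg summxE gS.
  under eq_bigr => x _ do rewrite mxE gM.
  rewrite (@sum_resample _ _ _ p i (fun x => g (rho (mix (lt_pred i) w x) a b))) //.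
  rewrite summxE gS.
  under [RHS]eq_bigr => v _ do rewrite mxE gM summxE gS mulr_sumr.
  rewrite [RHS]exchange_big; apply: eq_bigr => x _ /=; rewrite mulr_sumr.
  apply: eq_bigr => v _; rewrite mxE gM mulrCA; congr (_ * (_ * g (rho _ _ _))).
  apply/ffunP=> j; rewrite !ffunE /lt_pred ltnS.
  have [->|ji] := eqVneq j i; first by rewrite ltnn leqnn.
  by rewrite ltn_neqAle ji.
apply/andP; split; apply/eqP.
  apply: key; first exact: Re_realM.
  by move=> I F; rewrite raddf_sum.
apply: key; first by move=> r [c d] /=; rewrite mul0r addr0.
by move=> I F; rewrite raddf_sum.
Qed.

Definition entropy_at k : R := \sum_w pm p w * Ent (avg k w).

Lemma entropy_step (i : 'I_l) :
  \sum_w pm p w * \sum_v p i v * gd (avg i w) (avg i.+1 (upd w i v))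
   <= entropy_at i.+1 - entropy_at i.
Proof.
rewrite /entropy_at [X in _ <= X - _](sum_resample i) // -sumrB.
apply: ler_sum => w _; rewrite -mulrBr ler_wpM2l ?pm_ge0 //.
rewrite avg_step; apply: Ent_mixture => // v; exact: psd_avg.
Qed.

Variable sigma : 'M[C]_n.
Hypothesis psigma : psdmx sigma.
Hypothesis tr_sigma : complex.Re (\tr sigma) <= 1.
Hypothesis rho_le : forall x, mxle (rho x) sigma.

Definition mass : R := \sum_x pm p x * complex.Re (\tr (rho x)).

(** The two ends are compared through [sigma]. Domination bounds the final value by
    [cross rb sigma], with [rb] the overall average, and the relative entropy of [rb] to [sigma] is
    at least mass ln mass. The resulting bound does not involve the dimension. *)
Lemma entropy_total : entropy_at l - entropy_at 0 <= - (mass * ln mass).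
Proof.
have a0 w : avg 0 w = \sum_x (pm p x)%:C *: rho x.
  apply: eq_bigr => x _; congr (_ *: rho _).
  by apply/ffunP=> j; rewrite ffunE.
have al w : avg l w = rho w.
  transitivity (\sum_x (pm p x)%:C *: rho w).
    apply: eq_bigr => x _; congr (_ *: rho _).
    by apply/ffunP=> j; rewrite ffunE /lt_pred ltn_ord.
  by rewrite -scaler_suml -sum_C sum_pm // scale1r.
rewrite /entropy_at; under eq_bigr => w _ do rewrite al.
under [X in _ - X]eq_bigr => w _ do rewrite a0.
pose rb := \sum_x (pm p x)%:C *: rho x; rewrite -/rb sum_pm_const //.
have prb : psdmx rb by apply: psd_sum => // x; apply: pm_ge0.
have le1 : mxle ((1 : R)%:C *: rb) sigma.
  move=> v; rewrite scale1r /rb form_sum -[leRHS](@sum_pm_const _ _ _ p) //.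
  by apply: ler_sum => x _; rewrite ler_wpM2l ?pm_ge0 //; apply: rho_le.
have := Ent_cross_ge prb psigma le1 ltr01; rewrite !sum_ev // => /(_ tr_sigma).
rewrite {1 2}/rb tr_sum -/mass.
have : \sum_w pm p w * Ent (rho w) <= cross rb sigma.
  rewrite /rb cross_sum; apply: ler_sum => x _; rewrite ler_wpM2l ?pm_ge0 //.
  exact: Ent_le_cross.
lra.
Qed.

Lemma entropy_budget :
  \sum_(i < l) \sum_w pm p w * \sum_v p i v * gd (avg i w) (avg i.+1 (upd w i v))
    <= - (mass * ln mass).
Proof.
apply: le_trans entropy_total.
rewrite -(telescope_sumr entropy_at (leq0n l)) big_mkord.
by apply: ler_sum => i _; apply: entropy_step.
Qed.

End Telescope.

(** * Operators and states indexed by finite types *)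

Section FunMatrix.
Variable R : realType.
Local Notation C := (complex R).
Local Notation "x %:C" := (real_complex R x).

Definition nrm2 (I J : finType) (M : I -> J -> C) : R :=
  \sum_i \sum_j sqn (M i j).

Definition mulf (K I J : finType) (L : K -> I -> C) (M : I -> J -> C) :
  K -> J -> C := fun k j => \sum_i L k i * M i j.

Definition subf (I J : finType) (M N : I -> J -> C) : I -> J -> C :=
  fun i j => M i j - N i j.

Definition adjf (I J : finType) (M : I -> J -> C) : J -> I -> C :=
  fun j i => Num.conj (M i j).

Definition fmx (I J : finType) (M : I -> J -> C) : 'M[C]_(#|I|, #|J|) :=
  \matrix_(i, j) M (enum_val i) (enum_val j).

Definition mxf (I J : finType) (V : 'M[C]_(#|I|, #|J|)) : I -> J -> C :=
  fun i j => V (enum_rank i) (enum_rank j).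

Lemma mxfK (I J : finType) (V : 'M[C]_(#|I|, #|J|)) : fmx (mxf V) = V.
Proof. by apply/matrixP=> i j; rewrite mxE /mxf !enum_valK. Qed.

Lemma sum_enum_val (A : nmodType) (I : finType) (F : I -> A) :
  \sum_(i < #|I|) F (enum_val i) = \sum_i F i.
Proof. by rewrite -big_enum_val. Qed.

Lemma sum_pair (A : nmodType) (I J : finType) (F : I * J -> A) :
  \sum_p F p = \sum_i \sum_j F (i, j).
Proof. by rewrite pair_bigA; apply: eq_bigr => -[]. Qed.

Lemma fro_fmx (I J : finType) (M : I -> J -> C) : fro (fmx M) = nrm2 M.
Proof.
rewrite /fro /nrm2 -[RHS]sum_enum_val; apply: eq_bigr => i _.
by rewrite -[RHS]sum_enum_val; apply: eq_bigr => j _; rewrite mxE.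
Qed.

Lemma fmx_mulf (K I J : finType) (L : K -> I -> C) (M : I -> J -> C) :
  fmx (mulf L M) = fmx L *m fmx M.
Proof.
apply/matrixP=> k j; rewrite !mxE /mulf -[LHS]sum_enum_val.
by apply: eq_bigr => i _; rewrite !mxE.
Qed.

Lemma fmx_subf (I J : finType) (M N : I -> J -> C) :
  fmx (subf M N) = fmx M - fmx N.
Proof. by apply/matrixP=> k j; rewrite !mxE. Qed.

Lemma fmx_adjf (I J : finType) (M : I -> J -> C) : fmx (adjf M) = adjmx (fmx M).
Proof. by apply/matrixP=> k j; rewrite !mxE. Qed.

Lemma nrm_nrm2 (I : finType) (v : I -> C) : nrm v = nrm2 (fun i (_ : unit) => v i).
Proof. by apply: eq_bigr => i _; rewrite (big_pred1 tt) // => -[]. Qed.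

Lemma contrmx_fun (K I : finType) (V : 'M[C]_(#|K|, #|I|)) :
  contrmx V -> contr (mxf V).
Proof.
move=> cV v; have := cV _ (fmx (fun i (_ : unit) => v i)).
by rewrite -{1}(mxfK V) -fmx_mulf !fro_fmx -!nrm_nrm2.
Qed.

(** If [M i j] are the amplitudes of a bipartite vector, this is, up to transposition, its reduced
    state on the register [J]: all that matters for what can be reached by acting on [I] alone. *)
Definition gram (I J : finType) (M : I -> J -> C) : 'M[C]_#|J| :=
  adjmx (fmx M) *m fmx M.

Lemma gramE (I J : finType) (M : I -> J -> C) a b :
  gram M a b = \sum_i Num.conj (M i (enum_val a)) * M i (enum_val b).
Proof.
by rewrite mxE -[RHS]sum_enum_val; apply: eq_bigr => i _; rewrite adjmxE !mxE.
Qed.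

Lemma tr_gram (I J : finType) (M : I -> J -> C) : \tr (gram M) = (nrm2 M)%:C.
Proof. by rewrite /gram -froE fro_fmx. Qed.

Lemma mxle_gram (I I0 J : finType) (M : I -> J -> C) (N : I0 -> J -> C) :
  (forall v, nrm (app M v) <= nrm (app N v)) -> mxle (gram M) (gram N).
Proof.
move=> h v; have E (K : finType) (L : K -> J -> C) :
    complex.Re ((adjmx v *m gram L *m v) 0 0)
      = nrm (app L (fun j => v (enum_rank j) 0)).
  have -> : adjmx v *m gram L *m v = adjmx (fmx L *m v) *m (fmx L *m v).
    by rewrite /gram adjmxM !mulmxA.
  rewrite mxE raddf_sum /nrm -[RHS]sum_enum_val; apply: eq_bigr => k _ /=.
  rewrite adjmxE conj_mul /=; congr sqn.
  rewrite mxE /app -[RHS]sum_enum_val; apply: eq_bigr => j _.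
  by rewrite mxE enum_valK.
by rewrite !E.
Qed.

Lemma uhlmann_fun (I I' J : finType) (M : I -> J -> C) (N : I' -> J -> C) :
  exists V : I' -> I -> C, [/\ contr V, contr (adjf V),
    nrm2 (subf (mulf V M) N) <= gd (gram M) (gram N) &
    nrm2 (subf (mulf (adjf V) N) M) <= gd (gram M) (gram N)].
Proof.
have [V [cV h1 h2]] := uhlmann (fmx M) (fmx N).
exists (mxf V); split.
- exact: contrmx_fun.
- have -> : adjf (mxf V) = mxf (adjmx V).
    by apply: funext => i; apply: funext => j; rewrite /adjf /mxf adjmxE.
  by apply: contrmx_fun; apply: contrmx_adj.
- by rewrite -fro_fmx fmx_subf fmx_mulf mxfK.
- by rewrite -fro_fmx fmx_subf fmx_mulf fmx_adjf mxfK.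
Qed.

(** An operation controlled on the key, block t acting by [U t]. The [U t] need not respect the
    blocks: output falling into another block is discarded, which only lowers the norm. *)
Lemma contr_block (K T : finType) (key : K -> T) (U : T -> K -> K -> C) :
  (forall t, contr (U t)) ->
  contr (fun k k' => if key k == key k' then U (key k) k k' else 0).
Proof.
move=> cU v; pose r t k := if key k == t then v k else 0.
have -> : nrm v = \sum_t nrm (r t).
  rewrite exchange_big; apply: eq_bigr => k _; rewrite (bigD1 (key k)) //=.
  rewrite /r eqxx big1 ?addr0 // => t; rewrite eq_sym => /negbTE ->.
  exact: sqn0.
apply: le_trans (ler_sum _ (fun t _ => cU t (r t))).
rewrite exchange_big; apply: ler_sum => k _ /=; rewrite (bigD1 (key k)) //=.
rewrite ler_wpDr ?sumr_ge0 //; first by move=> t _; apply: sqn_ge0.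
rewrite le_eqVlt; apply/orP; left; apply/eqP; congr sqn.
apply: eq_bigr => k' _; rewrite /r [key k' == _]eq_sym.
by case: eqP => _; rewrite ?mul0r ?mulr0.
Qed.

Lemma complex_eq (z t : C) :
  complex.Re z = complex.Re t -> complex.Im z = complex.Im t -> z = t.
Proof. by case: z t => a b [c d] /= -> ->. Qed.

Lemma Im_realM (c : R) (z : C) : complex.Im (c%:C * z) = c * complex.Im z.
Proof. by case: z => a b /=; rewrite mul0r addr0. Qed.

Lemma sum_fixC l (V : finType) (p q : 'I_l -> V -> R) (D : pred 'I_l)
    (c : {ffun 'I_l -> V}) (h : {ffun 'I_l -> V} -> C) :
  (forall j, isprob (p j)) -> (forall j, ~~ D j -> q j = p j) ->
  (forall j, D j -> q j = dirac R (c j)) ->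
  \sum_x (pm q x)%:C * h x = \sum_x (pm p x)%:C * h (mix D c x).
Proof.
move=> hp qp qc; apply: complex_eq; rewrite !raddf_sum.
  under eq_bigr => x _ do rewrite /= Re_realM.
  under [RHS]eq_bigr => x _ do rewrite /= Re_realM.
  exact: (@sum_fix _ _ _ p q D c (fun x => complex.Re (h x))).
under eq_bigr => x _ do rewrite /= Im_realM.
under [RHS]eq_bigr => x _ do rewrite /= Im_realM.
exact: (@sum_fix _ _ _ p q D c (fun x => complex.Im (h x))).
Qed.

End FunMatrix.

(** * Fixing the coordinates of the superposed input of one party *)

Section PartyStep.
Variable R : realType.
Local Notation C := (complex R).
Local Notation "x %:C" := (real_complex R x).
Variables (l : nat) (V : finType) (p : 'I_l -> V -> R).
Hypothesis hp : forall j, isprob (p j).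
Variables (I J I0 : finType) (M : {ffun 'I_l -> V} -> I -> J -> C).
Variable N : I0 -> J -> C.
Hypothesis M_le : forall x v, nrm (app (M x) v) <= nrm (app N v).
Hypothesis N_le1 : nrm2 N <= 1.
Local Notation K := ({ffun 'I_l -> V} * I)%type.

(** The register keeps a copy of the input, so different inputs do not interfere and the reduced
    state on [J] is an average over [pm q]. *)
Definition Psi (q : 'I_l -> V -> R) : K -> J -> C :=
  fun xk j => (Num.sqrt (pm q xk.1))%:C * M xk.1 xk.2 j.

Lemma gram_Psi q : (forall j, isprob (q j)) ->
  gram (Psi q) = \sum_x (pm q x)%:C *: gram (M x).
Proof.
move=> hq; apply/matrixP=> a b; rewrite gramE summxE.
rewrite sum_pair; apply: eq_bigr => x _; rewrite mxE gramE mulr_sumr; apply: eq_bigr => k _.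
rewrite /Psi /= rmorphM /= conj_realC mulrACA -rmorphM -expr2 sqr_sqrtr //.
exact: pm_ge0.
Qed.

Definition pfix k (w : {ffun 'I_l -> V}) : 'I_l -> V -> R :=
  fun j => if lt_pred k j then dirac R (w j) else p j.

Lemma pfix_prob k w j : isprob (pfix k w j).
Proof. by rewrite /pfix; case: ifP => // _; apply: isprob_dirac. Qed.

Lemma gram_pfix k w : gram (Psi (pfix k w)) = avg p (fun x => gram (M x)) k w.
Proof.
rewrite gram_Psi; last exact: pfix_prob.
apply/matrixP=> a b; rewrite /avg !summxE.
under eq_bigr => x _ do rewrite mxE.
rewrite (@sum_fixC R _ _ p (pfix k w) (lt_pred k) w (fun x => gram (M x) a b)) //.
- by apply: eq_bigr => x _; rewrite [RHS]mxE.
- by move=> j /negbTE h; rewrite /pfix h.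
- by move=> j h; rewrite /pfix h.
Qed.

Variable i : 'I_l.

(** The prefix of [x] below [i], on which the contractions are controlled. The other entries are
    filled with [v] because [pfix i.+1] also reads entry [i], which is thereby pinned to the wanted
    value. *)
Definition prefix_key v (x : {ffun 'I_l -> V}) : {ffun 'I_l -> V} :=
  mix (lt_pred i) x [ffun=> v].

Definition prefix_mass (x : {ffun 'I_l -> V}) : R :=
  \prod_j (if lt_pred i j then p j (x j) else 1).

Lemma prefix_keyP v (x x' : {ffun 'I_l -> V}) : reflect (forall j, lt_pred i j -> x j = x' j)
  (prefix_key v x == prefix_key v x').
Proof.
apply: (iffP eqP) => [/ffunP h j ji | h].
  by have := h j; rewrite !ffunE ji.
by apply/ffunP=> j; rewrite !ffunE; case: ifP => // /h.
Qed.

Lemma prefix_mass_ge0 x : 0 <= prefix_mass x.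
Proof. by apply: prodr_ge0 => j _; case: ifP => // _; case: (hp j). Qed.

Lemma prefix_massE v x :
  prefix_mass x = \sum_w pm p w * (prefix_key v w == prefix_key v x)%:R.
Proof.
pose a j := if lt_pred i j then dirac R (x j) else fun=> 1.
transitivity (\sum_w pm p w * \prod_j a j (w j)).
  rewrite sum_pm_prod; apply: eq_bigr => j _; rewrite /a; case: ifP => _.
    by under eq_bigr => w _ do rewrite mulrC; rewrite sum_dirac.
  by under eq_bigr => w _ do rewrite mulr1; case: (hp j).
apply: eq_bigr => w _; congr (_ * _); case: prefix_keyP => [h|h] /=.
  by apply: big1 => j _; rewrite /a; case: ifP => // /h ->; rewrite /dirac eqxx.
apply/eqP; apply: contra_notT h => /prodf_neq0 h j ji.
by have := h j isT; rewrite /a ji /dirac; have [|_] := eqVneq (w j) (x j); rewrite ?eqxx.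
Qed.

Lemma prefix_mass_key v x x' : prefix_key v x == prefix_key v x' ->
  prefix_mass x = prefix_mass x'.
Proof.
by move=> /prefix_keyP h; apply: eq_bigr => j _; case: ifP => // /h ->.
Qed.

(** Both states split into blocks, one for each prefix, with amplitude the square root of the prefix
    probability times a conditional state. The controlled operator acts block by block, so the
    squared error is at most the average of the errors for the conditional states. *)
Lemma block_bound v (U : {ffun 'I_l -> V} -> K -> K -> C)
  (a b : K -> J -> C) (ac bc : {ffun 'I_l -> V} -> K -> J -> C) (g : {ffun 'I_l -> V} -> R) :
  (forall k j, a k j = (Num.sqrt (prefix_mass k.1))%:C * ac (prefix_key v k.1) k j) ->
  (forall k j, b k j = (Num.sqrt (prefix_mass k.1))%:C * bc (prefix_key v k.1) k j) ->
  (forall (k k' : K) j, prefix_key v k.1 != prefix_key v k'.1 ->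
     ac (prefix_key v k.1) k' j = 0) ->
  (forall c, nrm2 (subf (mulf (U c) (ac c)) (bc c)) <= g c) ->
  nrm2 (subf (mulf (fun k k' : K => if prefix_key v k.1 == prefix_key v k'.1
                     then U (prefix_key v k.1) k k' else 0) a) b)
   <= \sum_w pm p w * g (prefix_key v w).
Proof.
move=> ha hb hac hU.
pose D c := subf (mulf (U c) (ac c)) (bc c).
have E k j : subf (mulf (fun k k' : K => if prefix_key v k.1 == prefix_key v k'.1
                     then U (prefix_key v k.1) k k' else 0) a) b k j
   = (Num.sqrt (prefix_mass k.1))%:C * D (prefix_key v k.1) k j.
  rewrite /D /subf hb mulrBr; congr (_ - _); rewrite /mulf mulr_sumr.
  apply: eq_bigr => k' _; case: ifPn => [e|ne]; last first.
    by rewrite (hac k k' j ne) mul0r !mulr0.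
  by rewrite ha -(eqP e) (prefix_mass_key e) mulrCA.
have -> : nrm2 (subf (mulf (fun k k' : K => if prefix_key v k.1 == prefix_key v k'.1
                     then U (prefix_key v k.1) k k' else 0) a) b)
   = \sum_w pm p w * \sum_(k : K) (prefix_key v w == prefix_key v k.1)%:R
        * \sum_j sqn (D (prefix_key v w) k j).
  under [RHS]eq_bigr => w _ do rewrite mulr_sumr.
  rewrite exchange_big; apply: eq_bigr => k _ /=.
  under eq_bigr => j _ do rewrite E sqnM sqn_real sqr_sqrtr ?prefix_mass_ge0 //.
  rewrite -mulr_sumr (prefix_massE v) mulr_suml; apply: eq_bigr => w _.
  rewrite -mulrA; congr (_ * _).
  by case: eqP => [->|]; rewrite ?mul0r.
apply: ler_sum => w _; rewrite ler_wpM2l ?pm_ge0 //.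
apply: le_trans (hU _); apply: ler_sum => k _.
by case: (_ == _); rewrite ?mul0r ?mul1r // sumr_ge0 // => j _; apply: sqn_ge0.
Qed.

Lemma pm_split v x : pm p x = prefix_mass x * pm (pfix i (prefix_key v x)) x.
Proof.
rewrite /prefix_mass -big_split; apply: eq_bigr => j _.
rewrite /pfix ffunE; case: ifP => _ /=; last by rewrite mul1r.
by rewrite /dirac eqxx mulr1.
Qed.

Lemma pm_split_at v x :
  pm (updp p i (dirac R v)) x
    = prefix_mass x * pm (pfix i.+1 (prefix_key v x)) x.
Proof.
rewrite /prefix_mass -big_split; apply: eq_bigr => j _.
rewrite /pfix /updp !ffunE /lt_pred.
have [->|ji] := eqVneq j i; first by rewrite ltnn ltnSn /= mul1r.
have -> : (j < i.+1)%N = (j < i)%N by rewrite ltnS [RHS]ltn_neqAle ji.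
by case: ifP => _ /=; rewrite ?mul1r // /dirac eqxx mulr1.
Qed.

Lemma pfix_off k v x x' : (i <= k)%N -> prefix_key v x != prefix_key v x' ->
  pm (pfix k (prefix_key v x)) x' = 0.
Proof.
move=> ik; apply: contraNeq => /prodf_neq0 h; apply/prefix_keyP => j ji.
have := h j isT; rewrite /pfix ffunE ji.
have -> : lt_pred k j by apply: leq_trans ik.
by rewrite /dirac; have [->|_] := eqVneq (x' j) (x j); rewrite ?eqxx.
Qed.

Lemma prefix_key_avg v w : avg p (fun x => gram (M x)) i (prefix_key v w)
  = avg p (fun x => gram (M x)) i w /\
  avg p (fun x => gram (M x)) i.+1 (prefix_key v w)
  = avg p (fun x => gram (M x)) i.+1 (upd w i v).
Proof.
split; apply: eq_bigr => x _; congr (_ *: gram (M _)); apply/ffunP=> j.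
  by rewrite !ffunE; case: (lt_pred i j).
rewrite !ffunE /lt_pred ltnS; case: ifP => // ji.
have [->|nji] := eqVneq j i; first by rewrite ltnn.
by rewrite ltn_neqAle ji nji.
Qed.

End PartyStep.

(* Each coordinate of a party's input can be fixed, at total cost -t ln t, by
   contractions acting on that party's registers only: the reduced states of
   the other parties form a martingale whose increments are controlled by the
   entropy. The contractions are controlled on the register of the previous
   coordinates, so that the martingale can condition on them. *)
Lemma party_step (R : realType) (l : nat) (V : finType) (p : 'I_l -> V -> R)
    (I J I0 : finType) (M : {ffun 'I_l -> V} -> I -> J -> complex R)
    (N : I0 -> J -> complex R) :
  (forall j, isprob (p j)) ->
  (forall x v, nrm (app (M x) v) <= nrm (app N v)) -> nrm2 N <= 1 ->
  exists (d : 'I_l -> R)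
    (F G : 'I_l -> V -> {ffun 'I_l -> V} * I -> {ffun 'I_l -> V} * I -> complex R),
  [/\ (forall i v, contr (F i v) /\ contr (G i v)),
      (forall i, 0 <= d i),
      (forall i, \sum_v p i v * nrm2 (subf (mulf (F i v) (Psi M p))
                                     (Psi M (updp p i (dirac R v)))) <= d i),
      (forall i, \sum_v p i v * nrm2 (subf (mulf (G i v)
                 (Psi M (updp p i (dirac R v)))) (Psi M p)) <= d i) &
      \sum_i d i <= - (nrm2 (Psi M p) * ln (nrm2 (Psi M p)))].
Proof.
move=> hp M_le N_le1.
have exU (i : 'I_l) w := uhlmann_fun (Psi M (pfix p i w)) (Psi M (pfix p i.+1 w)).
pose g (i : 'I_l) w := gd (avg p (fun x => gram (M x)) i w)
                          (avg p (fun x => gram (M x)) i.+1 w).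
have {}exU : forall iw : 'I_l * {ffun 'I_l -> V}, exists V : _ -> _ -> complex R,
    [/\ contr V, contr (adjf V),
    nrm2 (subf (mulf V (Psi M (pfix p iw.1 iw.2)))
               (Psi M (pfix p iw.1.+1 iw.2))) <= g iw.1 iw.2 &
    nrm2 (subf (mulf (adjf V) (Psi M (pfix p iw.1.+1 iw.2)))
               (Psi M (pfix p iw.1 iw.2))) <= g iw.1 iw.2].
  by case=> i w; have := exU i w; rewrite !gram_pfix.
have [U hU] := choice exU.
pose F i v k k' := if prefix_key i v k.1 == prefix_key i v k'.1
   then U (i, prefix_key i v k.1) k k' else 0.
pose G i v k k' := if prefix_key i v k.1 == prefix_key i v k'.1
   then adjf (U (i, prefix_key i v k.1)) k k' else 0.
exists (fun i => \sum_v p i v * \sum_w pm p w * g i (prefix_key i v w)), F, G.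
have off (i : 'I_l) k' v x y j : (i <= k')%N ->
    prefix_key i v x.1 != prefix_key i v y.1 ->
    Psi M (pfix p k' (prefix_key i v x.1)) y j = 0.
  by move=> ik ne; rewrite /Psi pfix_off // sqrtr0 mul0r.
have sp (i : 'I_l) v k j : Psi M p k j = real_complex R (Num.sqrt (prefix_mass p i k.1))
    * Psi M (pfix p i (prefix_key i v k.1)) k j.
  rewrite /Psi (pm_split p i v) sqrtrM ?prefix_mass_ge0 //.
  by rewrite rmorphM mulrA.
have spv (i : 'I_l) v k j : Psi M (updp p i (dirac R v)) k j
    = real_complex R (Num.sqrt (prefix_mass p i k.1))
    * Psi M (pfix p i.+1 (prefix_key i v k.1)) k j.
  rewrite /Psi pm_split_at sqrtrM ?prefix_mass_ge0 //.
  by rewrite rmorphM mulrA.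
split.
- move=> i v; split.
    apply: (contr_block (fun k => prefix_key i v k.1) (U := fun w => U (i, w))).
    by move=> w; case: (hU (i, w)).
  apply: (contr_block (fun k => prefix_key i v k.1) (U := fun w => adjf (U (i, w)))).
  by move=> w; case: (hU (i, w)).
- move=> i; apply: sumr_ge0 => v _; apply: mulr_ge0; first by case: (hp i).
  by apply: sumr_ge0 => w _; rewrite mulr_ge0 ?pm_ge0 // gd_ge0.
- move=> i; apply: ler_sum => v _; apply: ler_wpM2l; first by case: (hp i).
  apply: (@block_bound _ _ _ _ hp _ _ i v (fun w => U (i, w)) (Psi M p) _
    (fun w => Psi M (pfix p i w)) (fun w => Psi M (pfix p i.+1 w))) => //.
    by move=> k k' j ne; apply: off.
  by move=> w; case: (hU (i, w)).
- move=> i; apply: ler_sum => v _; apply: ler_wpM2l; first by case: (hp i).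
  apply: (@block_bound _ _ _ _ hp _ _ i v (fun w => adjf (U (i, w))) _ (Psi M p)
    (fun w => Psi M (pfix p i.+1 w)) (fun w => Psi M (pfix p i w))) => //.
    by move=> k k' j ne; apply: off.
  by move=> w; case: (hU (i, w)).
have := @entropy_budget R l #|J| V p hp (fun x => gram (M x))
  (fun x => psd_gram _) (gram N) (psd_gram _).
rewrite tr_gram => /(_ N_le1 (fun x => mxle_gram (M_le x))).
have -> : mass p (fun x => gram (M x)) = nrm2 (Psi M p).
  rewrite /mass /nrm2 sum_pair; apply: eq_bigr => x _.
  rewrite tr_gram mulr_sumr; apply: eq_bigr => k _; rewrite mulr_sumr.
  by apply: eq_bigr => j _; rewrite sqnM sqn_real sqr_sqrtr // pm_ge0.
apply: le_trans; rewrite le_eqVlt; apply/orP; left; apply/eqP.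
apply: eq_bigr => i _; under [RHS]eq_bigr => w _ do rewrite mulr_sumr.
rewrite [RHS]exchange_big; apply: eq_bigr => v _ /=; rewrite mulr_sumr.
apply: eq_bigr => w _; rewrite mulrCA /g.
by have [-> ->] := prefix_key_avg p M i v w.
Qed.

(** * Strategies as contractions *)

Section LocalOps.
Variable R : realType.
Local Notation C := (complex R).
Local Notation "x %:C" := (real_complex R x).

Definition subv (I : finType) (v w : I -> C) : I -> C := fun i => v i - w i.

Definition op1 (K I T : finType) (L : K -> I -> C) (v : I * T -> C) : K * T -> C :=
  fun k => \sum_i L k.1 i * v (i, k.2).

Definition op2 (K I T : finType) (L : K -> I -> C) (v : T * I -> C) : T * K -> C :=
  fun k => \sum_i L k.2 i * v (k.1, i).

Definition opB (S T K I J : finType) (L : K -> I -> C)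
    (v : S * (T * (I * J)) -> C) : S * (T * (K * J)) -> C :=
  fun k => \sum_i L k.2.2.1 i * v (k.1, (k.2.1, (i, k.2.2.2))).

Definition opC (S T K I J : finType) (L : K -> I -> C)
    (v : S * (T * (J * I)) -> C) : S * (T * (J * K)) -> C :=
  fun k => \sum_i L k.2.2.2 i * v (k.1, (k.2.1, (k.2.2.1, i))).

Lemma nrm_pair (S T : finType) (v : S * T -> C) :
  nrm v = \sum_s nrm (fun t => v (s, t)).
Proof. exact: sum_pair. Qed.

Lemma nrm_pairC (S T : finType) (v : S * T -> C) :
  nrm v = \sum_t nrm (fun s => v (s, t)).
Proof. by rewrite nrm_pair exchange_big. Qed.

Lemma op1_nrm (K I T : finType) (L : K -> I -> C) (v : I * T -> C) :
  contr L -> nrm (op1 L v) <= nrm v.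
Proof.
by move=> cL; rewrite !nrm_pairC; apply: ler_sum => t _; apply: (cL (fun i => v (i, t))).
Qed.

Lemma op2_nrm (K I T : finType) (L : K -> I -> C) (v : T * I -> C) :
  contr L -> nrm (op2 L v) <= nrm v.
Proof.
by move=> cL; rewrite !nrm_pair; apply: ler_sum => t _; apply: (cL (fun i => v (t, i))).
Qed.

Lemma opB_nrm (S T K I J : finType) (L : K -> I -> C)
  (v : S * (T * (I * J)) -> C) : contr L -> nrm (opB L v) <= nrm v.
Proof.
move=> cL; rewrite !nrm_pair; apply: ler_sum => s _; rewrite !nrm_pair.
apply: ler_sum => t _.
exact: (op1_nrm (fun k => v (s, (t, k))) cL).
Qed.

Lemma opC_nrm (S T K I J : finType) (L : K -> I -> C)
  (v : S * (T * (J * I)) -> C) : contr L -> nrm (opC L v) <= nrm v.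
Proof.
move=> cL; rewrite !nrm_pair; apply: ler_sum => s _; rewrite !nrm_pair.
apply: ler_sum => t _.
exact: (op2_nrm (fun k => v (s, (t, k))) cL).
Qed.

Lemma op1_sub (K I T : finType) (L : K -> I -> C) (v w : I * T -> C) :
  op1 L (subv v w) = subv (op1 L v) (op1 L w).
Proof. by apply: funext => k; rewrite /subv /op1 -sumrB; apply: eq_bigr => i _; rewrite mulrBr. Qed.

Lemma op2_sub (K I T : finType) (L : K -> I -> C) (v w : T * I -> C) :
  op2 L (subv v w) = subv (op2 L v) (op2 L w).
Proof. by apply: funext => k; rewrite /subv /op2 -sumrB; apply: eq_bigr => i _; rewrite mulrBr. Qed.

Lemma opB_sub (S T K I J : finType) (L : K -> I -> C) (v w : S * (T * (I * J)) -> C) :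
  opB L (subv v w) = subv (opB L v) (opB L w).
Proof. by apply: funext => k; rewrite /subv /opB -sumrB; apply: eq_bigr => i _; rewrite mulrBr. Qed.

Lemma opC_sub (S T K I J : finType) (L : K -> I -> C) (v w : S * (T * (J * I)) -> C) :
  opC L (subv v w) = subv (opC L v) (opC L w).
Proof. by apply: funext => k; rewrite /subv /opC -sumrB; apply: eq_bigr => i _; rewrite mulrBr. Qed.

(** An output register holds a classical outcome together with whatever is left of the quantum
    register. [KE] is the part that Barlie keeps; [IB] and [IC] are what he sends to Bob and
    Charlie. *)
Definition amp (KA IA IU KE IB IC KB KC : finType) (LA : KA -> IA -> C)
    (LU : KE * (IB * IC) -> IU -> C) (LB : KB -> IB -> C) (LC : KC -> IC -> C)
    (v : IA * IU -> C) : KA * (KE * (KB * KC)) -> C :=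
  opC LC (opB LB (op2 LU (op1 LA v))).

Lemma amp_nrm (KA IA IU KE IB IC KB KC : finType) (LA : KA -> IA -> C)
    (LU : KE * (IB * IC) -> IU -> C) (LB : KB -> IB -> C) (LC : KC -> IC -> C)
    (v : IA * IU -> C) :
  contr LA -> contr LU -> contr LB -> contr LC ->
  nrm (amp LA LU LB LC v) <= nrm v.
Proof.
move=> cA cU cB cC; apply: le_trans (opC_nrm _ cC) _.
apply: le_trans (opB_nrm _ cB) _; apply: le_trans (op2_nrm _ cU) _.
exact: op1_nrm.
Qed.

Lemma exchange_mul (I J : finType) (f : I -> C) (g : J -> C) (h : I -> J -> C) :
  \sum_i f i * (\sum_j g j * h i j) = \sum_j g j * (\sum_i f i * h i j).
Proof.
under eq_bigr => i _ do rewrite mulr_sumr.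
rewrite exchange_big; apply: eq_bigr => j _; rewrite mulr_sumr.
by apply: eq_bigr => i _; rewrite mulrCA.
Qed.

Lemma op1_op2 (KA IA IU KU : finType) (LA : KA -> IA -> C) (LU : KU -> IU -> C)
  (v : IA * IU -> C) : op2 LU (op1 LA v) = op1 LA (op2 LU v).
Proof.
by apply: funext => k; exact: (exchange_mul (LU k.2) (LA k.1) (fun i j => v (j, i))).
Qed.

Lemma opB_op1 (KA IA T IB KB J : finType) (LA : KA -> IA -> C) (LB : KB -> IB -> C)
  (v : IA * (T * (IB * J)) -> C) : opB LB (op1 LA v) = op1 LA (opB LB v).
Proof.
by apply: funext => k; exact: (exchange_mul (LB k.2.2.1) (LA k.1) (fun i j => v (j, (k.2.1, (i, k.2.2.2))))).
Qed.

Lemma opC_op1 (KA IA T IB KB J : finType) (LA : KA -> IA -> C) (LB : KB -> IB -> C)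
  (v : IA * (T * (J * IB)) -> C) : opC LB (op1 LA v) = op1 LA (opC LB v).
Proof.
by apply: funext => k; exact: (exchange_mul (LB k.2.2.2) (LA k.1) (fun i j => v (j, (k.2.1, (k.2.2.1, i))))).
Qed.

Lemma opC_opB (S T KB IB KC IC : finType) (LB : KB -> IB -> C) (LC : KC -> IC -> C)
  (v : S * (T * (IB * IC)) -> C) : opC LC (opB LB v) = opB LB (opC LC v).
Proof.
by apply: funext => k; exact: (exchange_mul (LC k.2.2.2) (LB k.2.2.1) (fun i j => v (k.1, (k.2.1, (j, i))))).
Qed.

End LocalOps.

(** * Winning probabilities as sums of squared amplitudes *)

Section TensorAmp.
Variable R : realType.
Local Notation C := (complex R).
Local Notation "x %:C" := (real_complex R x).

Lemma sum_tens (A : nmodType) m n (F : 'I_(m * n) -> A) :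
  \sum_k F k = \sum_i \sum_j F (mxtens_index (i, j)).
Proof.
rewrite pair_bigA (reindex (@mxtens_index m n)); first by apply: eq_bigr => -[].
exists (@mxtens_unindex m n) => k _; first exact: mxtens_indexK.
exact: mxtens_unindexK.
Qed.

Variables (mA nA mB nb mC nc nB m q : nat).
Variables (RA : 'M[C]_(mA, nA)) (RB : 'M[C]_(mB, nb)) (RC : 'M[C]_(mC, nc)).
Variables (K : 'I_m -> 'M[C]_(nb * nc, nB)) (Q : 'M[C]_(nA * nB, q)).

Lemma trace_fro :
  complex.Re (\tr ((adjmx RA *m RA *t (adjmx RB *m RB *t (adjmx RC *m RC))) *m
     \sum_(k < m) ((1%:M : 'M[C]_nA) *t K k) *m (Q *m adjmx Q)
                    *m adjmx ((1%:M : 'M[C]_nA) *t K k)))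
  = \sum_(k < m) fro ((RA *t (RB *t RC)) *m (((1%:M : 'M[C]_nA) *t K k) *m Q)).
Proof.
rewrite mulmx_sumr (raddf_sum (@mxtrace C _)) raddf_sum.
apply: eq_bigr => k _ /=.
set T := RA *t (RB *t RC); set L := _ *t K k.
have -> : adjmx RA *m RA *t (adjmx RB *m RB *t (adjmx RC *m RC)) = adjmx T *m T.
  by rewrite /T !adjmx_tens !tensmx_mul.
have -> : \tr (adjmx T *m T *m (L *m (Q *m adjmx Q) *m adjmx L))
   = \tr (adjmx (T *m (L *m Q)) *m (T *m (L *m Q))).
  have -> : adjmx T *m T *m (L *m (Q *m adjmx Q) *m adjmx L)
     = (adjmx T *m (T *m (L *m Q))) *m (adjmx Q *m adjmx L) by rewrite !mulmxA.
  by rewrite mxtrace_mulC !adjmxM !mulmxA.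
by rewrite -froE.
Qed.

Lemma tens_entry k al be ga j :
  ((RA *t (RB *t RC)) *m (((1%:M : 'M[C]_nA) *t K k) *m Q))
     (mxtens_index (al, mxtens_index (be, ga))) j
  = \sum_c RC ga c * \sum_b RB be b * \sum_t K k (mxtens_index (b, c)) t
      * \sum_a RA al a * Q (mxtens_index (a, t)) j.
Proof.
rewrite mxE sum_tens.
transitivity (\sum_a \sum_b \sum_c \sum_t
  RA al a * (RB be b * RC ga c) * (K k (mxtens_index (b, c)) t * Q (mxtens_index (a, t)) j)).
  apply: eq_bigr => a _; rewrite sum_tens; apply: eq_bigr => b _.
  apply: eq_bigr => c _; rewrite !tensmxE -mulr_sumr; congr (_ * _).
  rewrite mxE sum_tens (bigD1 a) //= [X in _ + X]big1 ?addr0; last first.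
    move=> a' na; apply: big1 => t _.
    by rewrite tensmxE mxE eq_sym (negbTE na) !mul0r.
  by apply: eq_bigr => t _; rewrite tensmxE mxE eqxx mul1r.
under [RHS]eq_bigr => c _ do rewrite mulr_sumr.
rewrite [RHS]exchange_big.
rewrite [LHS]exchange_big; apply: eq_bigr => b _ /=.
rewrite [LHS]exchange_big; apply: eq_bigr => c _ /=.
rewrite [LHS]exchange_big !mulr_sumr; apply: eq_bigr => t _ /=.
rewrite !mulr_sumr; apply: eq_bigr => a _.
by ring.
Qed.

Lemma fro_tens (M : 'M[C]_(mA * (mB * mC), q)) :
  fro M = \sum_al \sum_be \sum_ga \sum_j
     sqn (M (mxtens_index (al, mxtens_index (be, ga))) j).
Proof.
by rewrite /fro sum_tens; apply: eq_bigr => a _; rewrite sum_tens.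
Qed.

End TensorAmp.

Section StrategyAmp.
Variable R : realType.
Local Notation C := (complex R).
Local Notation "x %:C" := (real_complex R x).

Lemma sum_fro_isom (O : finType) m n p (T : O -> 'M[C]_(m, n)) (M : 'M[C]_(n, p)) :
  \sum_o adjmx (T o) *m T o = 1%:M -> \sum_o fro (T o *m M) = fro M.
Proof.
move=> h; apply: (@complexI R); rewrite sum_C froE.
transitivity (\tr (adjmx M *m (\sum_o adjmx (T o) *m T o) *m M)); last first.
  by rewrite h mulmx1.
rewrite mulmx_sumr mulmx_suml (raddf_sum (@mxtrace C _)).
by apply: eq_bigr => o _; rewrite froE adjmxM !mulmxA.
Qed.

Lemma contr_povm (O : finType) m n (T : O -> 'M[C]_(m, n)) :
  \sum_o adjmx (T o) *m T o = 1%:M ->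
  contr (fun (k : O * 'I_m) (i : 'I_n) => T k.1 k.2 i).
Proof.
move=> h v; pose V : 'cV[C]_n := \col_i v i.
have -> : nrm v = fro V.
  by apply: eq_bigr => i _; rewrite big_ord1 mxE.
rewrite -(sum_fro_isom V h) nrm_pair le_eqVlt; apply/orP; left; apply/eqP.
apply: eq_bigr => o _; apply: eq_bigr => i _; rewrite big_ord1 mxE; congr sqn.
by apply: eq_bigr => j _; rewrite mxE.
Qed.

Lemma contr_instrument (S : finType) m nb nc nB q (K : S -> 'I_m -> 'M[C]_(nb * nc, nB)) :
  \sum_s \sum_(k < m) adjmx (K s k) *m K s k = 1%:M ->
  contr (fun (k : (S * ('I_m * 'I_q)) * ('I_nb * 'I_nc)) (i : 'I_nB * 'I_q) =>
     if k.1.2.2 == i.2 then K k.1.1 k.1.2.1 (mxtens_index k.2) i.1 else 0).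
Proof.
move=> h v; pose V : 'M[C]_(nB, q) := \matrix_(i, j) v (i, j).
have h' : \sum_(o : S * 'I_m) adjmx (K o.1 o.2) *m K o.1 o.2 = 1%:M.
  by rewrite -h sum_pair.
have -> : nrm v = fro V.
  by rewrite nrm_pair; apply: eq_bigr => i _; apply: eq_bigr => j _; rewrite mxE.
rewrite -(sum_fro_isom V h') nrm_pair !sum_pair.
rewrite le_eqVlt; apply/orP; left; apply/eqP.
apply: eq_bigr => s _; rewrite sum_pair; apply: eq_bigr => k _ /=.
rewrite /fro [RHS]exchange_big; apply: eq_bigr => j _ /=.
rewrite sum_tens nrm_pair; apply: eq_bigr => b _; apply: eq_bigr => c _.
congr sqn; rewrite mxE /app sum_pair; apply: eq_bigr => t _ /=.
rewrite (bigD1 j) //= eqxx big1 ?addr0 ?mxE // => j' /negbTE.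
by rewrite eq_sym => ->; rewrite mul0r.
Qed.

Variables (X U Y Z A S B D : finType).
Variable P : X -> U -> Y -> Z -> R.
Variable W : X -> U -> Y -> Z -> A -> S -> B -> D -> bool.

Definition fwin (KA KE KB KC : finType) (la : KA -> A) (le : KE -> S)
    (lb : KB -> B) (lc : KC -> D)
    (f : X -> U -> Y -> Z -> KA * (KE * (KB * KC)) -> C) : R :=
  \sum_x \sum_u \sum_y \sum_z P x u y z *
    \sum_k (W x u y z (la k.1) (le k.2.1) (lb k.2.2.1) (lc k.2.2.2))%:R
      * sqn (f x u y z k).

Variables (nA nB nb nc m : nat) (q : nat) (Q : 'M[C]_(nA * nB, q)).

(** The columns of [Q] index a purifying register. It is handed to Barlie, whose channel carries it
    unchanged into the part he keeps. *)
Definition pure_vec (k : 'I_nA * ('I_nB * 'I_q)) : C :=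
  Q (mxtens_index (k.1, k.2.1)) k.2.2.

Lemma nrm_pure_vec : nrm pure_vec = fro Q.
Proof.
rewrite nrm_pair /fro sum_tens; apply: eq_bigr => a _.
by rewrite nrm_pair.
Qed.

Lemma reorder_sums (I1 I2 I3 I4 I5 I6 I7 I8 I9 : finType)
  (F : I1 -> I2 -> I3 -> I4 -> I5 -> I6 -> I7 -> I8 -> I9 -> R) :
  \sum_a \sum_al \sum_s \sum_k \sum_j \sum_b \sum_be \sum_c \sum_ga
     F a al s k j b be c ga
  = \sum_a \sum_s \sum_b \sum_c \sum_k \sum_al \sum_be \sum_ga \sum_j
     F a al s k j b be c ga.
Proof.
rewrite !pair_bigA /=.
pose f (t : I1 * I3 * I6 * I8 * I4 * I2 * I7 * I9 * I5) :=
  let: (a, s, b, c, k, al, be, ga, j) := t in (a, al, s, k, j, b, be, c, ga).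
rewrite (reindex f) /=.
  by apply: eq_bigr => -[[[[[[[[a s] b] c] k] al] be] ga] j].
exists (fun t => let: (a, al, s, k, j, b, be, c, ga) := t in
   (a, s, b, c, k, al, be, ga, j)).
  by case=> [[[[[[[[a s] b] c] k] al] be] ga] j].
by case=> [[[[[[[[a al] s] k] j] b] be] c] ga].
Qed.

Lemma win_prob_amp mA mB mC (RA : X -> A -> 'M[C]_(mA, nA))
    (K : U -> S -> 'I_m -> 'M[C]_(nb * nc, nB))
    (RB : Y -> B -> 'M[C]_(mB, nb)) (RC : Z -> D -> 'M[C]_(mC, nc)) :
  win_prob P W (Q *m adjmx Q) (fun x a => adjmx (RA x a) *m RA x a) K
     (fun y b => adjmx (RB y b) *m RB y b) (fun z c => adjmx (RC z c) *m RC z c)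
  = fwin fst fst fst fst (fun x u y z =>
      amp (fun (k : A * 'I_mA) i => RA x k.1 k.2 i)
        (fun (k : (S * ('I_m * 'I_q)) * ('I_nb * 'I_nc)) (i : 'I_nB * 'I_q) =>
     if k.1.2.2 == i.2 then K u k.1.1 k.1.2.1 (mxtens_index k.2) i.1 else 0)
        (fun (k : B * 'I_mB) i => RB y k.1 k.2 i)
        (fun (k : D * 'I_mC) i => RC z k.1 k.2 i) pure_vec).
Proof.
rewrite /win_prob /fwin; do 4![apply: eq_bigr => ? _]; congr (_ * _).
rewrite sum_pair; under [RHS]eq_bigr => k _ do rewrite !sum_pair.
rewrite sum_pair.
under [RHS]eq_bigr => a _ do under eq_bigr => al _ do under eq_bigr => s _ do
  rewrite sum_pair.
under [RHS]eq_bigr => a _ do under eq_bigr => al _ do under eq_bigr => s _ do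
  under eq_bigr => k _ do under eq_bigr => j _ do (rewrite sum_pair;
   under eq_bigr => bb _ do rewrite sum_pair).
under [RHS]eq_bigr => a _ do under eq_bigr => al _ do under eq_bigr => s _ do
  under eq_bigr => k _ do under eq_bigr => j _ do rewrite sum_pair.
rewrite reorder_sums; do 4![apply: eq_bigr => ? _].
rewrite trace_fro mulr_sumr; apply: eq_bigr => k _.
rewrite fro_tens mulr_sumr; apply: eq_bigr => al _.
rewrite mulr_sumr; apply: eq_bigr => be _.
rewrite mulr_sumr; apply: eq_bigr => ga _.
rewrite mulr_sumr; apply: eq_bigr => j _ /=; congr (_ * sqn _).
rewrite tens_entry; apply: eq_bigr => c _; congr (_ * _).
apply: eq_bigr => b _; congr (_ * _).
rewrite /op2 sum_pair; apply: eq_bigr => t _ /=.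
rewrite [RHS](bigD1 j) //= eqxx [X in _ = _ + X]big1 ?addr0 // => j' /negbTE.
by rewrite eq_sym => ->; rewrite mul0r.
Qed.

End StrategyAmp.

Section QuantumValue.
Variable R : realType.
Local Notation C := (complex R).
Local Notation "x %:C" := (real_complex R x).
Variables (X U Y Z A S B D : finType).
Variable P : X -> U -> Y -> Z -> R.
Variable W : X -> U -> Y -> Z -> A -> S -> B -> D -> bool.
Hypothesis P0 : forall x u y z, 0 <= P x u y z.
Hypothesis P1 : \sum_x \sum_u \sum_y \sum_z P x u y z = 1.

(* Outcomes are read off the register labels la, le, lb, lc, so that POVMs and
   instruments become single rectangular contractions. *)
Definition amp_value (r : R) : Prop :=
  exists (KA KE KB KC IA IU IB IC : finType)
    (la : KA -> A) (le : KE -> S) (lb : KB -> B) (lc : KC -> D)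
    (LA : X -> KA -> IA -> C) (LU : U -> KE * (IB * IC) -> IU -> C)
    (LB : Y -> KB -> IB -> C) (LC : Z -> KC -> IC -> C) (v : IA * IU -> C),
    [/\ forall x, contr (LA x), forall u, contr (LU u), forall y, contr (LB y),
        forall z, contr (LC z) & nrm v = 1] /\
    r = fwin P W la le lb lc (fun x u y z => amp (LA x) (LU u) (LB y) (LC z) v).

Definition valid_value (r : R) : Prop :=
  exists (nA nB nb nc m : nat)
        (rho : 'M[C]_(nA * nB)) (EA : X -> A -> 'M[C]_nA)
        (K : U -> S -> 'I_m -> 'M[C]_(nb * nc, nB))
        (EB : Y -> B -> 'M[C]_nb) (EC : Z -> D -> 'M[C]_nc),
        [/\ densitymx rho, povm EA, instrument K, povm EB & povm EC] /\
        r = win_prob P W rho EA K EB EC.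

Lemma povm_factor (I O : finType) n (E : I -> O -> 'M[C]_n) : povm E ->
  exists T : I -> O -> 'M[C]_n,
    E = (fun i o => adjmx (T i o) *m T i o) /\
    forall i, \sum_o adjmx (T i o) *m T i o = 1%:M.
Proof.
case=> pE sE.
have ex : forall io : I * O, exists M : 'M[C]_n, E io.1 io.2 = adjmx M *m M.
  by move=> io; apply: psd_factor.
have [T hT] := choice ex.
exists (fun i o => T (i, o)); split.
  by apply: funext => i; apply: funext => o; apply: (hT (i, o)).
by move=> i; rewrite -(sE i); apply: eq_bigr => o _; rewrite -(hT (i, o)).
Qed.

Lemma valid_amp r : valid_value r -> amp_value r.
Proof.
move=> [nA [nB [nb [nc [m [rho [EA [K [EB [EC [[hr hA hK hB hC] ->]]]]]]]]]]].
have [RA [-> sA]] := povm_factor hA; have [RB [-> sB]] := povm_factor hB.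
have [RC [-> sC]] := povm_factor hC.
case: hr => /psd_factor [M ->] trr.
have E : adjmx M *m M = adjmx M *m adjmx (adjmx M) by rewrite adjmxK.
rewrite E win_prob_amp.
do 8![eexists]; do 4![exists fst]; do 4![eexists]; exists (pure_vec (adjmx M)).
split; last by reflexivity.
split=> [x|u|y|z|]; try exact: contr_povm.
  exact: contr_instrument.
by rewrite nrm_pure_vec fro_adj; apply: (@complexI R); rewrite froE trr.
Qed.

Lemma fwin_ge0 (KA KE KB KC : finType) (la : KA -> A) (le : KE -> S)
    (lb : KB -> B) (lc : KC -> D) f : 0 <= fwin P W la le lb lc f.
Proof.
do 4![apply: sumr_ge0 => ? _]; apply: mulr_ge0 => //; apply: sumr_ge0 => k _.
by rewrite mulr_ge0 ?ler0n ?sqn_ge0.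
Qed.

Lemma fwin_le_nrm (KA KE KB KC IA IU IB IC : finType)
    (la : KA -> A) (le : KE -> S) (lb : KB -> B) (lc : KC -> D)
    (LA : X -> KA -> IA -> C) (LU : U -> KE * (IB * IC) -> IU -> C)
    (LB : Y -> KB -> IB -> C) (LC : Z -> KC -> IC -> C) (v : IA * IU -> C) :
  (forall x, contr (LA x)) -> (forall u, contr (LU u)) -> (forall y, contr (LB y)) ->
  (forall z, contr (LC z)) ->
  fwin P W la le lb lc (fun x u y z => amp (LA x) (LU u) (LB y) (LC z) v) <= nrm v.
Proof.
move=> cA cU cB cC; rewrite -[leRHS]mul1r -P1 mulr_suml.
apply: ler_sum => x _; rewrite mulr_suml; apply: ler_sum => u _.
rewrite mulr_suml; apply: ler_sum => y _; rewrite mulr_suml.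
apply: ler_sum => z _; apply: ler_wpM2l => //.
apply: le_trans (amp_nrm v (cA x) (cU u) (cB y) (cC z)).
by apply: ler_sum => k _; case: (W _ _ _ _ _ _ _ _); rewrite ?mul1r // mul0r sqn_ge0.
Qed.

Lemma qvalueE : qvalue P W = sup [set r | valid_value r].
Proof. by []. Qed.

(** The set of values can be empty, for instance when an output alphabet is, and then [sup] is 0 by
    convention; hence the hypothesis 0 <= t. *)
Lemma qvalue_le (t : R) : 0 <= t -> (forall r, amp_value r -> r <= t) ->
  qvalue P W <= t.
Proof.
move=> t0 h; rewrite qvalueE; have [[r hr]|ne] := pselect (exists r, valid_value r).
  by apply: ge_sup => [|s /valid_amp]; [exists r | apply: h].
by rewrite sup_out // => -[[r hr] _]; apply: ne; exists r.
Qed.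

Lemma valid_le_qvalue r : valid_value r -> r <= qvalue P W.
Proof.
move=> hr; rewrite qvalueE; apply: sup_upper_bound => //; split; first by exists r.
exists 1 => s /valid_amp.
case=> [? [? [? [? [? [? [? [? [la [le [lb [lc [LA [LU [LB [LC [v [[cA cU cB cC nv] ->]]]]]]]]]]]]]]]]]].
by rewrite -nv; apply: fwin_le_nrm.
Qed.

Definition isom (K I : finType) (L : K -> I -> C) : Prop := gram L = 1%:M.

Section IsometryStrategy.
Variables (KA KE KB KC IA IU IB IC : finType).
Variables (la : KA -> A) (le : KE -> S) (lb : KB -> B) (lc : KC -> D).
Variables (LA : X -> KA -> IA -> C) (LU : U -> KE * (IB * IC) -> IU -> C).
Variables (LB : Y -> KB -> IB -> C) (LC : Z -> KC -> IC -> C) (v : IA * IU -> C).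

Definition lab_mx (K I O : finType) (lab : K -> O) (L : K -> I -> C) (o : O)
  : 'M[C]_(#|K|, #|I|) := fmx (fun k i => if lab k == o then L k i else 0).

Lemma lab_mx_sum (K I O : finType) (lab : K -> O) (L : K -> I -> C) : isom L ->
  \sum_o adjmx (lab_mx lab L o) *m lab_mx lab L o = 1%:M.
Proof.
move=> <-; apply/matrixP=> a b; rewrite summxE gramE.
under eq_bigr => o _ do rewrite -/(gram _) gramE.
rewrite exchange_big; apply: eq_bigr => k _ /=; rewrite (bigD1 (lab k)) //= eqxx.
by rewrite big1 ?addr0 // => o; rewrite eq_sym => /negbTE ->; rewrite mulr0.
Qed.

Definition kraus_mx u s (k : 'I_#|KE|) : 'M[C]_(#|IB| * #|IC|, #|IU|) :=
  \matrix_(r, t) if le (enum_val k) == s then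
     LU u (enum_val k, (enum_val (mxtens_unindex r).1, enum_val (mxtens_unindex r).2))
       (enum_val t) else 0.

Lemma kraus_mxE u s k b c t : kraus_mx u s k (mxtens_index (b, c)) t
  = if le (enum_val k) == s then LU u (enum_val k, (enum_val b, enum_val c)) (enum_val t)
    else 0.
Proof. by rewrite mxE mxtens_indexK. Qed.

Lemma kraus_mx_sum u : isom (LU u) ->
  \sum_s \sum_k adjmx (kraus_mx u s k) *m kraus_mx u s k = 1%:M.
Proof.
move=> <-; apply/matrixP=> a b; rewrite summxE gramE.
under eq_bigr => s _ do rewrite summxE.
rewrite exchange_big sum_pair -[RHS]sum_enum_val; apply: eq_bigr => k _ /=.
rewrite (bigD1 (le (enum_val k))) //= [X in _ + X]big1 ?addr0; last first.
  move=> s; rewrite eq_sym => /negbTE h; rewrite mxE sum_tens big1 // => i _.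
  by rewrite big1 // => j _; rewrite kraus_mxE h mulr0.
rewrite mxE sum_tens sum_pair -[RHS]sum_enum_val; apply: eq_bigr => i _.
rewrite -[RHS]sum_enum_val; apply: eq_bigr => j _.
by rewrite adjmxE !kraus_mxE eqxx.
Qed.

Definition vec_mx1 : 'M[C]_(#|IA| * #|IU|, 1) :=
  \matrix_(r, _) v (enum_val (mxtens_unindex r).1, enum_val (mxtens_unindex r).2).

Lemma lab_amp x u y z a al s k b be c ga :
  amp (fun (k : A * 'I_#|KA|) i => lab_mx la (LA x) k.1 k.2 i)
    (fun (k : (S * ('I_#|KE| * 'I_1)) * ('I_#|IB| * 'I_#|IC|)) (i : 'I_#|IU| * 'I_1) =>
     if k.1.2.2 == i.2 then kraus_mx u k.1.1 k.1.2.1 (mxtens_index k.2) i.1 else 0)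
    (fun (k : B * 'I_#|KB|) i => lab_mx lb (LB y) k.1 k.2 i)
    (fun (k : D * 'I_#|KC|) i => lab_mx lc (LC z) k.1 k.2 i) (pure_vec vec_mx1)
    ((a, al), ((s, (k, ord0)), ((b, be), (c, ga))))
  = if [&& la (enum_val al) == a, le (enum_val k) == s, lb (enum_val be) == b
         & lc (enum_val ga) == c]
    then amp (LA x) (LU u) (LB y) (LC z) v
      (enum_val al, (enum_val k, (enum_val be, enum_val ga))) else 0.
Proof.
rewrite /amp /opC /opB /op2 /op1 /=.
have [<-|na] := eqVneq; last first.
  apply: big1 => c' _; rewrite [X in _ * X]big1 ?mulr0 // => b' _.
  rewrite [X in _ * X]big1 ?mulr0 // => t _.
  rewrite [X in _ * X]big1 ?mulr0 // => a' _.
  by rewrite mxE (negbTE na) mul0r.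
have [<-|ns] := eqVneq; last first.
  apply: big1 => c' _; rewrite [X in _ * X]big1 ?mulr0 // => b' _.
  rewrite [X in _ * X]big1 ?mulr0 // => t _.
  by case: eqP; rewrite ?mul0r // kraus_mxE (negbTE ns) mul0r.
have [<-|nb] := eqVneq; last first.
  apply: big1 => c' _; rewrite [X in _ * X]big1 ?mulr0 // => b' _.
  by rewrite mxE (negbTE nb) mul0r.
have [<-|nc] := eqVneq; last first.
  by apply: big1 => c' _; rewrite mxE (negbTE nc) mul0r.
rewrite /= -[RHS]sum_enum_val; apply: eq_bigr => c' _; rewrite mxE eqxx.
congr (_ * _); rewrite -[RHS]sum_enum_val; apply: eq_bigr => b' _; rewrite mxE eqxx.
congr (_ * _); rewrite -[RHS]sum_enum_val sum_pair; apply: eq_bigr => t _.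
rewrite big_ord1 /= kraus_mxE !eqxx.
congr (_ * _); rewrite -[RHS]sum_enum_val; apply: eq_bigr => a' _; rewrite mxE eqxx.
by rewrite /pure_vec mxE mxtens_indexK.
Qed.

Lemma sum_label (K O : finType) (lab : K -> O) (F : O -> 'I_#|K| -> R) (G : K -> R) :
  (forall o al, F o al = if lab (enum_val al) == o then G (enum_val al) else 0) ->
  \sum_o \sum_al F o al = \sum_k G k.
Proof.
move=> h; rewrite exchange_big -[RHS]sum_enum_val; apply: eq_bigr => al _ /=.
rewrite (bigD1 (lab (enum_val al))) //= h eqxx big1 ?addr0 // => o.
by rewrite eq_sym h => /negbTE ->.
Qed.

(** A converse of [valid_amp] for isometries: the rows carrying a given label form one measurement
    operator, the values of [KE] index Kraus operators, and the pure state is a matrix with a single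
    column. *)
Lemma isom_value : (forall x, isom (LA x)) -> (forall u, isom (LU u)) ->
  (forall y, isom (LB y)) -> (forall z, isom (LC z)) -> nrm v = 1 ->
  valid_value (fwin P W la le lb lc
    (fun x u y z => amp (LA x) (LU u) (LB y) (LC z) v)).
Proof.
move=> iA iU iB iC nv.
exists #|IA|, #|IU|, #|IB|, #|IC|, #|KE|, (vec_mx1 *m adjmx vec_mx1).
exists (fun x a => adjmx (lab_mx la (LA x) a) *m lab_mx la (LA x) a), kraus_mx.
exists (fun y b => adjmx (lab_mx lb (LB y) b) *m lab_mx lb (LB y) b).
exists (fun z c => adjmx (lab_mx lc (LC z) c) *m lab_mx lc (LC z) c).
split.
  split.
  - split; first by have := psd_gram (adjmx vec_mx1); rewrite adjmxK.
    rewrite mxtrace_mulC -froE -[RHS](rmorph1 (real_complex R)); congr (_%:C).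
    rewrite -nv nrm_pair -sum_enum_val /fro sum_tens; apply: eq_bigr => i _.
    rewrite /nrm -[RHS]sum_enum_val; apply: eq_bigr => j _.
    by rewrite big_ord1 mxE mxtens_indexK.
  - by split=> [x a|x]; [apply: psd_gram | apply: lab_mx_sum].
  - by move=> u; apply: kraus_mx_sum.
  - by split=> [x a|x]; [apply: psd_gram | apply: lab_mx_sum].
  - by split=> [x a|x]; [apply: psd_gram | apply: lab_mx_sum].
rewrite win_prob_amp /fwin; do 4![apply: eq_bigr => ? _]; congr (_ * _).
rewrite [LHS]sum_pair sum_pair [RHS]sum_pair; apply/esym.
apply: (sum_label (lab := la)) => a al; rewrite [LHS]sum_pair.
case: ifPn => na; last first.
  apply: big1 => -[s [k j]] _; apply: big1 => -[[b be] [c ga]] _ /=.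
  by rewrite ord1 lab_amp (negbTE na) sqn0 mulr0.
rewrite [RHS]sum_pair [LHS]sum_pair.
under eq_bigr => s _ do rewrite sum_pair.
apply: (sum_label (lab := le)) => s k; rewrite big_ord1.
case: ifPn => ns; last first.
  apply: big1 => -[[b be] [c ga]] _ /=.
  by rewrite lab_amp (negbTE ns) andbF sqn0 mulr0.
rewrite [RHS]sum_pair [LHS]sum_pair [LHS]sum_pair.
apply: (sum_label (lab := lb)) => b be.
case: ifPn => nb; last first.
  apply: big1 => -[c ga] _ /=.
  by rewrite lab_amp (negbTE nb) !andbF sqn0 mulr0.
rewrite [LHS]sum_pair; apply: (sum_label (lab := lc)) => c ga.
rewrite lab_amp na ns nb /=; case: ifPn => nc; last by rewrite sqn0 mulr0.
by rewrite -(eqP na) -(eqP ns) -(eqP nb) -(eqP nc).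
Qed.

End IsometryStrategy.
End QuantumValue.

(** * Contractions as strategies for a single copy *)

Section Dilation.
Variable R : realType.
Local Notation C := (complex R).
Local Notation "x %:C" := (real_complex R x).

Lemma nrm_app_fro (K I : finType) (L : K -> I -> C) (v : 'cV[C]_#|I|) :
  fro (fmx L *m v) = nrm (app L (fun i => v (enum_rank i) 0)).
Proof.
rewrite /nrm -[RHS]sum_enum_val; apply: eq_bigr => k _; rewrite big_ord1 mxE.
congr sqn; rewrite /app -[RHS]sum_enum_val; apply: eq_bigr => i _.
by rewrite mxE enum_valK.
Qed.

Lemma contr_complete (K I : finType) (L : K -> I -> C) : contr L ->
  exists T : I -> I -> C, gram L + gram T = 1%:M.
Proof.
move=> cL; have pL : psdmx (1%:M - gram L).
  split; first by rewrite adjmxB adjmx1; case: (psd_gram (fmx L)) => ->.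
  move=> v; have -> : adjmx v *m (1%:M - gram L) *m v
      = adjmx v *m v - adjmx (fmx L *m v) *m (fmx L *m v).
    by rewrite mulmxBr mulmx1 mulmxBl /gram adjmxM !mulmxA.
  have trE (M : 'M[C]_1) : M 0 0 = \tr M by rewrite /mxtrace big_ord1.
  rewrite trE raddfB /= -!froE -rmorphB /= ler0c subr_ge0 nrm_app_fro.
  apply: le_trans (cL _) _; rewrite le_eqVlt; apply/orP; left; apply/eqP.
  rewrite /nrm -[LHS]sum_enum_val; apply: eq_bigr => i _.
  by rewrite big_ord1 enum_valK.
have [M hM] := psd_factor pL; exists (mxf M).
by rewrite /gram mxfK -hM addrC subrK.
Qed.

Definition sumf (K K' I : finType) (L : K -> I -> C) (T : K' -> I -> C)
  (k : K + K') : I -> C := match k with inl k => L k | inr k => T k end.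

Lemma sum_sum (A : nmodType) (K K' : finType) (F : K + K' -> A) :
  \sum_k F k = \sum_k F (inl k) + \sum_k F (inr k).
Proof. by rewrite big_sumType. Qed.

Lemma gram_sumf (K K' I : finType) (L : K -> I -> C) (T : K' -> I -> C) :
  gram (sumf L T) = gram L + gram T.
Proof. by apply/matrixP=> a b; rewrite [RHS]mxE !gramE sum_sum. Qed.

(** The outcomes added for Barlie must also deliver registers to Bob and Charlie; these are put in
    the fixed state [j0]. *)
Definition sumf2 (K J I : finType) (j0 : J) (L : K * J -> I -> C) (T : I -> I -> C)
  (k : (K + I) * J) : I -> C := match k.1 with
    | inl e => L (e, k.2) | inr t => if k.2 == j0 then T t else fun=> 0 end.

Lemma gram_sumf2 (K J I : finType) (j0 : J) (L : K * J -> I -> C) (T : I -> I -> C) :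
  gram (sumf2 j0 L T) = gram L + gram T.
Proof.
apply/matrixP=> a b; rewrite [RHS]mxE !gramE sum_pair sum_sum; congr (_ + _).
  by rewrite sum_pair.
apply: eq_bigr => t _; rewrite (bigD1 j0) //= {1 2}/sumf2 /= eqxx.
by rewrite big1 ?addr0 // => j /negbTE h; rewrite /sumf2 /= h mulr0.
Qed.

Lemma sum_inj_le (K K' : finType) (f : K -> K') (F : K' -> R) : injective f ->
  (forall k, 0 <= F k) -> \sum_k F (f k) <= \sum_k F k.
Proof.
move=> fi F0; rewrite (partition_big f predT) //=; apply: ler_sum => k' _.
have [k0 /eqP <-|h] := pickP (fun k => f k == k').
  rewrite (big_pred1 k0) // => k /=; exact: inj_eq.
by rewrite big_pred0.
Qed.

End Dilation.

Section Simulation.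
Variable R : realType.
Local Notation C := (complex R).
Local Notation "x %:C" := (real_complex R x).
Variables (X U Y Z A S B D : finType).
Variable P : X -> U -> Y -> Z -> R.
Variable W : X -> U -> Y -> Z -> A -> S -> B -> D -> bool.
Hypothesis P0 : forall x u y z, 0 <= P x u y z.
Hypothesis P1 : \sum_x \sum_u \sum_y \sum_z P x u y z = 1.
Variables (KA KE KB KC IA IU IB IC : finType).
Variables (la : KA -> A) (le : KE -> S) (lb : KB -> B) (lc : KC -> D).
Variables (LA : X -> KA -> IA -> C) (LU : U -> KE * (IB * IC) -> IU -> C).
Variables (LB : Y -> KB -> IB -> C) (LC : Z -> KC -> IC -> C).
Hypothesis cA : forall x, contr (LA x).
Hypothesis cU : forall u, contr (LU u).
Hypothesis cB : forall y, contr (LB y).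
Hypothesis cC : forall z, contr (LC z).

Lemma contr_value (v : IA * IU -> C) (a0 : A) (s0 : S) (b0 : B) (d0 : D)
    (j0 : IB * IC) : nrm v = 1 ->
  fwin P W la le lb lc (fun x u y z => amp (LA x) (LU u) (LB y) (LC z) v)
   <= qvalue P W.
Proof.
move=> nv.
have [TA hA] := choice (fun x => contr_complete (cA x)).
have [TU hU] := choice (fun u => contr_complete (cU u)).
have [TB hB] := choice (fun y => contr_complete (cB y)).
have [TC hC] := choice (fun z => contr_complete (cC z)).
have := isom_value P W (fun k : KA + IA => if k is inl k then la k else a0)
  (fun k : KE + IU => if k is inl k then le k else s0)
  (fun k : KB + IB => if k is inl k then lb k else b0)
  (fun k : KC + IC => if k is inl k then lc k else d0)
  (LA := fun x => sumf (LA x) (TA x)) (LU := fun u => sumf2 j0 (LU u) (TU u))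
  (LB := fun y => sumf (LB y) (TB y)) (LC := fun z => sumf (LC z) (TC z)) (v := v).
rewrite /isom => /(_ _ _ _ _ nv) h.
apply: le_trans (valid_le_qvalue P0 P1 (h _ _ _ _)); first last.
- by move=> z; rewrite gram_sumf.
- by move=> z; rewrite gram_sumf.
- by move=> z; rewrite gram_sumf2.
- by move=> z; rewrite gram_sumf.
do 4![apply: ler_sum => ? _]; apply: ler_wpM2l => //.
pose f (k : KA * (KE * (KB * KC))) :
  (KA + IA) * ((KE + IU) * ((KB + IB) * (KC + IC))) :=
  (inl k.1, (inl k.2.1, (inl k.2.2.1, inl k.2.2.2))).
have fi : injective f.
  by move=> [a [e [b c]]] [a' [e' [b' c']]] [-> -> -> ->].
apply: le_trans (sum_inj_le fi _); last first.
  by move=> k; rewrite mulr_ge0 ?ler0n ?sqn_ge0.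
by [].
Qed.

Lemma ampZ (r : C) (v : IA * IU -> C) x u y z k :
  amp (LA x) (LU u) (LB y) (LC z) (fun i => r * v i) k
    = r * amp (LA x) (LU u) (LB y) (LC z) v k.
Proof.
rewrite /amp /opC mulr_sumr; apply: eq_bigr => c _; rewrite mulrCA; congr (_ * _).
rewrite /opB mulr_sumr; apply: eq_bigr => b _; rewrite mulrCA; congr (_ * _).
rewrite /op2 mulr_sumr; apply: eq_bigr => t _; rewrite mulrCA; congr (_ * _).
by rewrite /op1 mulr_sumr; apply: eq_bigr => a _; rewrite mulrCA.
Qed.

Lemma nrmZ (I : finType) (r : R) (v : I -> C) :
  nrm (fun i => r%:C * v i) = r ^+ 2 * nrm v.
Proof.
by rewrite /nrm mulr_sumr; apply: eq_bigr => i _; rewrite sqnM sqn_real.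
Qed.

End Simulation.

(* Completing each contraction to an isometry only adds outcomes, whose
   contribution to the winning probability is nonnegative. *)
Lemma simulation (R : realType) (X U Y Z A S B D : finType)
    (P : X -> U -> Y -> Z -> R) (W : X -> U -> Y -> Z -> A -> S -> B -> D -> bool)
    (KA KE KB KC : finType)
    (la : KA -> A) (le : KE -> S) (lb : KB -> B) (lc : KC -> D)
    (LA : X -> KA -> KA -> complex R)
    (LU : U -> KE * (KB * KC) -> KE * (KB * KC) -> complex R)
    (LB : Y -> KB -> KB -> complex R) (LC : Z -> KC -> KC -> complex R)
    (v : KA * (KE * (KB * KC)) -> complex R) :
  (forall x u y z, 0 <= P x u y z) ->
  \sum_x \sum_u \sum_y \sum_z P x u y z = 1 ->
  (forall x, contr (LA x)) -> (forall u, contr (LU u)) ->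
  (forall y, contr (LB y)) -> (forall z, contr (LC z)) ->
  fwin P W la le lb lc (fun x u y z => amp (LA x) (LU u) (LB y) (LC z) v)
   <= qvalue P W * nrm v.
Proof.
move=> P0 P1 cA cU cB cC.
have [n0|n0] := eqVneq (nrm v) 0.
  by rewrite n0 mulr0 -n0; apply: fwin_le_nrm.
have npos : 0 < nrm v by rewrite lt_neqAle eq_sym n0 nrm_ge0.
(* A nonzero vector has an index, and the labels of this index serve as outputs for the outcomes
   added by the dilation. *)
have [k _] : exists k : KA * (KE * (KB * KC)), true.
  apply/existsP; apply: contraNT n0; rewrite negb_exists => /forallP h.
  by rewrite /nrm big1 // => k _; have := h k.
pose r := (Num.sqrt (nrm v))^-1.
have rr : r ^+ 2 * nrm v = 1.
  by rewrite /r exprVn sqr_sqrtr ?mulVf // ltW.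
have := @contr_value R X U Y Z A S B D P W P0 P1 KA KE KB KC KA (KE * (KB * KC))%type KB KC
  la le lb lc LA LU LB LC cA cU cB cC (fun i => real_complex R r * v i)
  (la k.1) (le k.2.1) (lb k.2.2.1) (lc k.2.2.2) k.2.2.
rewrite nrmZ => /(_ rr) h.
rewrite -(ler_pM2l (_ : 0 < r ^+ 2)); last first.
  by rewrite exprn_gt0 // invr_gt0 sqrtr_gt0.
rewrite mulrCA rr mulr1; apply: le_trans h.
rewrite /fwin !mulr_sumr le_eqVlt; apply/orP; left; apply/eqP.
do 4![rewrite ?mulr_sumr; apply: eq_bigr => ? _].
rewrite mulrCA; congr (_ * _); rewrite mulr_sumr; apply: eq_bigr => k' _.
by rewrite ampZ sqnM sqn_real mulrCA.
Qed.

(** * Fixing one coordinate of the four inputs *)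

Section Contractions.
Variable R : realType.
Local Notation C := (complex R).
Local Notation "x %:C" := (real_complex R x).

Lemma app_mulf (K I J : finType) (L : K -> I -> C) (M : I -> J -> C) v :
  app (mulf L M) v = app L (app M v).
Proof.
apply: funext => k; rewrite /app /mulf.
under eq_bigr => j _ do rewrite mulr_suml.
rewrite exchange_big; apply: eq_bigr => i _; rewrite mulr_sumr.
by apply: eq_bigr => j _; rewrite mulrA.
Qed.

Lemma contr_mulf (K I J : finType) (L : K -> I -> C) (M : I -> J -> C) :
  contr L -> contr M -> contr (mulf L M).
Proof. by move=> cL cM v; rewrite app_mulf; apply: le_trans (cL _) (cM _). Qed.

Definition idf (I : finType) (i j : I) : C := (i == j)%:R.

Lemma sum_idf (I : finType) (i : I) (f : I -> C) : \sum_j idf i j * f j = f i.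
Proof.
rewrite (bigD1 i) //= /idf eqxx mul1r big1 ?addr0 // => j.
by rewrite eq_sym => /negbTE ->; rewrite mul0r.
Qed.

Lemma contr_idf (I : finType) : contr (@idf I).
Proof.
by move=> v; rewrite le_eqVlt; apply/orP; left; apply/eqP; apply: eq_bigr => i _;
  rewrite /app sum_idf.
Qed.

Variables (l : nat) (V K I : finType).

Definition bigL (q : 'I_l -> V -> R) (L : {ffun 'I_l -> V} -> K -> I -> C)
  : {ffun 'I_l -> V} * K -> I -> C :=
  fun k i => (Num.sqrt (pm q k.1))%:C * L k.1 k.2 i.

Lemma contr_bigL q L : (forall j, isprob (q j)) -> (forall x, contr (L x)) ->
  contr (bigL q L).
Proof.
move=> hq cL v; rewrite nrm_pair -[leRHS](@sum_pm_const _ _ _ q) //.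
apply: ler_sum => x _; apply: le_trans (_ : pm q x * nrm (app (L x) v) <= _).
  rewrite /nrm mulr_sumr; apply: ler_sum => k _.
  rewrite -[X in X * _]sqr_sqrtr ?pm_ge0 // -sqn_real -sqnM.
  rewrite le_eqVlt; apply/orP; left; apply/eqP; congr sqn.
  by rewrite /app mulr_sumr; apply: eq_bigr => i _; rewrite mulrA.
by rewrite ler_wpM2l ?pm_ge0 //; apply: cL.
Qed.

Definition flatL (L : {ffun 'I_l -> V} -> K -> I -> C)
  : {ffun 'I_l -> V} * K -> I -> C := fun k i => L k.1 k.2 i.

End Contractions.

Section Recombine.
Variable R : realType.
Local Notation C := (complex R).

Lemma sum_unit (A : nmodType) (F : unit -> A) : \sum_u F u = F tt.
Proof. by rewrite (bigD1 tt) //= big1 ?addr0 // => -[]. Qed.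

Lemma contr_reindex (K K' : finType) (f : K -> K') (g : K' -> K) (L : K' -> K' -> C) :
  cancel f g -> cancel g f -> contr L -> contr (fun k k' => L (f k) (f k')).
Proof.
move=> fK gK cL v; have := cL (v \o g).
have -> : nrm (v \o g) = nrm v.
  rewrite /nrm (reindex f) //=; last by exists g => k _; rewrite ?fK ?gK.
  by apply: eq_bigr => k _; rewrite fK.
suff -> : nrm (app L (v \o g)) = nrm (app (fun k k' => L (f k) (f k')) v) by [].
rewrite /nrm (reindex f) //=; last by exists g => k _; rewrite ?fK ?gK.
apply: eq_bigr => k _; congr sqn; rewrite /app (reindex f) /=.
  by apply: eq_bigr => k' _; rewrite fK.
by exists g => k' _; rewrite ?fK ?gK.
Qed.

End Recombine.

Section States.
Variable R : realType.
Local Notation C := (complex R).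
Local Notation "x %:C" := (real_complex R x).
Variables (X U : finType) (l : nat).
Variables (KA KE KB KC IA IU IB IC : finType).
Variables (LA : {ffun 'I_l -> X} -> KA -> IA -> C).
Variables (LU : {ffun 'I_l -> U} -> KE * (IB * IC) -> IU -> C).
Variables (LB : {ffun 'I_l -> option X} -> KB -> IB -> C).
Variables (LC : {ffun 'I_l -> option X} -> KC -> IC -> C).
Variable v : IA * IU -> C.
Hypothesis cA : forall x, contr (LA x).
Hypothesis cU : forall x, contr (LU x).
Hypothesis cB : forall x, contr (LB x).
Hypothesis cC : forall x, contr (LC x).
Hypothesis nv : nrm v <= 1.

Definition bot_or (T : Type) (b : bool) (x : T) : option T := if b then None else Some x.

Definition yof (xb : {ffun 'I_l -> X}) (f : {ffun 'I_l -> bool})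
  : {ffun 'I_l -> option X} := [ffun j => bot_or (f j) (xb j)].

Local Notation KA' := ({ffun 'I_l -> X} * KA)%type.
Local Notation KE' := ({ffun 'I_l -> U} * KE)%type.
Local Notation KB' := ({ffun 'I_l -> bool} * KB)%type.
Local Notation KC' := ({ffun 'I_l -> bool} * KC)%type.
Local Notation K4 := (KA' * (KE' * (KB' * KC')))%type.

Definition bigU (q : 'I_l -> U -> R) : KE' * (IB * IC) -> IU -> C :=
  fun k i => (Num.sqrt (pm q k.1.1))%:C * LU k.1.1 (k.1.2, k.2) i.

Definition flatU : KE' * (IB * IC) -> IU -> C :=
  fun k i => LU k.1.1 (k.1.2, k.2) i.

Lemma contr_bigU q : (forall j, isprob (q j)) -> contr (bigU q).
Proof.
move=> hq w; have := contr_bigL hq cU w.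
apply: le_trans; rewrite le_eqVlt; apply/orP; left; apply/eqP.
by rewrite !nrm_pair sum_pair; apply: eq_bigr => u _; rewrite nrm_pair.
Qed.

(** Bob and Charlie hold only flags telling whether their questions are bottom; the question itself
    is read from the public [xb]. The private inputs of the four parties are thus independent
    although the questions are correlated. *)
Definition State (qA : 'I_l -> X -> R) (qU : 'I_l -> U -> R)
   (qB qC : 'I_l -> bool -> R) (xb : {ffun 'I_l -> X}) : K4 -> C :=
  amp (bigL qA LA) (bigU qU) (bigL qB (fun f => LB (yof xb f)))
      (bigL qC (fun g => LC (yof xb g))) v.

Definition party_claim (V K' : finType) (p : 'I_l -> V -> R) (T : finType)
   (op : (K' -> K' -> C) -> (T -> C) -> (T -> C)) (S : ('I_l -> V -> R) -> T -> C)
   (d : 'I_l -> R) (F G : 'I_l -> V -> K' -> K' -> C) : Prop :=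
  [/\ forall i w, contr (F i w) /\ contr (G i w),
      forall i, 0 <= d i,
      forall i, \sum_w p i w * nrm (subv (op (F i w) (S p))
                                     (S (updp p i (dirac R w)))) <= d i,
      forall i, \sum_w p i w * nrm (subv (op (G i w) (S (updp p i (dirac R w))))
                                     (S p)) <= d i &
      \sum_i d i <= - (nrm (S p) * ln (nrm (S p)))].

Section Steps.
Variables (qA : 'I_l -> X -> R) (qU : 'I_l -> U -> R) (qB qC : 'I_l -> bool -> R).
Variable xb : {ffun 'I_l -> X}.
Hypothesis hA : forall j, isprob (qA j).
Hypothesis hU : forall j, isprob (qU j).
Hypothesis hB : forall j, isprob (qB j).
Hypothesis hC : forall j, isprob (qC j).

Let cLB (f : {ffun 'I_l -> bool}) : contr (LB (yof xb f)) := cB _.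
Let cLC (f : {ffun 'I_l -> bool}) : contr (LC (yof xb f)) := cC _.

(** Alice's operation commutes with the others, so the state is her operation applied to [rest],
    which plays the part of the dominating state in [party_step]. *)
Lemma step_A : exists d (F G : 'I_l -> X -> KA' -> KA' -> C),
  party_claim qA (@op1 R KA' KA' _) (fun q => State q qU qB qC xb) d F G.
Proof.
pose rest := opC (bigL qC (fun g => LC (yof xb g)))
  (opB (bigL qB (fun f => LB (yof xb f))) (op2 (bigU qU) v)).
have StE q : State q qU qB qC xb = op1 (bigL q LA) rest.
  by rewrite /State /amp op1_op2 opB_op1 opC_op1.
pose N i j := rest (i, j).
pose M x := mulf (LA x) N.
have StM q k j : State q qU qB qC xb (k, j) = Psi M q k j.
  by rewrite StE /op1 /Psi /M /mulf mulr_sumr; apply: eq_bigr => i _; rewrite mulrA.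
have [] := @party_step R l X qA _ _ _ M N hA.
- by move=> x w; rewrite /M app_mulf; apply: cA.
- rewrite /nrm2 -(nrm_pair rest); apply: le_trans nv.
  apply: le_trans (opC_nrm _ (contr_bigL hC cLC)) _.
  apply: le_trans (opB_nrm _ (contr_bigL hB cLB)) _.
  exact: op2_nrm (contr_bigU hU).
move=> d [F [G [h1 h2 h3 h4 h5]]]; exists d, F, G.
have nS q : nrm (State q qU qB qC xb) = nrm2 (Psi M q).
  by rewrite nrm_pair; apply: eq_bigr => k _; apply: eq_bigr => j _; rewrite StM.
have nF (L : KA' -> KA' -> C) q q' :
   nrm (subv (op1 L (State q qU qB qC xb)) (State q' qU qB qC xb))
     = nrm2 (subf (mulf L (Psi M q)) (Psi M q')).
  rewrite nrm_pair; apply: eq_bigr => k _; apply: eq_bigr => j _; congr sqn.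
  by rewrite /subv StM; congr (_ - _); apply: eq_bigr => i _; rewrite StM.
split=> // [i|i|]; last by rewrite nS.
  by apply: le_trans (h3 i); apply: ler_sum => w _; rewrite nF.
by apply: le_trans (h4 i); apply: ler_sum => w _; rewrite nF.
Qed.

Lemma step_B : exists d (F G : 'I_l -> bool -> KB' -> KB' -> C),
  party_claim qB (@opB R KA' KE' KB' KB' _) (fun q => State qA qU q qC xb) d F G.
Proof.
pose rest := opC (bigL qC (fun g => LC (yof xb g))) (op2 (bigU qU) (op1 (bigL qA LA) v)).
have StE q : State qA qU q qC xb = opB (bigL q (fun f => LB (yof xb f))) rest.
  by rewrite /State /amp opC_opB.
pose N i (j : KA' * (KE' * KC')) := rest (j.1, (j.2.1, (i, j.2.2))).
pose M f := mulf (LB (yof xb f)) N.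
have StM q k (j : KA' * (KE' * KC')) :
    State qA qU q qC xb (j.1, (j.2.1, (k, j.2.2))) = Psi M q k j.
  by rewrite StE /opB /Psi /M /mulf mulr_sumr; apply: eq_bigr => i _; rewrite mulrA.
have nE (Kx : finType) (w : KA' * (KE' * (Kx * KC')) -> C) : nrm w
     = nrm2 (fun k (j : KA' * (KE' * KC')) => w (j.1, (j.2.1, (k, j.2.2)))).
  rewrite /nrm2; under [RHS]eq_bigr => k _ do rewrite sum_pair.
  rewrite exchange_big nrm_pair; apply: eq_bigr => a _ /=.
  under [RHS]eq_bigr => k _ do rewrite sum_pair.
  rewrite exchange_big nrm_pair; apply: eq_bigr => e _ /=.
  by rewrite nrm_pair.
have [] := @party_step R l _ qB _ _ _ M N hB.
- by move=> x w; rewrite /M app_mulf; apply: cB.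
- rewrite -(nE _ rest); apply: le_trans nv.
  apply: le_trans (opC_nrm _ (contr_bigL hC cLC)) _.
  apply: le_trans (op2_nrm _ (contr_bigU hU)) _.
  exact: op1_nrm (contr_bigL hA cA).
move=> d [F [G [h1 h2 h3 h4 h5]]]; exists d, F, G.
have nS q : nrm (State qA qU q qC xb) = nrm2 (Psi M q).
  by rewrite nE; apply: eq_bigr => k _; apply: eq_bigr => j _; rewrite StM.
have nF (L : KB' -> KB' -> C) q q' :
   nrm (subv (opB L (State qA qU q qC xb)) (State qA qU q' qC xb))
     = nrm2 (subf (mulf L (Psi M q)) (Psi M q')).
  rewrite nE; apply: eq_bigr => k _; apply: eq_bigr => j _; congr sqn.
  by rewrite /subv StM; congr (_ - _); apply: eq_bigr => i _; rewrite -StM.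
split=> // [i|i|]; last by rewrite nS.
  by apply: le_trans (h3 i); apply: ler_sum => w _; rewrite nF.
by apply: le_trans (h4 i); apply: ler_sum => w _; rewrite nF.
Qed.

Lemma step_C : exists d (F G : 'I_l -> bool -> KC' -> KC' -> C),
  party_claim qC (@opC R KA' KE' KC' KC' _) (fun q => State qA qU qB q xb) d F G.
Proof.
pose rest := opB (bigL qB (fun f => LB (yof xb f))) (op2 (bigU qU) (op1 (bigL qA LA) v)).
have StE q : State qA qU qB q xb = opC (bigL q (fun f => LC (yof xb f))) rest by [].
pose N i (j : KA' * (KE' * KB')) := rest (j.1, (j.2.1, (j.2.2, i))).
pose M f := mulf (LC (yof xb f)) N.
have StM q k (j : KA' * (KE' * KB')) :
    State qA qU qB q xb (j.1, (j.2.1, (j.2.2, k))) = Psi M q k j.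
  by rewrite StE /opC /Psi /M /mulf mulr_sumr; apply: eq_bigr => i _; rewrite mulrA.
have nE (Kx : finType) (w : KA' * (KE' * (KB' * Kx)) -> C) : nrm w
     = nrm2 (fun k (j : KA' * (KE' * KB')) => w (j.1, (j.2.1, (j.2.2, k)))).
  rewrite /nrm2; under [RHS]eq_bigr => k _ do rewrite sum_pair.
  rewrite exchange_big nrm_pair; apply: eq_bigr => a _ /=.
  under [RHS]eq_bigr => k _ do rewrite sum_pair.
  rewrite exchange_big nrm_pair; apply: eq_bigr => e _ /=.
  by rewrite nrm_pairC.
have [] := @party_step R l _ qC _ _ _ M N hC.
- by move=> x w; rewrite /M app_mulf; apply: cC.
- rewrite -(nE _ rest); apply: le_trans nv.
  apply: le_trans (opB_nrm _ (contr_bigL hB cLB)) _.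
  apply: le_trans (op2_nrm _ (contr_bigU hU)) _.
  exact: op1_nrm (contr_bigL hA cA).
move=> d [F [G [h1 h2 h3 h4 h5]]]; exists d, F, G.
have nS q : nrm (State qA qU qB q xb) = nrm2 (Psi M q).
  by rewrite nE; apply: eq_bigr => k _; apply: eq_bigr => j _; rewrite StM.
have nF (L : KC' -> KC' -> C) q q' :
   nrm (subv (opC L (State qA qU qB q xb)) (State qA qU qB q' xb))
     = nrm2 (subf (mulf L (Psi M q)) (Psi M q')).
  rewrite nE; apply: eq_bigr => k _; apply: eq_bigr => j _; congr sqn.
  by rewrite /subv StM; congr (_ - _); apply: eq_bigr => i _; rewrite -StM.
split=> // [i|i|]; last by rewrite nS.
  by apply: le_trans (h3 i); apply: ler_sum => w _; rewrite nF.
by apply: le_trans (h4 i); apply: ler_sum => w _; rewrite nF.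
Qed.

(** Bob and Charlie act on what Barlie sends, so his operation cannot be postponed after theirs. His
    register is taken to include theirs, which is harmless: in the simulated copy he acts before
    anything is distributed. *)
Lemma step_U : exists d
    (F G : 'I_l -> U -> KE' * (KB' * KC') -> KE' * (KB' * KC') -> C),
  party_claim qU (@op2 R (KE' * (KB' * KC'))%type _ KA') (fun q => State qA q qB qC xb) d F G.
Proof.
pose w' := op1 (bigL qA LA) v.
pose N t a := w' (a, t).
pose lB := bigL qB (fun f => LB (yof xb f)).
pose lC := bigL qC (fun f => LC (yof xb f)).
pose M u (k : KE * (KB' * KC')) a := opC lC (opB lB (op2 (LU u) w')) (a, k).
pose re (k : KE' * (KB' * KC')) : {ffun 'I_l -> U} * (KE * (KB' * KC')) :=
  (k.1.1, (k.1.2, k.2)).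
pose er (k : {ffun 'I_l -> U} * (KE * (KB' * KC'))) : KE' * (KB' * KC') :=
  ((k.1, k.2.1), k.2.2).
have reK : cancel re er by case=> [[? ?] ?].
have erK : cancel er re by case=> [? [? ?]].
have StM q a k : State qA q qB qC xb (a, k) = Psi M q (re k) a.
  case: k => -[u e] [b c]; rewrite /State /amp /Psi /M /re /= /opC /opB /op2 /=.
  rewrite mulr_sumr; apply: eq_bigr => i _; rewrite mulrCA; congr (_ * _).
  rewrite mulr_sumr; apply: eq_bigr => j _; rewrite mulrCA; congr (_ * _).
  by rewrite mulr_sumr; apply: eq_bigr => t _; rewrite mulrA.
have nE (w : K4 -> C) : nrm w = nrm2 (fun k a => w (a, er k)).
  rewrite nrm_pairC /nrm2 (reindex er) //.
  by exists re => k _; rewrite ?reK ?erK.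
have [] := @party_step R l _ qU _ _ _ M N hU.
- move=> u w.
  (* Contracting Alice's register with [w] leaves the single vector [y], on which the operations of
     Barlie, Bob and Charlie act as contractions. *)
  pose row (_ : unit) a := w a.
  pose y : unit * IU -> C := op1 row w'.
  have -> : nrm (app N w) = nrm y.
    rewrite [RHS]nrm_pair sum_unit; apply: eq_bigr => t _; congr sqn.
    by apply: eq_bigr => a _; rewrite mulrC.
  have -> : nrm (app (M u) w) = nrm (opC lC (opB lB (op2 (LU u) y))).
    rewrite /y op1_op2 opB_op1 opC_op1 [in RHS]nrm_pair sum_unit.
    apply: eq_bigr => t _; congr sqn.
    by apply: eq_bigr => a _; rewrite mulrC.
  apply: le_trans (opC_nrm _ (contr_bigL hC cLC)) _.
  apply: le_trans (opB_nrm _ (contr_bigL hB cLB)) _.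
  exact: op2_nrm.
- rewrite /nrm2 exchange_big -(nrm_pair w'); apply: le_trans nv.
  exact: op1_nrm (contr_bigL hA cA).
move=> d [F [G [h1 h2 h3 h4 h5]]].
exists d, (fun i w k k' => F i w (re k) (re k')), (fun i w k k' => G i w (re k) (re k')).
have nS q : nrm (State qA q qB qC xb) = nrm2 (Psi M q).
  by rewrite nE; apply: eq_bigr => k _; apply: eq_bigr => j _; rewrite StM erK.
have nF L q q' :
   nrm (subv (op2 (fun k k' => L (re k) (re k')) (State qA q qB qC xb)) (State qA q' qB qC xb))
     = nrm2 (subf (mulf L (Psi M q)) (Psi M q')).
  rewrite nE; apply: eq_bigr => k _; apply: eq_bigr => j _; congr sqn.
  rewrite /subv StM erK; congr (_ - _); rewrite /op2 /= erK.
  rewrite /mulf [RHS](reindex re) /=; last by exists er => k' _; rewrite ?reK ?erK.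
  by apply: eq_bigr => i _; rewrite StM.
split=> // [i w|i|i|]; last by rewrite nS.
- by have [? ?] := h1 i w; split; apply: (contr_reindex reK erK).
- by apply: le_trans (h3 i); apply: ler_sum => w _; rewrite nF.
- by apply: le_trans (h4 i); apply: ler_sum => w _; rewrite nF.
Qed.

End Steps.
End States.

(** * Linearity of squared norms in the law of one coordinate *)

Section Linearity.
Variable R : realType.
Local Notation C := (complex R).
Local Notation "x %:C" := (real_complex R x).

(** Copies of the inputs stay in the registers, so a squared norm has no cross terms and is linear
    in the marginal at [i]. This lets an error proved for a superposed coordinate be split exactly
    into errors for its fixed values, also when another party acts. *)
Lemma pm_linear (l : nat) (V K : finType) (key : K -> {ffun 'I_l -> V}) (Y : K -> R)
    (f : ('I_l -> V -> R) -> R) (q : 'I_l -> V -> R) (i : 'I_l) (m : V -> R) :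
  (forall q, (forall j, isprob (q j)) -> f q = \sum_k pm q (key k) * Y k) ->
  (forall j, isprob (q j)) -> isprob m ->
  f (updp q i m) = \sum_w m w * f (updp q i (dirac R w)).
Proof.
move=> hf hq hm; rewrite hf; last exact: updp_prob.
under eq_bigr => k _ do rewrite pm_updp_sum mulr_suml.
rewrite exchange_big; apply: eq_bigr => w _ /=; rewrite hf.
  by rewrite mulr_sumr; apply: eq_bigr => k _; rewrite mulrA.
by apply: updp_prob => //; apply: isprob_dirac.
Qed.

Lemma nrm_scaled (l : nat) (V K : finType) (key : K -> {ffun 'I_l -> V})
    (q : 'I_l -> V -> R) (G : K -> R) (w w0 : K -> C) :
  (forall j, isprob (q j)) ->
  (forall k, w k = (Num.sqrt (pm q (key k)))%:C * w0 k) ->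
  \sum_k G k * sqn (w k) = \sum_k pm q (key k) * (G k * sqn (w0 k)).
Proof.
move=> hq h; apply: eq_bigr => k _; rewrite h sqnM sqn_real sqr_sqrtr ?pm_ge0 //.
exact: mulrCA.
Qed.

Lemma nrm_scaled1 (l : nat) (V K : finType) (key : K -> {ffun 'I_l -> V})
    (q : 'I_l -> V -> R) (w w0 : K -> C) :
  (forall j, isprob (q j)) ->
  (forall k, w k = (Num.sqrt (pm q (key k)))%:C * w0 k) ->
  nrm w = \sum_k pm q (key k) * sqn (w0 k).
Proof.
move=> hq h; have := nrm_scaled (fun=> 1) hq h.
by under eq_bigr do rewrite mul1r; under [in RHS]eq_bigr do rewrite mul1r.
Qed.

Variables (X U : finType) (l : nat).
Variables (KA KE KB KC IA IU IB IC : finType).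
Variables (LA : {ffun 'I_l -> X} -> KA -> IA -> C).
Variables (LU : {ffun 'I_l -> U} -> KE * (IB * IC) -> IU -> C).
Variables (LB : {ffun 'I_l -> option X} -> KB -> IB -> C).
Variables (LC : {ffun 'I_l -> option X} -> KC -> IC -> C).
Variable v : IA * IU -> C.
Local Notation KA' := ({ffun 'I_l -> X} * KA)%type.
Local Notation KE' := ({ffun 'I_l -> U} * KE)%type.
Local Notation KB' := ({ffun 'I_l -> bool} * KB)%type.
Local Notation KC' := ({ffun 'I_l -> bool} * KC)%type.
Local Notation K4 := (KA' * (KE' * (KB' * KC')))%type.
Local Notation St := (State LA LU LB LC v).
Implicit Types (qA : 'I_l -> X -> R) (qU : 'I_l -> U -> R) (qB qC : 'I_l -> bool -> R).
Implicit Types (xb : {ffun 'I_l -> X}).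

(** In [StA] to [StC] the amplitude of one party's input is left out, so that the law of this input
    enters the state only as an explicit factor. *)
Definition StA qU qB qC xb : K4 -> C := op1 (flatL LA)
  (opC (bigL qC (fun g => LC (yof xb g)))
  (opB (bigL qB (fun f => LB (yof xb f))) (op2 (bigU LU qU) v))).
Definition StU qA qB qC xb : K4 -> C := opC (bigL qC (fun g => LC (yof xb g)))
  (opB (bigL qB (fun f => LB (yof xb f))) (op2 (flatU LU) (op1 (bigL qA LA) v))).
Definition StB qA qU qC xb : K4 -> C := opB (flatL (fun f => LB (yof xb f)))
  (opC (bigL qC (fun g => LC (yof xb g))) (op2 (bigU LU qU) (op1 (bigL qA LA) v))).
Definition StC qA qU qB xb : K4 -> C := opC (flatL (fun g => LC (yof xb g)))
  (opB (bigL qB (fun f => LB (yof xb f))) (op2 (bigU LU qU) (op1 (bigL qA LA) v))).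

Lemma StAE qA qU qB qC xb k :
  St qA qU qB qC xb k = (Num.sqrt (pm qA k.1.1))%:C * StA qU qB qC xb k.
Proof.
have -> : St qA qU qB qC xb = op1 (bigL qA LA) (opC (bigL qC (fun g => LC (yof xb g)))
  (opB (bigL qB (fun f => LB (yof xb f))) (op2 (bigU LU qU) v))).
  by rewrite /State /amp op1_op2 opB_op1 opC_op1.
by rewrite mulr_sumr; apply: eq_bigr => i _; rewrite -mulrA.
Qed.

Lemma StUE qA qU qB qC xb k :
  St qA qU qB qC xb k = (Num.sqrt (pm qU k.2.1.1))%:C * StU qA qB qC xb k.
Proof.
rewrite /State /amp /StU /opC mulr_sumr; apply: eq_bigr => c _.
rewrite mulrCA; congr (_ * _).
rewrite /opB mulr_sumr; apply: eq_bigr => b _; rewrite mulrCA; congr (_ * _).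
by rewrite /op2 mulr_sumr; apply: eq_bigr => t _; rewrite -mulrA.
Qed.

Lemma StBE qA qU qB qC xb k :
  St qA qU qB qC xb k = (Num.sqrt (pm qB k.2.2.1.1))%:C * StB qA qU qC xb k.
Proof.
rewrite /State /amp opC_opB /StB /opB mulr_sumr; apply: eq_bigr => b _.
by rewrite -mulrA.
Qed.

Lemma StCE qA qU qB qC xb k :
  St qA qU qB qC xb k = (Num.sqrt (pm qC k.2.2.2.1))%:C * StC qA qU qB xb k.
Proof.
rewrite /State /amp /StC /opC mulr_sumr; apply: eq_bigr => b _.
by rewrite -mulrA.
Qed.

Section Refine.
Variables (i : 'I_l).

Lemma lin_pay (G : K4 -> R) :
  [/\ forall qA qU qB qC xb (m : X -> R), (forall j, isprob (qA j)) -> isprob m ->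
      \sum_k G k * sqn (St (updp qA i m) qU qB qC xb k)
       = \sum_x m x * \sum_k G k * sqn (St (updp qA i (dirac R x)) qU qB qC xb k),
    forall qA qU qB qC xb (m : U -> R), (forall j, isprob (qU j)) -> isprob m ->
      \sum_k G k * sqn (St qA (updp qU i m) qB qC xb k)
       = \sum_x m x * \sum_k G k * sqn (St qA (updp qU i (dirac R x)) qB qC xb k),
    forall qA qU qB qC xb (m : bool -> R), (forall j, isprob (qB j)) -> isprob m ->
      \sum_k G k * sqn (St qA qU (updp qB i m) qC xb k)
       = \sum_x m x * \sum_k G k * sqn (St qA qU (updp qB i (dirac R x)) qC xb k) &
    forall qA qU qB qC xb (m : bool -> R), (forall j, isprob (qC j)) -> isprob m ->
      \sum_k G k * sqn (St qA qU qB (updp qC i m) xb k)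
       = \sum_x m x * \sum_k G k * sqn (St qA qU qB (updp qC i (dirac R x)) xb k)].
Proof.
split=> qA qU qB qC xb m hq hm.
- apply: (pm_linear (f := fun q => \sum_k G k * sqn (St q qU qB qC xb k))) => // q hq'.
  by apply: nrm_scaled => // k; apply: StAE.
- apply: (pm_linear (f := fun q => \sum_k G k * sqn (St qA q qB qC xb k))) => // q hq'.
  by apply: nrm_scaled => // k; apply: StUE.
- apply: (pm_linear (f := fun q => \sum_k G k * sqn (St qA qU q qC xb k))) => // q hq'.
  by apply: nrm_scaled => // k; apply: StBE.
- apply: (pm_linear (f := fun q => \sum_k G k * sqn (St qA qU qB q xb k))) => // q hq'.
  by apply: nrm_scaled => // k; apply: StCE.
Qed.

Lemma lin_op2_A (F : KE' * (KB' * KC') -> KE' * (KB' * KC') -> C)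
    qA qU qU' qB qB' qC qC' xb (m : X -> R) :
  (forall j, isprob (qA j)) -> isprob m ->
  nrm (subv (op2 F (St (updp qA i m) qU qB qC xb)) (St (updp qA i m) qU' qB' qC' xb))
  = \sum_x m x * nrm (subv (op2 F (St (updp qA i (dirac R x)) qU qB qC xb))
                           (St (updp qA i (dirac R x)) qU' qB' qC' xb)).
Proof.
move=> hq hm; apply: (pm_linear (f := fun q =>
  nrm (subv (op2 F (St q qU qB qC xb)) (St q qU' qB' qC' xb))) (key := fun k : K4 => k.1.1)
  (Y := fun k => sqn (subv (op2 F (StA qU qB qC xb)) (StA qU' qB' qC' xb) k))) => // q hq'.
apply: nrm_scaled1 => // k; rewrite /subv mulrBr -StAE; congr (_ - _).
by rewrite /op2 mulr_sumr; apply: eq_bigr => j _; rewrite StAE mulrCA.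
Qed.

Lemma lin_opB_U (F : KB' -> KB' -> C) qA qU qB qB' qC xb (m : U -> R) :
  (forall j, isprob (qU j)) -> isprob m ->
  nrm (subv (opB F (St qA (updp qU i m) qB qC xb)) (St qA (updp qU i m) qB' qC xb))
  = \sum_x m x * nrm (subv (opB F (St qA (updp qU i (dirac R x)) qB qC xb))
                           (St qA (updp qU i (dirac R x)) qB' qC xb)).
Proof.
move=> hq hm; apply: (pm_linear (f := fun q =>
  nrm (subv (opB F (St qA q qB qC xb)) (St qA q qB' qC xb))) (key := fun k : K4 => k.2.1.1)
  (Y := fun k => sqn (subv (opB F (StU qA qB qC xb)) (StU qA qB' qC xb) k))) => // q hq'.
apply: nrm_scaled1 => // k; rewrite /subv mulrBr -StUE; congr (_ - _).
by rewrite /opB mulr_sumr; apply: eq_bigr => j _; rewrite StUE mulrCA.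
Qed.

Lemma lin_opB_C (F : KB' -> KB' -> C) qA qU qB qB' qC xb (m : bool -> R) :
  (forall j, isprob (qC j)) -> isprob m ->
  nrm (subv (opB F (St qA qU qB (updp qC i m) xb)) (St qA qU qB' (updp qC i m) xb))
  = \sum_x m x * nrm (subv (opB F (St qA qU qB (updp qC i (dirac R x)) xb))
                           (St qA qU qB' (updp qC i (dirac R x)) xb)).
Proof.
move=> hq hm; apply: (pm_linear (f := fun q =>
  nrm (subv (opB F (St qA qU qB q xb)) (St qA qU qB' q xb))) (key := fun k : K4 => k.2.2.2.1)
  (Y := fun k => sqn (subv (opB F (StC qA qU qB xb)) (StC qA qU qB' xb) k))) => // q hq'.
apply: nrm_scaled1 => // k; rewrite /subv mulrBr -StCE; congr (_ - _).
by rewrite /opB mulr_sumr; apply: eq_bigr => j _; rewrite StCE mulrCA.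
Qed.

Lemma lin_opC_U (F : KC' -> KC' -> C) qA qU qB qC qC' xb (m : U -> R) :
  (forall j, isprob (qU j)) -> isprob m ->
  nrm (subv (opC F (St qA (updp qU i m) qB qC xb)) (St qA (updp qU i m) qB qC' xb))
  = \sum_x m x * nrm (subv (opC F (St qA (updp qU i (dirac R x)) qB qC xb))
                           (St qA (updp qU i (dirac R x)) qB qC' xb)).
Proof.
move=> hq hm; apply: (pm_linear (f := fun q =>
  nrm (subv (opC F (St qA q qB qC xb)) (St qA q qB qC' xb))) (key := fun k : K4 => k.2.1.1)
  (Y := fun k => sqn (subv (opC F (StU qA qB qC xb)) (StU qA qB qC' xb) k))) => // q hq'.
apply: nrm_scaled1 => // k; rewrite /subv mulrBr -StUE; congr (_ - _).
by rewrite /opC mulr_sumr; apply: eq_bigr => j _; rewrite StUE mulrCA.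
Qed.

Lemma lin_opC_B (F : KC' -> KC' -> C) qA qU qB qC qC' xb (m : bool -> R) :
  (forall j, isprob (qB j)) -> isprob m ->
  nrm (subv (opC F (St qA qU (updp qB i m) qC xb)) (St qA qU (updp qB i m) qC' xb))
  = \sum_x m x * nrm (subv (opC F (St qA qU (updp qB i (dirac R x)) qC xb))
                           (St qA qU (updp qB i (dirac R x)) qC' xb)).
Proof.
move=> hq hm; apply: (pm_linear (f := fun q =>
  nrm (subv (opC F (St qA qU q qC xb)) (St qA qU q qC' xb))) (key := fun k : K4 => k.2.2.1.1)
  (Y := fun k => sqn (subv (opC F (StB qA qU qC xb)) (StB qA qU qC' xb) k))) => // q hq'.
apply: nrm_scaled1 => // k; rewrite /subv mulrBr -StBE; congr (_ - _).
by rewrite /opC mulr_sumr; apply: eq_bigr => j _; rewrite StBE mulrCA.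
Qed.

End Refine.
End Linearity.

Section Hybrid.
Variable R : realType.
Local Notation C := (complex R).

Lemma nrm_subv_tri (I : finType) (a b c : I -> C) :
  nrm (subv a c) <= 2 * nrm (subv a b) + 2 * nrm (subv b c).
Proof.
have := nrmD_le (subv a b) (subv b c) (@ltr01 R); rewrite invr1.
by have -> : nrm (fun i => subv a b i + subv b c i) = nrm (subv a c);
  first by apply: eq_bigr => i _; congr sqn; rewrite /subv addrA subrK.
Qed.

Definition nonexp (I : finType) (O : (I -> C) -> (I -> C)) : Prop :=
  (forall v w, O (subv v w) = subv (O v) (O w)) /\ forall v, nrm (O v) <= nrm v.

Lemma nonexp_comp (I : finType) (O O' : (I -> C) -> (I -> C)) :
  nonexp O -> nonexp O' -> nonexp (fun v => O (O' v)).
Proof.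
by move=> [s c] [s' c']; split=> [v w|v]; [rewrite s' s | apply: le_trans (c _) (c' _)].
Qed.

Lemma nonexp_dist (I : finType) (O : (I -> C) -> (I -> C)) v w : nonexp O ->
  nrm (subv (O v) (O w)) <= nrm (subv v w).
Proof. by move=> [s c]; rewrite -s. Qed.

Lemma hybrid2 (I : finType) (O1 O2 : (I -> C) -> (I -> C)) a b c : nonexp O2 ->
  nrm (subv (O2 (O1 a)) c) <= 2 * nrm (subv (O1 a) b) + 2 * nrm (subv (O2 b) c).
Proof.
move=> n2; apply: le_trans (nrm_subv_tri _ (O2 b) _) _.
by rewrite lerD2r ler_pM2l // nonexp_dist.
Qed.

(** Two nested uses of the triangle inequality for squared norms, each losing a factor 2. *)
Lemma hybrid4 (I : finType) (O1 O2 O3 O4 : (I -> C) -> (I -> C)) v0 v1 v2 v3 v4 :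
  nonexp O2 -> nonexp O3 -> nonexp O4 ->
  nrm (subv (O4 (O3 (O2 (O1 v0)))) v4)
   <= 4 * (nrm (subv (O1 v0) v1) + nrm (subv (O2 v1) v2) + nrm (subv (O3 v2) v3)
           + nrm (subv (O4 v3) v4)).
Proof.
move=> n2 n3 n4.
have h := hybrid2 (fun v => O2 (O1 v)) v0 v2 v4 (nonexp_comp n4 n3).
have h1 := hybrid2 O1 v0 v1 v2 n2; have h2 := hybrid2 O3 v2 v3 v4 n4.
lra.
Qed.

Lemma hybrid4_rev (I : finType) (O1 O2 O3 O4 : (I -> C) -> (I -> C)) v0 v1 v2 v3 v4 :
  nonexp O2 -> nonexp O3 -> nonexp O4 ->
  nrm (subv (O4 (O3 (O2 (O1 v0)))) v4)
   <= 4 * (nrm (subv (O4 v3) v4) + nrm (subv (O3 v2) v3) + nrm (subv (O2 v1) v2)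
           + nrm (subv (O1 v0) v1)).
Proof.
move=> n2 n3 n4; have := hybrid4 O1 v0 v1 v2 v3 v4 n2 n3 n4; lra.
Qed.

Lemma nonexp_op1 (K T : finType) (L : K -> K -> C) :
  contr L -> nonexp (@op1 R K K T L).
Proof. by move=> cL; split=> [v w|v]; [apply: op1_sub | apply: op1_nrm]. Qed.
Lemma nonexp_op2 (K T : finType) (L : K -> K -> C) :
  contr L -> nonexp (@op2 R K K T L).
Proof. by move=> cL; split=> [v w|v]; [apply: op2_sub | apply: op2_nrm]. Qed.
Lemma nonexp_opB (S T K J : finType) (L : K -> K -> C) :
  contr L -> nonexp (@opB R S T K K J L).
Proof. by move=> cL; split=> [v w|v]; [apply: opB_sub | apply: opB_nrm]. Qed.
Lemma nonexp_opC (S T K J : finType) (L : K -> K -> C) :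
  contr L -> nonexp (@opC R S T K K J L).
Proof. by move=> cL; split=> [v w|v]; [apply: opC_sub | apply: opC_nrm]. Qed.

Lemma mulf_sum (K I : finType) (L M : K -> K -> C) k (w : K -> C) :
  \sum_i mulf L M k i * w i = \sum_j L k j * \sum_i M j i * w i.
Proof. by have := app_mulf L M w => /(congr1 (fun f => f k)). Qed.

Lemma opB_mulf (S T K J : finType) (L M : K -> K -> C) (w : S * (T * (K * J)) -> C) :
  opB (mulf L M) w = opB L (opB M w).
Proof. by apply: funext => k; rewrite /opB mulf_sum. Qed.
Lemma opC_mulf (S T K J : finType) (L M : K -> K -> C) (w : S * (T * (J * K)) -> C) :
  opC (mulf L M) w = opC L (opC M w).
Proof. by apply: funext => k; rewrite /opC mulf_sum. Qed.
Lemma opB_idf (S T K J : finType) (w : S * (T * (K * J)) -> C) : opB (@idf R K) w = w.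
Proof. by apply: funext => -[s [t [k j]]]; rewrite /opB sum_idf. Qed.
Lemma opC_idf (S T K J : finType) (w : S * (T * (J * K)) -> C) : opC (@idf R K) w = w.
Proof. by apply: funext => -[s [t [k j]]]; rewrite /opC sum_idf. Qed.

Lemma nrm_subvv (I : finType) (a : I -> C) : nrm (subv a a) = 0.
Proof. by apply: big1 => i _; rewrite /subv subrr sqn0. Qed.

Definition bern (t : R) (b : bool) : R := if b then t else 1 - t.

Lemma isprob_bern t : 0 <= t <= 1 -> isprob (bern t).
Proof.
move=> /andP[t0 t1]; split; first by case; rewrite //= subr_ge0.
by rewrite big_bool /= addrC subrK.
Qed.

(** One of the two pinned values has weight t, the other 1 - t. The factor 1 - al, the probability
    of a question other than bottom, is at most 1 - t and absorbs the second loss, so only 1 / t is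
    paid. *)
Lemma pair_bound (t al d S1 S0 : R) (s : bool) : 0 < t -> t < 1 -> t <= al ->
  0 <= 1 - al -> 0 <= S1 -> 0 <= S0 ->
  bern t s * S1 <= d -> bern t (~~ s) * S0 <= d ->
  (1 - al) * (2 * S1 + 2 * S0) <= 4 * d / t.
Proof.
move=> t0 t1 ta a0.
wlog -> : s S1 S0 / s = true.
  move=> H; case: s; first exact: H.
  by move=> p1 p0 h1 h0; rewrite [2 * S1 + _]addrC; apply: (H true).
move=> /= p1 p0 h1 h0.
have d0 : 0 <= d by apply: le_trans h1; rewrite mulr_ge0 // ltW.
have e1 : (1 - al) * S1 <= d / t.
  rewrite ler_pdivlMr // -mulrA [S1 * t]mulrC.
  have : (1 - al) * (t * S1) <= 1 * d by apply: ler_pM => //; [rewrite mulr_ge0 // ltW | lra].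
  by rewrite mul1r.
have e0 : (1 - al) * S0 <= d / t.
  apply: le_trans (_ : (1 - t) * S0 <= _); first by rewrite ler_wpM2r //; lra.
  apply: le_trans h0 _; rewrite ler_pdivlMr // ler_piMr // ltW //.
have -> : 4 * d / t = 4 * (d / t) by rewrite mulrA.
lra.
Qed.

End Hybrid.

Lemma pm_updp_supp (R : realType) (l : nat) (V : finType) (p : 'I_l -> V -> R) i w x :
  pm (updp p i (dirac R w)) x != 0 -> x i = w.
Proof.
by rewrite pm_updp /dirac; have [//|_] := eqVneq (x i) w; rewrite mul0r eqxx.
Qed.

(** * Moving all four parties to fixed inputs at one coordinate *)

Section Chain.
Variable R : realType.
Local Notation C := (complex R).
Local Notation "x %:C" := (real_complex R x).
Variables (X U : finType) (l : nat).
Variables (KA KE KB KC IA IU IB IC : finType).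
Variables (LA : {ffun 'I_l -> X} -> KA -> IA -> C).
Variables (LU : {ffun 'I_l -> U} -> KE * (IB * IC) -> IU -> C).
Variables (LB : {ffun 'I_l -> option X} -> KB -> IB -> C).
Variables (LC : {ffun 'I_l -> option X} -> KC -> IC -> C).
Variable v : IA * IU -> C.
Local Notation KA' := ({ffun 'I_l -> X} * KA)%type.
Local Notation KE' := ({ffun 'I_l -> U} * KE)%type.
Local Notation KB' := ({ffun 'I_l -> bool} * KB)%type.
Local Notation KC' := ({ffun 'I_l -> bool} * KC)%type.
Local Notation K4 := (KA' * (KE' * (KB' * KC')))%type.
Variables (PX : X -> R) (PU : U -> R) (al t2 : R).
Hypothesis hPX : isprob PX.
Hypothesis hPU : isprob PU.
Hypothesis t0 : 0 < t2.
Hypothesis t1 : t2 < 1.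
Hypothesis ta : t2 <= al.
Hypothesis at2 : al <= 2 * t2.
Hypothesis al1 : al < 1.
Variables (qA : 'I_l -> X -> R) (qU : 'I_l -> U -> R) (qB qC : 'I_l -> bool -> R).
Hypothesis hA : forall j, isprob (qA j).
Hypothesis hU : forall j, isprob (qU j).
Hypothesis hB : forall j, isprob (qB j).
Hypothesis hC : forall j, isprob (qC j).
Variables (i : 'I_l) (xb : {ffun 'I_l -> X}).
Local Notation S mA mU mB mC xb := (State LA LU LB LC v
  (updp qA i mA) (updp qU i mU) (updp qB i mB) (updp qC i mC) xb).
Local Notation "\d z" := (dirac R z) (at level 8, z at level 8).
Local Notation beta := (bern t2).
Local Notation bal := (bern al).

Let hbeta : isprob beta.
Proof. by apply: isprob_bern; rewrite !ltW. Qed.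
Let hbal : isprob bal.
Proof. by apply: isprob_bern; rewrite (ltW al1) andbT (le_trans (ltW t0)). Qed.

(* At coordinate i Bob and Charlie see bottom, so the revealed question of
   Alice at i does not matter. *)
Lemma state_bot_irrel mA mU (y : X) :
  S mA mU \d true \d true (upd xb i y) = S mA mU \d true \d true xb.
Proof.
have E (q : 'I_l -> bool -> R) (K I : finType)
   (L : {ffun 'I_l -> option X} -> K -> I -> C) :
   bigL (updp q i \d true) (fun f => L (yof (upd xb i y) f))
    = bigL (updp q i \d true) (fun f => L (yof xb f)).
  apply: funext => k; apply: funext => j; rewrite /bigL.
  have [->|nz] := eqVneq (pm (updp q i \d true) k.1) 0.
    by rewrite sqrtr0 !mul0r.
  congr (_ * L _ _ _); apply/ffunP=> c; rewrite !ffunE.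
  have [->|//] := eqVneq c i; rewrite /bot_or.
  by rewrite (pm_updp_supp nz).
by rewrite /State !E.
Qed.

Section Transition.
Variable x : X.
Variables (FB GB : bool -> KB' -> KB' -> C) (FC GC : bool -> KC' -> KC' -> C).
Hypothesis cFB : forall b, contr (FB b).
Hypothesis cFC : forall b, contr (FC b).
Variables dB dC : R.
Let S1 := fun mU mB mC => S \d x mU mB mC (upd xb i x).
Hypothesis hFB : \sum_f beta f * nrm (subv (opB (FB f) (S1 PU beta beta)) (S1 PU \d f beta)) <= dB.
Hypothesis hGB : \sum_f beta f * nrm (subv (opB (GB f) (S1 PU \d f beta)) (S1 PU beta beta)) <= dB.
Hypothesis hFC : \sum_f beta f * nrm (subv (opC (FC f) (S1 PU beta beta)) (S1 PU beta \d f)) <= dC.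
Hypothesis hGC : \sum_f beta f * nrm (subv (opC (GC f) (S1 PU beta \d f)) (S1 PU beta beta)) <= dC.

Let beta0 b : 0 <= beta b.
Proof. by case: hbeta. Qed.
Let bal0 b : 0 <= bal b.
Proof. by case: hbal. Qed.
Let PU0 u : 0 <= PU u.
Proof. by case: hPU. Qed.

Let pick (f : bool -> R) (d : R) b : (forall b, 0 <= f b) ->
  \sum_b beta b * f b <= d -> beta b * f b <= d.
Proof.
move=> f0; apply: le_trans; rewrite (bigD1 b) //= lerDl sumr_ge0 // => c _.
exact: mulr_ge0.
Qed.

(** Bob passes to the opposite flag through the superposed one: [GB s] undoes the pinning and
    [FB (~~ s)] pins again. Charlie's flag is held at bottom, which has weight [t2] in his
    superposition; this is the inner division by [t2]. *)
Lemma transB s : (1 - al) * (\sum_u PU u *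
   nrm (subv (opB (mulf (FB (~~ s)) (GB s)) (S1 \d u \d s \d true))
             (S1 \d u \d (~~ s) \d true))) <= 4 * (dB / t2) / t2.
Proof.
pose a1 u := nrm (subv (opB (GB s) (S1 \d u \d s \d true)) (S1 \d u beta \d true)).
pose a0 u := nrm (subv (opB (FB (~~ s)) (S1 \d u beta \d true)) (S1 \d u \d (~~ s) \d true)).
have sum0 (a : U -> R) : (forall u, 0 <= a u) -> 0 <= \sum_u PU u * a u.
  by move=> a0'; apply: sumr_ge0 => u _; rewrite mulr_ge0.
apply: le_trans (_ : (1 - al) * (2 * (\sum_u PU u * a1 u) + 2 * (\sum_u PU u * a0 u)) <= _).
  apply: ler_wpM2l; first by rewrite subr_ge0 ltW.
  rewrite !mulr_sumr -big_split; apply: ler_sum => u _ /=.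
  rewrite mulrCA [X in _ <= _ + X]mulrCA -mulrDr ler_wpM2l // opB_mulf.
  by apply: hybrid2; apply: nonexp_opB.
have key (b : bool) (f : U -> bool -> R) : (forall u g, 0 <= f u g) ->
   beta b * (\sum_u PU u * \sum_g beta g * f u g) <= dB ->
   beta b * (\sum_u PU u * f u true) <= dB / t2.
  move=> f0 h; rewrite ler_pdivlMr // -mulrA; apply: le_trans h.
  rewrite ler_wpM2l // mulr_suml; apply: ler_sum => u _.
  rewrite -mulrA ler_wpM2l // (bigD1 true) //= mulrC lerDl sumr_ge0 // => c _.
  exact: mulr_ge0.
apply: (pair_bound (s := s)) => //.
- by rewrite subr_ge0 ltW.
- by apply: sum0 => u; apply: nrm_ge0.
- by apply: sum0 => u; apply: nrm_ge0.
- apply: (key s (fun u g => nrm (subv (opB (GB s) (S1 \d u \d s \d g)) (S1 \d u beta \d g)))).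
    by move=> u g; apply: nrm_ge0.
  have := pick s (fun b => nrm_ge0 _) hGB; apply: le_trans; rewrite ler_wpM2l //.
  rewrite /S1 lin_opB_U // le_eqVlt; apply/orP; left; apply/eqP.
  by apply: eq_bigr => u _; rewrite [in RHS]lin_opB_C.
- apply: (key (~~ s) (fun u g => nrm (subv (opB (FB (~~ s)) (S1 \d u beta \d g)) (S1 \d u \d (~~ s) \d g)))).
    by move=> u g; apply: nrm_ge0.
  have := pick (~~ s) (fun b => nrm_ge0 _) hFB; apply: le_trans; rewrite ler_wpM2l //.
  rewrite /S1 lin_opB_U // le_eqVlt; apply/orP; left; apply/eqP.
  by apply: eq_bigr => u _; rewrite [in RHS]lin_opB_C.
Qed.

(** Bob's flag already follows the law of the game, whose weights are at most twice those of [beta].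
    This costs a factor 2 where Bob's move paid 1 / t2. *)
Lemma transC s : (1 - al) * (\sum_u PU u * \sum_f bal f *
   nrm (subv (opC (mulf (FC (~~ s)) (GC s)) (S1 \d u \d f \d s))
             (S1 \d u \d f \d (~~ s)))) <= 4 * (2 * dC) / t2.
Proof.
pose a1 u f := nrm (subv (opC (GC s) (S1 \d u \d f \d s)) (S1 \d u \d f beta)).
pose a0 u f := nrm (subv (opC (FC (~~ s)) (S1 \d u \d f beta)) (S1 \d u \d f \d (~~ s))).
have sum0 (a : U -> bool -> R) : (forall u f, 0 <= a u f) ->
    0 <= \sum_u PU u * \sum_f bal f * a u f.
  move=> a0'; apply: sumr_ge0 => u _; rewrite mulr_ge0 // sumr_ge0 // => f _.
  exact: mulr_ge0.
apply: le_trans (_ : (1 - al) * (2 * (\sum_u PU u * \sum_f bal f * a1 u f)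
    + 2 * (\sum_u PU u * \sum_f bal f * a0 u f)) <= _).
  apply: ler_wpM2l; first by rewrite subr_ge0 ltW.
  rewrite !mulr_sumr -big_split; apply: ler_sum => u _ /=.
  rewrite mulrCA [X in _ <= _ + X]mulrCA -mulrDr ler_wpM2l //.
  rewrite !mulr_sumr -big_split; apply: ler_sum => f _ /=.
  rewrite mulrCA [X in _ <= _ + X]mulrCA -mulrDr ler_wpM2l // opC_mulf.
  by apply: hybrid2; apply: nonexp_opC.
have balle f : bal f <= 2 * beta f by case: f => /=; move: at2 ta t1; lra.
have key (b : bool) (f : U -> bool -> R) : (forall u g, 0 <= f u g) ->
   beta b * (\sum_u PU u * \sum_g beta g * f u g) <= dC ->
   beta b * (\sum_u PU u * \sum_g bal g * f u g) <= 2 * dC.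
  move=> f0 h; apply: le_trans (_ : 2 * (beta b * (\sum_u PU u * \sum_g beta g * f u g)) <= _).
    rewrite mulrCA ler_wpM2l // mulr_sumr; apply: ler_sum => u _.
    rewrite mulrCA ler_wpM2l // mulr_sumr; apply: ler_sum => g _.
    by rewrite mulrA ler_wpM2r.
  by rewrite ler_pM2l.
apply: (pair_bound (s := s)) => //.
- by rewrite subr_ge0 ltW.
- by apply: sum0 => u f; apply: nrm_ge0.
- by apply: sum0 => u f; apply: nrm_ge0.
- apply: key; first by move=> u g; apply: nrm_ge0.
  have := pick s (fun b => nrm_ge0 _) hGC; apply: le_trans; rewrite ler_wpM2l //.
  rewrite /S1 lin_opC_U // le_eqVlt; apply/orP; left; apply/eqP.
  by apply: eq_bigr => u _; rewrite [in RHS]lin_opC_B.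
- apply: key; first by move=> u g; apply: nrm_ge0.
  have := pick (~~ s) (fun b => nrm_ge0 _) hFC; apply: le_trans; rewrite ler_wpM2l //.
  rewrite /S1 lin_opC_U // le_eqVlt; apply/orP; left; apply/eqP.
  by apply: eq_bigr => u _; rewrite [in RHS]lin_opC_B.
Qed.

End Transition.
Section Total.
Variables (FA GA : X -> KA' -> KA' -> C).
Variables (FU GU : U -> KE' * (KB' * KC') -> KE' * (KB' * KC') -> C).
Variables (FB GB : X -> bool -> KB' -> KB' -> C) (FC GC : X -> bool -> KC' -> KC' -> C).
Hypothesis cA : forall x, contr (FA x) /\ contr (GA x).
Hypothesis cU : forall x, contr (FU x) /\ contr (GU x).
Hypothesis cB : forall x f, contr (FB x f) /\ contr (GB x f).
Hypothesis cC : forall x f, contr (FC x f) /\ contr (GC x f).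
Variables (dA dU : R) (dB dC : X -> R).
Let v0 := S PX PU \d true \d true xb.
Let S1 := fun x mU mB mC => S \d x mU mB mC (upd xb i x).
Hypothesis hFA : \sum_x PX x * nrm (subv (op1 (FA x) v0) (S \d x PU \d true \d true xb)) <= dA.
Hypothesis hGA : \sum_x PX x * nrm (subv (op1 (GA x) (S \d x PU \d true \d true xb)) v0) <= dA.
Hypothesis hFU : \sum_u PU u * nrm (subv (op2 (FU u) v0) (S PX \d u \d true \d true xb)) <= dU.
Hypothesis hGU : \sum_u PU u * nrm (subv (op2 (GU u) (S PX \d u \d true \d true xb)) v0) <= dU.
Hypothesis hFB : forall x, \sum_f beta f * nrm (subv (opB (FB x f) (S1 x PU beta beta)) (S1 x PU \d f beta)) <= dB x.
Hypothesis hGB : forall x, \sum_f beta f * nrm (subv (opB (GB x f) (S1 x PU \d f beta)) (S1 x PU beta beta)) <= dB x.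
Hypothesis hFC : forall x, \sum_f beta f * nrm (subv (opC (FC x f) (S1 x PU beta beta)) (S1 x PU beta \d f)) <= dC x.
Hypothesis hGC : forall x, \sum_f beta f * nrm (subv (opC (GC x f) (S1 x PU beta \d f)) (S1 x PU beta beta)) <= dC x.

(** Bottom is the resting position and needs no move. For a genuine question, [s = true] leads from
    bottom to it and [s = false] leads back. *)
Definition turn (K : finType) (s : bool) (F G : bool -> K -> K -> C) (f : bool) :=
  if f then @idf R K else mulf (F (~~ s)) (G s).

Lemma contr_turn (K : finType) s (F G : bool -> K -> K -> C) f :
  (forall b, contr (F b) /\ contr (G b)) -> contr (turn s F G f).
Proof.
move=> c; case: f; first exact: contr_idf.
by apply: contr_mulf; [case: (c (~~ s)) | case: (c s)].
Qed.

Definition chain_cost : R := 4 * (dA + dU +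
  \sum_x PX x * (4 * (dB x / t2) / t2 + 4 * (2 * dC x) / t2)).

Lemma avgD (V : finType) (p : V -> R) a (f : V -> R) : isprob p ->
  \sum_w p w * (a + f w) = a + \sum_w p w * f w.
Proof.
move=> [_ p1]; under eq_bigr => w _ do rewrite mulrDr.
by rewrite big_split /= -mulr_suml p1 mul1r.
Qed.

(** The errors of Bob's and Charlie's moves vanish at bottom, so they enter with the weight 1 - al
    that [pair_bound] relies on. *)
Lemma avg4 (n1 : X -> R) (n2 : X -> U -> R) (n3 : X -> U -> bool -> R)
   (n4 : X -> U -> bool -> bool -> R) (W : X -> U -> bool -> bool -> R) :
  (forall x u f g, W x u f g <= 4 * (n1 x + n2 x u + n3 x u f + n4 x u f g)) ->
  \sum_x PX x * n1 x <= dA -> \sum_u PU u * \sum_x PX x * n2 x u <= dU ->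
  (forall x u, n3 x u true = 0) -> (forall x u f, n4 x u f true = 0) ->
  (forall x, (1 - al) * (\sum_u PU u * n3 x u false) <= 4 * (dB x / t2) / t2) ->
  (forall x, (1 - al) * (\sum_u PU u * \sum_f bal f * n4 x u f false)
      <= 4 * (2 * dC x) / t2) ->
  \sum_x PX x * \sum_u PU u * \sum_f bal f * \sum_g bal g * W x u f g <= chain_cost.
Proof.
move=> hW h1 h2 z3 z4 h3 h4.
have E (V : finType) (p : V -> R) (f : V -> R) : \sum_w p w * (4 * f w) = 4 * \sum_w p w * f w.
  by rewrite mulr_sumr; apply: eq_bigr => w _; rewrite mulrCA.
apply: le_trans (_ : \sum_x PX x * \sum_u PU u * \sum_f bal f * \sum_g bal g *
   (4 * (n1 x + n2 x u + n3 x u f + n4 x u f g)) <= _).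
  apply: ler_sum => x _; rewrite ler_wpM2l ?(proj1 hPX) //.
  apply: ler_sum => u _; rewrite ler_wpM2l ?(proj1 hPU) //.
  apply: ler_sum => f _; rewrite ler_wpM2l ?(proj1 hbal) //.
  by apply: ler_sum => g _; rewrite ler_wpM2l ?(proj1 hbal).
under eq_bigr => x _ do under eq_bigr => u _ do under eq_bigr => f _ do
  rewrite E avgD //.
under eq_bigr => x _ do under eq_bigr => u _ do
  (rewrite E; under eq_bigr => f _ do rewrite -addrA; rewrite avgD //).
under eq_bigr => x _ do
  (rewrite E; under eq_bigr => u _ do rewrite -addrA; rewrite avgD //).
rewrite E /chain_cost ler_pM2l //.
under eq_bigr => x _ do rewrite mulrDr.
rewrite big_split /= -addrA lerD //.
under eq_bigr => x _ do (under eq_bigr => u _ do rewrite mulrDr; rewrite big_split /= mulrDr).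
rewrite big_split /= lerD //.
  apply: le_trans h2; rewrite le_eqVlt; apply/orP; left; apply/eqP.
  under eq_bigr => x _ do rewrite mulr_sumr.
  rewrite exchange_big; apply: eq_bigr => u _ /=; rewrite mulr_sumr.
  by apply: eq_bigr => x _; rewrite mulrCA.
apply: ler_sum => x _; rewrite ler_wpM2l ?(proj1 hPX) //.
under eq_bigr => u _ do (under eq_bigr => f _ do rewrite mulrDr; rewrite big_split /= mulrDr).
rewrite big_split /= lerD //.
  apply: le_trans (h3 x); rewrite mulr_sumr; apply: ler_sum => u _.
  by rewrite big_bool /= z3 mulr0 add0r mulrCA.
apply: le_trans (h4 x); rewrite mulr_sumr; apply: ler_sum => u _.
rewrite mulrCA ler_wpM2l ?(proj1 hPU) // mulr_sumr; apply: ler_sum => f _.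
by rewrite big_bool /= z4 mulr0 add0r mulrCA.
Qed.

Lemma chain_fwd : \sum_x PX x * \sum_u PU u * \sum_f bal f * \sum_g bal g *
  nrm (subv (opC (turn true (FC x) (GC x) g) (opB (turn true (FB x) (GB x) f)
              (op2 (FU u) (op1 (FA x) v0)))) (S1 x \d u \d f \d g)) <= chain_cost.
Proof.
apply: (avg4
  (n1 := fun x => nrm (subv (op1 (FA x) v0) (S \d x PU \d true \d true xb)))
  (n2 := fun x u => nrm (subv (op2 (FU u) (S \d x PU \d true \d true xb))
                              (S \d x \d u \d true \d true xb)))
  (n3 := fun x u f => nrm (subv (opB (turn true (FB x) (GB x) f)
      (S1 x \d u \d true \d true)) (S1 x \d u \d f \d true)))
  (n4 := fun x u f g => nrm (subv (opC (turn true (FC x) (GC x) g)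
      (S1 x \d u \d f \d true)) (S1 x \d u \d f \d g)))) => //.
- move=> x u f g.
  have := @hybrid4 R _ (op1 (FA x)) (op2 (FU u)) (opB (turn true (FB x) (GB x) f))
    (opC (turn true (FC x) (GC x) g)) v0 (S \d x PU \d true \d true xb)
    (S \d x \d u \d true \d true xb) (S1 x \d u \d f \d true) (S1 x \d u \d f \d g).
  (* While both flags are at bottom, the public question at [i] is exchanged for the true question
     [x] at no cost. *)
  rewrite /S1 state_bot_irrel; apply.
  + by apply: nonexp_op2; case: (cU u).
  + by apply: nonexp_opB; apply: contr_turn.
  + by apply: nonexp_opC; apply: contr_turn.
- apply: le_trans hFU; apply: ler_sum => u _; rewrite ler_wpM2l ?(proj1 hPU) //.
  by rewrite /v0 lin_op2_A.
- by move=> x u; rewrite /turn opB_idf nrm_subvv.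
- by move=> x u f; rewrite /turn opC_idf nrm_subvv.
- by move=> x; apply: (transB _ (hFB x) (hGB x) true) => b; case: (cB x b).
- by move=> x; apply: (transC _ (hFC x) (hGC x) true) => b; case: (cC x b).
Qed.

Lemma chain_bwd : \sum_x PX x * \sum_u PU u * \sum_f bal f * \sum_g bal g *
  nrm (subv (op1 (GA x) (op2 (GU u) (opB (turn false (FB x) (GB x) f)
     (opC (turn false (FC x) (GC x) g) (S1 x \d u \d f \d g))))) v0) <= chain_cost.
Proof.
apply: (avg4
  (n1 := fun x => nrm (subv (op1 (GA x) (S \d x PU \d true \d true xb)) v0))
  (n2 := fun x u => nrm (subv (op2 (GU u) (S \d x \d u \d true \d true xb))
                              (S \d x PU \d true \d true xb)))
  (n3 := fun x u f => nrm (subv (opB (turn false (FB x) (GB x) f)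
      (S1 x \d u \d f \d true)) (S1 x \d u \d true \d true)))
  (n4 := fun x u f g => nrm (subv (opC (turn false (FC x) (GC x) g)
      (S1 x \d u \d f \d g)) (S1 x \d u \d f \d true)))) => //.
- move=> x u f g.
  have := @hybrid4_rev R _ (opC (turn false (FC x) (GC x) g)) (opB (turn false (FB x) (GB x) f))
    (op2 (GU u)) (op1 (GA x)) (S1 x \d u \d f \d g) (S1 x \d u \d f \d true)
    (S \d x \d u \d true \d true xb) (S \d x PU \d true \d true xb) v0.
  rewrite /S1 state_bot_irrel; apply.
  + by apply: nonexp_opB; apply: contr_turn.
  + by apply: nonexp_op2; case: (cU u).
  + by apply: nonexp_op1; case: (cA x).
- apply: le_trans hGU; apply: ler_sum => u _; rewrite ler_wpM2l ?(proj1 hPU) //.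
  by rewrite /v0 lin_op2_A.
- by move=> x u; rewrite /turn opB_idf nrm_subvv.
- by move=> x u f; rewrite /turn opC_idf nrm_subvv.
- by move=> x; apply: (transB _ (hFB x) (hGB x) false) => b; case: (cB x b).
- by move=> x; apply: (transC _ (hFC x) (hGC x) false) => b; case: (cC x b).
Qed.

End Total.
End Chain.

(** * Public data and the anchored game *)

Section GameDistribution.
Variable R : realType.
Variables (X U : finType) (PX : X -> R) (PU : U -> R) (al : R).
Hypothesis hPX : isprob PX.
Hypothesis hPU : isprob PU.
Hypothesis hal : 0 < al < 1.

Lemma galpha_sum x u (h : option X -> option X -> R) :
  \sum_y \sum_z Galpha_dist PX PU al x u y z * h y z
  = PX x * (PU u * \sum_f bern al f * \sum_g bern al g * h (bot_or f x) (bot_or g x)).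
Proof.
have sumo (F : option X -> R) : (forall x', x' != x -> F (Some x') = 0) ->
   \sum_y F y = F None + F (Some x).
  move=> F0; rewrite (bigD1 None) //= (bigD1 (Some x)) //= big1 ?addr0 //.
  by move=> [x'|] //= hx; apply: F0; apply: contraNneq hx => ->.
rewrite sumo; last first.
  move=> x' ne; apply: big1 => z _.
  by rewrite /Galpha_dist (negbTE ne) !(mul0r, mulr0).
have z0 y x' : x' != x -> Galpha_dist PX PU al x u y (Some x') * h y (Some x') = 0.
  by move=> ne; rewrite /Galpha_dist (negbTE ne) !(mul0r, mulr0).
rewrite !sumo; try by move=> x' ne; apply: z0.
rewrite /Galpha_dist !eqxx !big_bool /= /bot_or; ring.
Qed.

Lemma galpha_ge0 x u y z : 0 <= Galpha_dist PX PU al x u y z.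
Proof.
have [/ltW a0 /ltW a1] := andP hal.
have h (o : option X) : 0 <= (if o is Some y' then (y' == x)%:R * (1 - al) else al).
  by case: o => // y'; rewrite mulr_ge0 ?ler0n ?subr_ge0.
apply: mulr_ge0; apply: mulr_ge0.
- exact: (proj1 hPU).
- exact: (proj1 hPX).
- exact: (h y).
- exact: (h z).
Qed.

Lemma isprob_bal : isprob (bern al).
Proof. by apply: isprob_bern; case/andP: hal => /ltW -> /ltW ->. Qed.

Lemma exchange_avg (I J : finType) (f : I -> R) (g : J -> R) (h : I -> J -> R) :
  \sum_i f i * (\sum_j g j * h i j) = \sum_j g j * (\sum_i f i * h i j).
Proof.
under eq_bigr => i _ do rewrite mulr_sumr.
rewrite exchange_big; apply: eq_bigr => j _; rewrite mulr_sumr.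
by apply: eq_bigr => i _; rewrite mulrCA.
Qed.

Lemma avg_const (V : finType) (p : V -> R) r : isprob p -> \sum_w p w * r = r.
Proof. by case=> _ p1; rewrite -mulr_suml p1 mul1r. Qed.

Lemma galpha_sum1 : \sum_x \sum_u \sum_y \sum_z Galpha_dist PX PU al x u y z = 1.
Proof.
rewrite -[RHS](avg_const 1 hPX); apply: eq_bigr => x _.
rewrite -[in RHS](avg_const 1 hPU) mulr_sumr; apply: eq_bigr => u _.
have := galpha_sum x u (fun _ _ => 1).
under eq_bigr => y _ do under eq_bigr => z _ do rewrite mulr1.
move=> ->; congr (_ * (_ * _)).
under eq_bigr => f _ do rewrite (avg_const 1 isprob_bal).
exact: (avg_const 1 isprob_bal).
Qed.

End GameDistribution.

Section Environment.
Variable R : realType.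
Local Notation C := (complex R).
Local Notation "x %:C" := (real_complex R x).
Variables (X U A S B D : finType) (l : nat).
Variable W : X -> U -> option X -> option X -> A -> S -> B -> D -> bool.
Variables (KA KE KB KC IA IU IB IC : finType).
Variables (la : KA -> {ffun 'I_l -> A}) (le : KE -> {ffun 'I_l -> S}).
Variables (lb : KB -> {ffun 'I_l -> B}) (lc : KC -> {ffun 'I_l -> D}).
Variables (LA : {ffun 'I_l -> X} -> KA -> IA -> C).
Variables (LU : {ffun 'I_l -> U} -> KE * (IB * IC) -> IU -> C).
Variables (LB : {ffun 'I_l -> option X} -> KB -> IB -> C).
Variables (LC : {ffun 'I_l -> option X} -> KC -> IC -> C).
Variable v : IA * IU -> C.
Hypothesis cA : forall x, contr (LA x).
Hypothesis cU : forall x, contr (LU x).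
Hypothesis cB : forall x, contr (LB x).
Hypothesis cC : forall x, contr (LC x).
Hypothesis nv : nrm v <= 1.
Local Notation KA' := ({ffun 'I_l -> X} * KA)%type.
Local Notation KE' := ({ffun 'I_l -> U} * KE)%type.
Local Notation KB' := ({ffun 'I_l -> bool} * KB)%type.
Local Notation KC' := ({ffun 'I_l -> bool} * KC)%type.
Local Notation K4 := (KA' * (KE' * (KB' * KC')))%type.
Local Notation St := (State LA LU LB LC v).
Variables (PX : X -> R) (PU : U -> R) (al : R).
Hypothesis hPX : isprob PX.
Hypothesis hPU : isprob PU.
Hypothesis hal : 0 < al < 1.
Variable Ts : pred 'I_l.
Variables (ub : {ffun 'I_l -> U}) (fb gb : {ffun 'I_l -> bool}).
Implicit Types (dB dC : {ffun 'I_l -> bool}) (xb : {ffun 'I_l -> X}).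
Local Notation "\d z" := (dirac R z) (at level 8, z at level 8).

(* A question of Bob is bottom if one of two independent coins says so; the
   first coin, of bias t1, is public. Alice's question is public unless it is
   outside of Ts and both public coins replaced it by bottom. *)
Definition t1 : R := al / 2.
Definition t2 : R := al / (2 - al).

Definition pA dB dC xb : 'I_l -> X -> R := fun j =>
  if ~~ Ts j && (dB j && dC j) then PX else \d (xb j).
Definition pU : 'I_l -> U -> R := fun j => if Ts j then \d (ub j) else PU.
Definition pBC (fb dB : {ffun 'I_l -> bool}) : 'I_l -> bool -> R := fun j =>
  if Ts j then \d (fb j) else if dB j then \d true else bern t2.

Lemma t1_bounds : [/\ 0 < t1, t1 < 1 & 1 / 4 <= (1 - t1) ^+ 2].
Proof.
have [a0 a1] := andP hal; rewrite /t1; split; try lra.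
have h : 0 <= (1 - al) / 2 by rewrite divr_ge0 ?subr_ge0 // ltW.
have -> : (1 - al / 2) ^+ 2 = 1 / 4 + (1 - al) / 2 * (1 + (1 - al) / 2) by field.
by rewrite lerDl mulr_ge0 // addr_ge0.
Qed.

Lemma t2_bounds : [/\ 0 < t2, t2 < 1, t2 <= al & al <= 2 * t2].
Proof.
have [a0 a1] := andP hal; have d0 : 0 < 2 - al by lra.
split; first by rewrite divr_gt0.
- by rewrite ltr_pdivrMr // mul1r; lra.
- by rewrite ler_pdivrMr // ler_peMr; lra.
- by rewrite mulrA ler_pdivlMr // mulrC ler_pM2r //; lra.
Qed.

(** A question survives if neither coin hides it; given [t1], this identity determines [t2]. Halving
    al for the first coin keeps both biases of order al. *)
Lemma t12_mix : (1 - t1) * (1 - t2) = 1 - al.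
Proof.
have [a0 a1] := andP hal; rewrite /t1 /t2; field.
by rewrite subr_eq0 gt_eqF //; lra.
Qed.

Lemma prob_t1 : isprob (bern t1).
Proof. by apply: isprob_bern; case: t1_bounds => /ltW -> /ltW ->. Qed.
Lemma prob_t2 : isprob (bern t2).
Proof. by apply: isprob_bern; case: t2_bounds => /ltW -> /ltW ->. Qed.
Lemma prob_pA dB dC xb j : isprob (pA dB dC xb j).
Proof. by rewrite /pA; case: ifP => // _; apply: isprob_dirac. Qed.
Lemma prob_pU j : isprob (pU j).
Proof. by rewrite /pU; case: ifP => // _; apply: isprob_dirac. Qed.
Lemma prob_pBC f0 dB j : isprob (pBC f0 dB j).
Proof.
rewrite /pBC; case: ifP => _; first exact: isprob_dirac.
by case: ifP => _; [apply: isprob_dirac | apply: prob_t2].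
Qed.

Definition ES dB dC xb : K4 -> C := St (pA dB dC xb) pU (pBC fb dB) (pBC gb dC) xb.

Definition Eenv (F : {ffun 'I_l -> bool} -> {ffun 'I_l -> bool} -> {ffun 'I_l -> X} -> R) : R :=
  \sum_dB pm (fun=> bern t1) dB * \sum_dC pm (fun=> bern t1) dC *
    \sum_xb pm (fun=> PX) xb * F dB dC xb.

Lemma Eenv_le F G : (forall dB dC xb, F dB dC xb <= G dB dC xb) -> Eenv F <= Eenv G.
Proof.
move=> h; have p1 (d : {ffun 'I_l -> bool}) : 0 <= pm (fun=> bern t1) d.
  by apply: pm_ge0 => _; apply: prob_t1.
apply: ler_sum => dB _; apply: ler_wpM2l => //.
apply: ler_sum => dC _; apply: ler_wpM2l => //.
by apply: ler_sum => xb _; apply: ler_wpM2l => //; apply: pm_ge0.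
Qed.

Lemma EenvZ r F : Eenv (fun dB dC xb => r * F dB dC xb) = r * Eenv F.
Proof.
rewrite /Eenv mulr_sumr; apply: eq_bigr => dB _; rewrite mulrCA; congr (_ * _).
rewrite mulr_sumr; apply: eq_bigr => dC _; rewrite mulrCA; congr (_ * _).
by rewrite mulr_sumr; apply: eq_bigr => xb _; rewrite mulrCA.
Qed.

Lemma EenvD F G : Eenv (fun dB dC xb => F dB dC xb + G dB dC xb) = Eenv F + Eenv G.
Proof.
rewrite /Eenv -big_split; apply: eq_bigr => dB _ /=; rewrite -mulrDr; congr (_ * _).
rewrite -big_split; apply: eq_bigr => dC _ /=; rewrite -mulrDr; congr (_ * _).
by rewrite -big_split; apply: eq_bigr => xb _ /=; rewrite -mulrDr.
Qed.

Lemma Eenv_coins i F : Eenv F = Eenv (fun dB dC xb =>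
   \sum_b bern t1 b * \sum_c bern t1 c * F (upd dB i b) (upd dC i c) xb).
Proof.
have h1 (j : 'I_l) : isprob (bern t1) := prob_t1.
transitivity (\sum_dB pm (fun=> bern t1) dB * \sum_b bern t1 b *
   \sum_dC pm (fun=> bern t1) dC * \sum_c bern t1 c *
    \sum_xb pm (fun=> PX) xb * F (upd dB i b) (upd dC i c) xb).
  rewrite /Eenv (@sum_resample _ _ _ _ i) //; apply: eq_bigr => dB _; congr (_ * _).
  by apply: eq_bigr => b _; congr (_ * _); rewrite (@sum_resample _ _ _ _ i).
apply: eq_bigr => dB _; congr (_ * _).
under eq_bigr => b _ do rewrite mulr_sumr.
rewrite exchange_big; apply: eq_bigr => dC _ /=.
under eq_bigr => b _ do rewrite mulrCA.
rewrite -mulr_sumr; congr (_ * _).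
under [RHS]eq_bigr => xb _ do rewrite mulr_sumr.
rewrite [RHS]exchange_big; apply: eq_bigr => b _ /=.
under [RHS]eq_bigr => xb _ do rewrite mulrCA.
rewrite -[RHS]mulr_sumr; congr (_ * _).
under [RHS]eq_bigr => xb _ do rewrite mulr_sumr.
rewrite [RHS]exchange_big; apply: eq_bigr => c _ /=; rewrite mulr_sumr.
by apply: eq_bigr => xb _; rewrite mulrCA.
Qed.

Lemma Eenv_question i F : Eenv F = Eenv (fun dB dC xb =>
   \sum_y PX y * F dB dC (upd xb i y)).
Proof.
apply: eq_bigr => dB _; congr (_ * _); apply: eq_bigr => dC _; congr (_ * _).
exact: sum_resample.
Qed.

Lemma updp_updp (V : finType) (q : 'I_l -> V -> R) i m m' :
  updp (updp q i m) i m' = updp q i m'.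
Proof. by apply: funext => j; rewrite /updp; case: eqVneq. Qed.

Lemma pA_upd i b c dB dC xb y : ~~ Ts i ->
  pA (upd dB i b) (upd dC i c) (upd xb i y)
   = updp (pA dB dC xb) i (if b && c then PX else \d y).
Proof.
move=> Ti; apply: funext => j; rewrite /pA /updp !ffunE.
by have [->|//] := eqVneq j i; rewrite Ti.
Qed.

Lemma pA_upd1 i dB dC xb : ~~ Ts i ->
  pA (upd dB i true) (upd dC i true) xb = updp (pA dB dC xb) i PX.
Proof.
move=> Ti; apply: funext => j; rewrite /pA /updp !ffunE.
by have [->|//] := eqVneq j i; rewrite Ti.
Qed.

Lemma pU_upd i : ~~ Ts i -> pU = updp pU i PU.
Proof.
move=> Ti; apply: funext => j; rewrite /pU /updp.
by have [->|//] := eqVneq j i; rewrite (negbTE Ti).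
Qed.

Lemma pBC_upd i f0 b dB : ~~ Ts i ->
  pBC f0 (upd dB i b) = updp (pBC f0 dB) i (if b then \d true else bern t2).
Proof.
move=> Ti; apply: funext => j; rewrite /pBC /updp !ffunE.
by have [->|//] := eqVneq j i; rewrite (negbTE Ti).
Qed.

Definition Sat i dB dC xb mA mU mB mC y : K4 -> C :=
  St (updp (pA dB dC xb) i mA) (updp pU i mU) (updp (pBC fb dB) i mB)
     (updp (pBC gb dC) i mC) y.

Definition game_avg (F : X -> U -> bool -> bool -> R) : R :=
  \sum_x PX x * \sum_u PU u * \sum_f bern al f * \sum_g bern al g * F x u f g.

Lemma coin_mix (F : bool -> R) :
  \sum_b bern t1 b * \sum_f (if b then \d true else bern t2) f * F f
   = \sum_f bern al f * F f.
Proof.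
rewrite !big_bool /= /dirac !eqxx /=.
have : al = 1 - (1 - t1) * (1 - t2) by rewrite t12_mix; ring.
by move: t1 t2 => a b ->; ring.
Qed.

(* The coins, the public question and the superposed inputs at coordinate i
   together reproduce the distribution of the anchored game. *)
Lemma mixture_at i (wt : {ffun 'I_l -> X} -> R) (G : K4 -> R) : ~~ Ts i ->
  (forall xb y, wt (upd xb i y) = wt xb) ->
  Eenv (fun dB dC xb => wt xb * \sum_k G k * sqn (ES dB dC xb k))
  = Eenv (fun dB dC xb => wt xb * game_avg (fun x u f g =>
      \sum_k G k * sqn (Sat i dB dC xb \d x \d u \d f \d g (upd xb i x) k))).
Proof.
move=> Ti hwt; rewrite (Eenv_coins i) (Eenv_question i).
congr Eenv; apply: funext => dB; apply: funext => dC; apply: funext => xb.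
pose H y x u f g := \sum_k G k * sqn (Sat i dB dC xb \d x \d u \d f \d g (upd xb i y) k).
have [lA lU lB lC] := lin_pay LA LU LB LC v i G.
have hU := prob_pU; have hA := prob_pA dB dC xb.
have hB := prob_pBC fb dB; have hC := prob_pBC gb dC.
have pd (V : finType) (w : V) := isprob_dirac R w.
have E y b c : \sum_k G k * sqn (ES (upd dB i b) (upd dC i c) (upd xb i y) k)
  = \sum_x (if b && c then PX else \d y) x * \sum_u PU u *
     \sum_f (if b then \d true else bern t2) f *
     \sum_g (if c then \d true else bern t2) g * H y x u f g.
  rewrite /ES pA_upd // {1}(pU_upd Ti) !pBC_upd //.
  rewrite lA //; last by case: ifP.
  apply: eq_bigr => x _; congr (_ * _); rewrite lU //; apply: eq_bigr => u _.
  congr (_ * _); rewrite lB //; last by case: ifP => // _; apply: prob_t2.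
  apply: eq_bigr => f _; congr (_ * _); rewrite lC //.
  by case: ifP => // _; apply: prob_t2.
(* If both coins hide the question, Alice's question is superposed and the public one is independent
   of it. Bob and Charlie see bottom, so the public question may be taken equal to hers. *)
have bot y x u : H y x u true true = H x x u true true.
  by apply: eq_bigr => k _; congr (_ * sqn _); rewrite /Sat !state_bot_irrel.
have E2 b c : \sum_y PX y * \sum_k G k * sqn (ES (upd dB i b) (upd dC i c) (upd xb i y) k)
  = \sum_y PX y * \sum_u PU u * \sum_f (if b then \d true else bern t2) f *
     \sum_g (if c then \d true else bern t2) g * H y y u f g.
  under eq_bigr => y _ do rewrite E.
  have [/andP[-> ->]|nbc] := boolP (b && c); last first.
    by apply: eq_bigr => y _; rewrite sum_dirac.
  under eq_bigr => y _ do under eq_bigr => x _ do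
    (under eq_bigr => u _ do rewrite !sum_dirac bot;
     under [X in _ * X]eq_bigr => u _ do idtac).
  rewrite avg_const //; apply: eq_bigr => x _; congr (_ * _).
  by apply: eq_bigr => u _; rewrite !sum_dirac.
transitivity (wt xb * \sum_b bern t1 b * \sum_c bern t1 c *
   \sum_y PX y * \sum_k G k * sqn (ES (upd dB i b) (upd dC i c) (upd xb i y) k)).
  rewrite mulr_sumr; under eq_bigr => y _ do rewrite mulr_sumr.
  rewrite exchange_big; apply: eq_bigr => b _ /=.
  rewrite !mulr_sumr; under eq_bigr => y _ do rewrite !mulr_sumr.
  rewrite exchange_big; apply: eq_bigr => c _ /=.
  rewrite !mulr_sumr; apply: eq_bigr => y _; rewrite hwt; ring.
congr (_ * _); under eq_bigr => b _ do under eq_bigr => c _ do rewrite E2.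
rewrite /game_avg.
transitivity (\sum_y PX y * \sum_u PU u * \sum_b bern t1 b *
  \sum_f (if b then \d true else bern t2) f * \sum_c bern t1 c *
     \sum_g (if c then \d true else bern t2) g * H y y u f g); last first.
  apply: eq_bigr => x _; congr (_ * _); apply: eq_bigr => u _; congr (_ * _).
  rewrite coin_mix; apply: eq_bigr => f _; congr (_ * _).
  by rewrite coin_mix.
under [LHS]eq_bigr => b _ do rewrite exchange_avg.
rewrite [LHS]exchange_avg; apply: eq_bigr => y _; congr (_ * _).
under [LHS]eq_bigr => b _ do rewrite exchange_avg.
rewrite [LHS]exchange_avg; apply: eq_bigr => u _; congr (_ * _).
by apply: eq_bigr => b _; congr (_ * _); rewrite [LHS]exchange_avg.
Qed.

Lemma game_avg_le F G : (forall x u f g, F x u f g <= G x u f g) ->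
  game_avg F <= game_avg G.
Proof.
have hb := isprob_bal hal.
move=> h; apply: ler_sum => x _; rewrite ler_wpM2l ?(proj1 hPX) //.
apply: ler_sum => u _; rewrite ler_wpM2l ?(proj1 hPU) //.
apply: ler_sum => f _; rewrite ler_wpM2l ?(proj1 hb) //.
by apply: ler_sum => g _; rewrite ler_wpM2l ?(proj1 hb).
Qed.

Lemma game_avgD F G : game_avg (fun x u f g => F x u f g + G x u f g)
  = game_avg F + game_avg G.
Proof.
rewrite /game_avg -big_split; apply: eq_bigr => x _ /=; rewrite -mulrDr; congr (_ * _).
rewrite -big_split; apply: eq_bigr => u _ /=; rewrite -mulrDr; congr (_ * _).
rewrite -big_split; apply: eq_bigr => f _ /=; rewrite -mulrDr; congr (_ * _).
by rewrite -big_split; apply: eq_bigr => g _ /=; rewrite -mulrDr.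
Qed.

Lemma game_avgZ r F : game_avg (fun x u f g => r * F x u f g) = r * game_avg F.
Proof.
rewrite /game_avg mulr_sumr; apply: eq_bigr => x _; rewrite mulrCA; congr (_ * _).
rewrite mulr_sumr; apply: eq_bigr => u _; rewrite mulrCA; congr (_ * _).
rewrite mulr_sumr; apply: eq_bigr => f _; rewrite mulrCA; congr (_ * _).
by rewrite mulr_sumr; apply: eq_bigr => g _; rewrite mulrCA.
Qed.

Lemma game_avg_const r : game_avg (fun _ _ _ _ => r) = r.
Proof.
have hb := isprob_bal hal; rewrite /game_avg.
under eq_bigr => x _ do under eq_bigr => u _ do under eq_bigr => f _ do
  rewrite (avg_const r hb).
under eq_bigr => x _ do under eq_bigr => u _ do rewrite (avg_const r hb).
under eq_bigr => x _ do rewrite (avg_const r hPU).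
exact: avg_const.
Qed.

Definition won_at i (x : X) (u : U) (f g : bool) (k : K4) : bool :=
  W x u (bot_or f x) (bot_or g x) (la k.1.2 i) (le k.2.1.2 i) (lb k.2.2.1.2 i)
    (lc k.2.2.2.2 i).

(* Unlike the indicator of winning, this payoff is bounded away from 0, which
   keeps the moments at least 2^-n times the probability to be estimated. *)
Definition pay_at i x u f g (k : K4) : R := (1 + (won_at i x u f g k)%:R) / 2.

Definition pay i (k : K4) : R :=
  pay_at i (k.1.1 i) (k.2.1.1 i) (k.2.2.1.1 i) (k.2.2.2.1 i) k.

Lemma pay_at_bounds i x u f g k : 0 <= pay_at i x u f g k <= 1.
Proof. by rewrite /pay_at; case: (won_at _ _ _ _ _ _) => /=; apply/andP; split; lra. Qed.

Lemma pay_Sat i dB dC xb x u f g y :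
  \sum_k pay i k * sqn (Sat i dB dC xb \d x \d u \d f \d g y k)
  = \sum_k pay_at i x u f g k * sqn (Sat i dB dC xb \d x \d u \d f \d g y k).
Proof.
apply: eq_bigr => k _; set s := Sat _ _ _ _ _ _ _ _ _ _.
have [->|nz] := eqVneq s 0; first by rewrite sqn0 !mulr0.
have supp (V : finType) (q : 'I_l -> V -> R) (w : V) key z :
   s = (Num.sqrt (pm (updp q i \d w) key))%:C * z -> key i = w.
  move=> e; apply: (@pm_updp_supp R l V q i w key); apply: contraNneq nz => h.
  by rewrite e h sqrtr0 mul0r.
rewrite /pay (supp _ _ _ _ _ (StAE _ _ _ _ _ _ _ _ _ _ _)).
rewrite (supp _ _ _ _ _ (StUE _ _ _ _ _ _ _ _ _ _ _)).
rewrite (supp _ _ _ _ _ (StBE _ _ _ _ _ _ _ _ _ _ _)).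
by rewrite (supp _ _ _ _ _ (StCE _ _ _ _ _ _ _ _ _ _ _)).
Qed.

Variable om : R.
Hypothesis om01 : 0 <= om <= 1.
Hypothesis om_ge : qvalue (Galpha_dist PX PU al) W <= om.

(** Here [a] is the average norm of the states with fixed inputs, [n] the norm of the common
    starting state, [s] the payoff and [c] the transport error. The bound on [n] comes from the
    backward chain, the one on [s] from the forward chain. *)
Lemma combine_bounds (th q a c s n : R) : 0 < th -> th <= 1 -> 0 <= q -> q <= 1 ->
  0 <= a -> 0 <= c ->
  n <= (1 + th) * a + (1 + th^-1) * c ->
  s <= (1 + th) * (q * n) + (1 + th^-1) * c ->
  s <= (q + 3 * th) * a + 6 / th * c.
Proof.
move=> h0 h1 q0 q1 a0 c0 hn hs; apply: le_trans hs _.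
set t := th^-1; have t1' : 1 <= t by rewrite /t invf_ge1.
have tt : th * t = 1 by rewrite mulfV // gt_eqF.
apply: le_trans (_ : (1 + th) * (q * ((1 + th) * a + (1 + t) * c)) + (1 + t) * c <= _).
  by rewrite lerD2r ler_wpM2l ?addr_ge0 ?(ltW h0) // ler_wpM2l.
have -> : (1 + th) * (q * ((1 + th) * a + (1 + t) * c)) + (1 + t) * c
   = q * a + (q * (2 * th + th * th)) * a + ((1 + th) * q * (1 + t) + (1 + t)) * c by ring.
have -> : (q + 3 * th) * a + 6 / th * c = q * a + 3 * th * a + (6 * t) * c.
  by rewrite /t; ring.
have e1 : q * (2 * th + th * th) <= 3 * th.
  have -> : 3 * th = 1 * (2 * th + th * 1) by ring.
  apply: ler_pM => //; first by rewrite addr_ge0 ?mulr_ge0 // ltW.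
  by rewrite lerD2l ler_pM2l.
have e2 : (1 + th) * q * (1 + t) + (1 + t) <= 6 * t.
  have f1 : (1 + th) * q <= 2 * 1 by apply: ler_pM => //; lra.
  have f2 : (1 + th) * q * (1 + t) <= 2 * 1 * (2 * t).
    apply: ler_pM => //; try lra.
    by rewrite mulr_ge0 //; lra.
  by lra.
by rewrite !lerD // ler_wpM2r.
Qed.

Section OneEnv.
Variables (i : 'I_l) (dB dC : {ffun 'I_l -> bool}) (xb : {ffun 'I_l -> X}).
Hypothesis Ti : ~~ Ts i.
Variables (FA GA : X -> KA' -> KA' -> C).
Variables (FU GU : U -> KE' * (KB' * KC') -> KE' * (KB' * KC') -> C).
Variables (FB GB : X -> bool -> KB' -> KB' -> C) (FC GC : X -> bool -> KC' -> KC' -> C).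
Hypothesis hcA : forall x, contr (FA x) /\ contr (GA x).
Hypothesis hcU : forall x, contr (FU x) /\ contr (GU x).
Hypothesis hcB : forall x f, contr (FB x f) /\ contr (GB x f).
Hypothesis hcC : forall x f, contr (FC x f) /\ contr (GC x f).
Variables cost : R.
Let v0 := Sat i dB dC xb PX PU \d true \d true xb.
Let H := fun x u f g => Sat i dB dC xb \d x \d u \d f \d g (upd xb i x).
Hypothesis fwd : game_avg (fun x u f g =>
  nrm (subv (opC (turn true (FC x) (GC x) g) (opB (turn true (FB x) (GB x) f)
              (op2 (FU u) (op1 (FA x) v0)))) (H x u f g))) <= cost.
Hypothesis bwd : game_avg (fun x u f g =>
  nrm (subv (op1 (GA x) (op2 (GU u) (opB (turn false (FB x) (GB x) f)
     (opC (turn false (FC x) (GC x) g) (H x u f g))))) v0)) <= cost.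

(** From the starting state, the forward chain is a strategy for one copy, which wins with weight at
    most [om] times the norm; averaging with the constant 1 gives (1 + om) / 2. The backward chain
    then replaces the norm of the starting state by the average norm of the states [H]. *)
Lemma one_env th : 0 < th -> th <= 1 ->
  game_avg (fun x u f g => \sum_k pay i k * sqn (H x u f g k))
  <= ((1 + om) / 2 + 3 * th) * game_avg (fun x u f g => nrm (H x u f g))
      + 6 / th * cost.
Proof.
move=> h0 h1; have [o0 o1] := andP om01.
have hb := isprob_bal hal.
pose O x u f g w := opC (turn true (FC x) (GC x) g) (opB (turn true (FB x) (GB x) f)
              (op2 (FU u) (op1 (FA x) w))).
pose O' x u f g w := op1 (GA x) (op2 (GU u) (opB (turn false (FB x) (GB x) f)
     (opC (turn false (FC x) (GC x) g) w))).
have nO x u f g w : nrm (O x u f g w) <= nrm w.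
  apply: le_trans (opC_nrm _ (contr_turn _ _ (hcC x))) _.
  apply: le_trans (opB_nrm _ (contr_turn _ _ (hcB x))) _.
  apply: le_trans (op2_nrm _ (proj1 (hcU u))) _.
  exact: op1_nrm (proj1 (hcA x)).
have nO' x u f g w : nrm (O' x u f g w) <= nrm w.
  apply: le_trans (op1_nrm _ (proj2 (hcA x))) _.
  apply: le_trans (op2_nrm _ (proj2 (hcU u))) _.
  apply: le_trans (opB_nrm _ (contr_turn _ _ (hcB x))) _.
  exact: opC_nrm (contr_turn _ _ (hcC x)).
have ga0 F : (forall x u f g, 0 <= F x u f g) -> 0 <= game_avg F.
  by move=> F0; rewrite -(game_avg_const 0); apply: game_avg_le.
apply: (combine_bounds (n := nrm v0)) => //.
- by apply: divr_ge0 => //; apply: addr_ge0.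
- by rewrite ler_pdivrMr // mul1r; move: o1; lra.
- by apply: ga0 => x u f g; apply: nrm_ge0.
- by apply: le_trans fwd; apply: ga0 => x u f g; apply: nrm_ge0.
- rewrite -[leLHS]game_avg_const.
  apply: le_trans (_ : game_avg (fun x u f g => (1 + th) * nrm (H x u f g)
    + (1 + th^-1) * nrm (subv (O' x u f g (H x u f g)) v0)) <= _).
    apply: game_avg_le => x u f g; set w := O' x u f g _.
    have := nrmD_le w (fun k => - subv w v0 k) h0; rewrite nrmN.
    have -> : nrm (fun k => w k + - subv w v0 k) = nrm v0.
      by apply: eq_bigr => k _; congr sqn; rewrite /subv opprB addrC subrK.
    move=> /le_trans; apply; rewrite lerD2r; apply: ler_wpM2l; last exact: nO'.
    by rewrite addr_ge0 // ltW.
  rewrite game_avgD !game_avgZ lerD2l; apply: ler_wpM2l; last exact: bwd.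
  by rewrite addr_ge0 // invr_ge0 ltW.
apply: le_trans (_ : game_avg (fun x u f g =>
  (1 + th) * (\sum_k pay_at i x u f g k * sqn (O x u f g v0 k))
    + (1 + th^-1) * nrm (subv (O x u f g v0) (H x u f g))) <= _).
  apply: game_avg_le => x u f g; rewrite /H pay_Sat -/(H x u f g) !mulr_sumr -big_split.
  apply: ler_sum => k _ /=; set w := O x u f g v0.
  have [p0 p1] := andP (pay_at_bounds i x u f g k).
  have := sqnD_le (w k) (- subv w (H x u f g) k) h0; rewrite sqnN.
  have -> : w k + - subv w (H x u f g) k = H x u f g k.
    by rewrite /subv opprB addrC subrK.
  move=> h; apply: le_trans (ler_wpM2l p0 h) _.
  rewrite mulrDr mulrCA lerD2l mulrCA ler_wpM2l //.
    by rewrite addr_ge0 // invr_ge0 ltW.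
  by rewrite ler_piMl ?sqn_ge0.
rewrite game_avgD !game_avgZ; apply: lerD; last first.
  apply: ler_wpM2l; last exact: fwd.
  by rewrite addr_ge0 // invr_ge0 ltW.
apply: ler_wpM2l; first by rewrite addr_ge0 // ltW.
have E x u f g : \sum_k pay_at i x u f g k * sqn (O x u f g v0 k)
  = 1 / 2 * nrm (O x u f g v0) + 1 / 2 * (\sum_k (won_at i x u f g k)%:R * sqn (O x u f g v0 k)).
  rewrite /nrm !mulr_sumr -big_split; apply: eq_bigr => k _ /=.
  by rewrite /pay_at; field.
have -> : game_avg (fun x u f g => \sum_k pay_at i x u f g k * sqn (O x u f g v0 k))
  = 1 / 2 * game_avg (fun x u f g => nrm (O x u f g v0))
    + 1 / 2 * game_avg (fun x u f g => \sum_k (won_at i x u f g k)%:R * sqn (O x u f g v0 k)).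
  rewrite -(game_avgZ (1 / 2) (fun x u f g => nrm (O x u f g v0))).
  rewrite -(game_avgZ (1 / 2) (fun x u f g =>
    \sum_k (won_at i x u f g k)%:R * sqn (O x u f g v0 k))) -game_avgD.
  congr game_avg; apply: funext => x; apply: funext => u; apply: funext => f.
  by apply: funext => g; rewrite E.
have -> : (1 + om) / 2 * nrm v0 = 1 / 2 * nrm v0 + 1 / 2 * (om * nrm v0) by field.
have half0 : 0 <= 1 / 2 :> R by rewrite divr_ge0.
apply: lerD; apply: ler_wpM2l => //.
  by rewrite -[leRHS]game_avg_const; apply: game_avg_le => x u f g; apply: nO.
apply: le_trans (_ : qvalue (Galpha_dist PX PU al) W * nrm v0 <= _); last first.
  by rewrite ler_wpM2r ?nrm_ge0.
(* A question other than bottom reveals [x], on which the operations of Bob and Charlie depend; at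
   bottom they do nothing. The chain is therefore a legitimate strategy. *)
pose VB (y : option X) := if y is Some x then turn true (FB x) (GB x) false else @idf R _.
pose VC (y : option X) := if y is Some x then turn true (FC x) (GC x) false else @idf R _.
have := @simulation R X U _ _ A S B D (Galpha_dist PX PU al) W KA' KE' KB' KC'
  (fun k => la k.2 i) (fun k => le k.2 i) (fun k => lb k.2 i) (fun k => lc k.2 i)
  FA FU VB VC v0 (galpha_ge0 hPX hPU hal) (galpha_sum1 hPX hPU hal).
have hB y : contr (VB y) by case: y => [x|]; [apply: contr_turn | apply: contr_idf].
have hC y : contr (VC y) by case: y => [x|]; [apply: contr_turn | apply: contr_idf].
move=> /(_ (fun x => proj1 (hcA x)) (fun u => proj1 (hcU u)) hB hC).
apply: le_trans; rewrite le_eqVlt; apply/orP; left; apply/eqP.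
rewrite /fwin /game_avg; apply: eq_bigr => x _; rewrite mulr_sumr.
apply: eq_bigr => u _; rewrite galpha_sum; congr (_ * (_ * _)).
apply: eq_bigr => f _; congr (_ * _); apply: eq_bigr => g _; congr (_ * _).
by apply: eq_bigr => k _; congr (_ * sqn _); rewrite /O; case: f; case: g.
Qed.

End OneEnv.

(** Both coins at [i] show [b] with probability the square of [bern t1 b]. Distances measured in
    environments with prescribed coins are charged to the average environment in this way. *)
Lemma coins_ge i b F : (forall dB dC xb, 0 <= F dB dC xb) ->
  bern t1 b ^+ 2 * Eenv (fun dB dC xb => F (upd dB i b) (upd dC i b) xb) <= Eenv F.
Proof.
move=> F0; rewrite (Eenv_coins i F) -EenvZ; apply: Eenv_le => dB dC xb.
have b0 c : 0 <= bern t1 c := proj1 prob_t1 c.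
rewrite (bigD1 b) //= ler_wpDr ?sumr_ge0 //.
  by move=> c _; rewrite mulr_ge0 // sumr_ge0 // => e _; rewrite mulr_ge0.
rewrite expr2 -mulrA ler_wpM2l // (bigD1 b) //= lerDl sumr_ge0 // => c _.
by rewrite mulr_ge0.
Qed.

(** From t1^2 = al^2 / 4, (1 - t1)^2 >= 1 / 4 and al / t2 <= 2: after multiplication by al^2 the
    four terms receive the factors 16, 16, 256 and 256. *)
Lemma env_cost_bound (EA EU EB ED EA1 EU1 EB0 ED0 : R) :
  0 <= EA -> 0 <= EU -> 0 <= EB -> 0 <= ED ->
  t1 ^+ 2 * EA1 <= EA -> t1 ^+ 2 * EU1 <= EU ->
  (1 - t1) ^+ 2 * EB0 <= EB -> (1 - t1) ^+ 2 * ED0 <= ED ->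
  0 <= EB0 -> 0 <= ED0 ->
  4 * (EA1 + EU1 + (4 / t2 / t2 * EB0 + 8 / t2 * ED0))
    <= 256 / al ^+ 2 * (EA + EU + EB + ED).
Proof.
move=> a0 u0 b0 d0 hA hU hB hD b00 d00.
have [p0 p1 p4] := t1_bounds; have [q0 q1 qa aq] := t2_bounds.
have [al0 al1] := andP hal.
have al2 : 0 < al ^+ 2 by rewrite exprn_gt0.
have hA1 : al ^+ 2 * EA1 <= 4 * EA.
  by move: hA; rewrite /t1 exprMn exprVn; lra.
have hU1 : al ^+ 2 * EU1 <= 4 * EU.
  by move: hU; rewrite /t1 exprMn exprVn; lra.
have q4 (E E0 : R) : 0 <= E0 -> (1 - t1) ^+ 2 * E0 <= E -> E0 <= 4 * E.
  move=> e0 h; have : 1 / 4 * E0 <= (1 - t1) ^+ 2 * E0 by rewrite ler_wpM2r.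
  by move: h; lra.
have hB1 := q4 _ _ b00 hB; have hD1 := q4 _ _ d00 hD.
have r1 : al / t2 <= 2 by rewrite ler_pdivrMr.
have r0 : 0 <= al / t2 by rewrite divr_ge0 // ltW.
rewrite -(ler_pM2l al2).
have -> : al ^+ 2 * (256 / al ^+ 2 * (EA + EU + EB + ED)) = 256 * (EA + EU + EB + ED).
  by field; rewrite gt_eqF.
have -> : al ^+ 2 * (4 * (EA1 + EU1 + (4 / t2 / t2 * EB0 + 8 / t2 * ED0)))
   = 4 * (al ^+ 2 * EA1) + 4 * (al ^+ 2 * EU1) + 16 * ((al / t2) * (al / t2) * EB0)
     + 32 * ((al * (al / t2)) * ED0) by field; rewrite gt_eqF.
have e1 : al / t2 * (al / t2) * EB0 <= 2 * 2 * (4 * EB).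
  by apply: ler_pM => //; [rewrite mulr_ge0 | apply: ler_pM].
have e2 : al * (al / t2) * ED0 <= 1 * 2 * (4 * ED).
  apply: ler_pM => //; first by rewrite mulr_ge0 // ltW.
  by apply: ler_pM => //; exact: ltW.
by move: hA1 hU1 e1 e2 a0 u0 b0 d0; lra.
Qed.

Lemma claim_at (V K' T : finType) p op Sf d F G i q m :
  @party_claim R l V K' p T op Sf d F G -> p = updp q i m ->
  (\sum_w m w * nrm (subv (op (F i w) (Sf (updp q i m))) (Sf (updp q i \d w))) <= d i) /\
  (\sum_w m w * nrm (subv (op (G i w) (Sf (updp q i \d w))) (Sf (updp q i m))) <= d i).
Proof.
move=> [_ _ h3 h4 _] e; have h w : updp p i \d w = updp q i \d w by rewrite e updp_updp.
have pm : p i = m by rewrite e /updp eqxx.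
split; [have := h3 i | have := h4 i]; rewrite pm -e; apply: le_trans;
  by apply: ler_sum => w _; rewrite h.
Qed.

(* Dst dB dC xb i is the information that the four parties' registers carry
   about coordinate i, given the public data. *)
Lemma env_step : exists Dst : {ffun 'I_l -> bool} -> {ffun 'I_l -> bool} ->
    {ffun 'I_l -> X} -> 'I_l -> R,
  [/\ forall dB dC xb i, 0 <= Dst dB dC xb i,
      forall dB dC xb, \sum_i Dst dB dC xb i
        <= 4 * - (nrm (ES dB dC xb) * ln (nrm (ES dB dC xb))) &
      forall i (wt : {ffun 'I_l -> X} -> R) th, ~~ Ts i ->
        (forall xb, 0 <= wt xb) -> (forall xb y, wt (upd xb i y) = wt xb) ->
        0 < th -> th <= 1 ->
        Eenv (fun dB dC xb => wt xb * \sum_k pay i k * sqn (ES dB dC xb k))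
        <= ((1 + om) / 2 + 3 * th) * Eenv (fun dB dC xb => wt xb * nrm (ES dB dC xb))
          + 6 / th * (256 / al ^+ 2 * Eenv (fun dB dC xb => wt xb * Dst dB dC xb i))].
Proof.
pose T := ({ffun 'I_l -> bool} * {ffun 'I_l -> bool} * {ffun 'I_l -> X})%type.
pose qs (e : T) := (pA e.1.1 e.1.2 e.2, pBC fb e.1.1, pBC gb e.1.2).
have hqA (e : T) j : isprob ((qs e).1.1 j) := prob_pA _ _ _ j.
have hqB (e : T) j : isprob ((qs e).1.2 j) := prob_pBC _ _ j.
have hqC (e : T) j : isprob ((qs e).2 j) := prob_pBC _ _ j.
have exA (e : T) : exists t : ('I_l -> R) * (('I_l -> X -> KA' -> KA' -> C)
    * ('I_l -> X -> KA' -> KA' -> C)),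
  party_claim (qs e).1.1 (@op1 R KA' KA' _)
    (fun q => St q pU (qs e).1.2 (qs e).2 e.2) t.1 t.2.1 t.2.2.
  have [d [F [G h]]] := step_A cA cU cB cC nv e.2 (hqA e) prob_pU (hqB e) (hqC e).
  by exists (d, (F, G)).
have exU (e : T) : exists t : ('I_l -> R) *
    (('I_l -> U -> KE' * (KB' * KC') -> KE' * (KB' * KC') -> C)
    * ('I_l -> U -> KE' * (KB' * KC') -> KE' * (KB' * KC') -> C)),
  party_claim pU (@op2 R (KE' * (KB' * KC'))%type _ KA')
    (fun q => St (qs e).1.1 q (qs e).1.2 (qs e).2 e.2) t.1 t.2.1 t.2.2.
  have [d [F [G h]]] := step_U cA cU cB cC nv e.2 (hqA e) prob_pU (hqB e) (hqC e).
  by exists (d, (F, G)).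
have exB (e : T) : exists t : ('I_l -> R) * (('I_l -> bool -> KB' -> KB' -> C)
    * ('I_l -> bool -> KB' -> KB' -> C)),
  party_claim (qs e).1.2 (@opB R KA' KE' KB' KB' _)
    (fun q => St (qs e).1.1 pU q (qs e).2 e.2) t.1 t.2.1 t.2.2.
  have [d [F [G h]]] := step_B cA cU cB cC nv e.2 (hqA e) prob_pU (hqB e) (hqC e).
  by exists (d, (F, G)).
have exC (e : T) : exists t : ('I_l -> R) * (('I_l -> bool -> KC' -> KC' -> C)
    * ('I_l -> bool -> KC' -> KC' -> C)),
  party_claim (qs e).2 (@opC R KA' KE' KC' KC' _)
    (fun q => St (qs e).1.1 pU (qs e).1.2 q e.2) t.1 t.2.1 t.2.2.
  have [d [F [G h]]] := step_C cA cU cB cC nv e.2 (hqA e) prob_pU (hqB e) (hqC e).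
  by exists (d, (F, G)).
have [tA hA] := choice exA; have [tU hU] := choice exU.
have [tB hB] := choice exB; have [tC hC] := choice exC.
have dA0 e i : 0 <= (tA e).1 i by case: (hA e) => _ /(_ i).
have dU0 e i : 0 <= (tU e).1 i by case: (hU e) => _ /(_ i).
have dB0 e i : 0 <= (tB e).1 i by case: (hB e) => _ /(_ i).
have dC0 e i : 0 <= (tC e).1 i by case: (hC e) => _ /(_ i).
exists (fun dB dC xb i => (tA (dB, dC, xb)).1 i + (tU (dB, dC, xb)).1 i
  + (tB (dB, dC, xb)).1 i + (tC (dB, dC, xb)).1 i); split.
- by move=> dB dC xb i; rewrite !addr_ge0.
- move=> dB dC xb; rewrite !big_split /=.
  have [_ _ _ _ sA] := hA (dB, dC, xb); have [_ _ _ _ sU] := hU (dB, dC, xb).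
  have [_ _ _ _ sB] := hB (dB, dC, xb); have [_ _ _ _ sC] := hC (dB, dC, xb).
  by move: (lerD (lerD (lerD sA sU) sB) sC); rewrite /ES /= => /le_trans; apply; lra.
move=> i wt th Ti wt0 hwt th0 th1; have [q0 q1 qa aq] := t2_bounds.
have [_ al1] := andP hal.
(* Alice and Barlie are moved where both coins hide the question: hers is then superposed and Bob
   and Charlie see bottom. Bob and Charlie are moved where neither coin does ([r0]): Alice's
   question is then the public one and their flags are superposed. *)
pose r1 dB dC xb : T := (upd dB i true, upd dC i true, xb).
pose r0 dB dC xb : T := (upd dB i false, upd dC i false, xb).
pose cost dB dC xb := chain_cost PX t2 ((tA (r1 dB dC xb)).1 i) ((tU (r1 dB dC xb)).1 i)
   (fun x => (tB (r0 dB dC (upd xb i x))).1 i) (fun x => (tC (r0 dB dC (upd xb i x))).1 i).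
have mix1 (G : K4 -> R) := mixture_at (wt := wt) G Ti hwt.
have nrmS w : nrm w = \sum_(k : K4) 1 * sqn (w k).
  by apply: eq_bigr => k _; rewrite mul1r.
have one dB dC xb : game_avg (fun x u f g =>
     \sum_k pay i k * sqn (Sat i dB dC xb \d x \d u \d f \d g (upd xb i x) k))
  <= ((1 + om) / 2 + 3 * th) * game_avg (fun x u f g =>
       nrm (Sat i dB dC xb \d x \d u \d f \d g (upd xb i x)))
      + 6 / th * cost dB dC xb.
  have [A3 A4] := claim_at (hA (r1 dB dC xb)) (pA_upd1 dB dC xb Ti).
  have [U3 U4] := claim_at (hU (r1 dB dC xb)) (pU_upd Ti).
  have hq0 x : (qs (r0 dB dC (upd xb i x))).1.1 = updp (pA dB dC xb) i \d x.
    exact: pA_upd.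
  have hqb b x : pBC fb (upd dB i b) = updp (pBC fb dB) i (if b then \d true else bern t2).
    exact: pBC_upd.
  have B34 x := claim_at (hB (r0 dB dC (upd xb i x))) (pBC_upd fb false dB Ti).
  have C34 x := claim_at (hC (r0 dB dC (upd xb i x))) (pBC_upd gb false dC Ti).
  have eA1 : (qs (r1 dB dC xb)).1.1 = updp (pA dB dC xb) i PX by apply: pA_upd1.
  have eB1 : (qs (r1 dB dC xb)).1.2 = updp (pBC fb dB) i \d true by apply: pBC_upd.
  have eC1 : (qs (r1 dB dC xb)).2 = updp (pBC gb dC) i \d true by apply: pBC_upd.
  have eB0 x : (qs (r0 dB dC (upd xb i x))).1.2 = updp (pBC fb dB) i (bern t2).
    exact: pBC_upd.
  have eC0 x : (qs (r0 dB dC (upd xb i x))).2 = updp (pBC gb dC) i (bern t2).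
    exact: pBC_upd.
  rewrite eB1 eC1 (pU_upd Ti) in A3; rewrite eB1 eC1 (pU_upd Ti) in A4.
  rewrite eA1 eB1 eC1 in U3; rewrite eA1 eB1 eC1 in U4.
  have B3 x := proj1 (B34 x); have B4 x := proj2 (B34 x).
  have C3 x := proj1 (C34 x); have C4 x := proj2 (C34 x).
  have cAx x := let: And5 h _ _ _ _ := hA (r1 dB dC xb) in h i x.
  have cUx x := let: And5 h _ _ _ _ := hU (r1 dB dC xb) in h i x.
  have cBx x f := let: And5 h _ _ _ _ := hB (r0 dB dC (upd xb i x)) in h i f.
  have cCx x f := let: And5 h _ _ _ _ := hC (r0 dB dC (upd xb i x)) in h i f.
  have {}B3 x : \sum_f bern t2 f * nrm (subv (opB ((tB (r0 dB dC (upd xb i x))).2.1 i f)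
      (Sat i dB dC xb \d x PU (bern t2) (bern t2) (upd xb i x)))
      (Sat i dB dC xb \d x PU \d f (bern t2) (upd xb i x)))
      <= (tB (r0 dB dC (upd xb i x))).1 i.
    by have := B3 x; rewrite eC0 hq0 (pU_upd Ti).
  have {}B4 x : \sum_f bern t2 f * nrm (subv (opB ((tB (r0 dB dC (upd xb i x))).2.2 i f)
      (Sat i dB dC xb \d x PU \d f (bern t2) (upd xb i x)))
      (Sat i dB dC xb \d x PU (bern t2) (bern t2) (upd xb i x)))
      <= (tB (r0 dB dC (upd xb i x))).1 i.
    by have := B4 x; rewrite eC0 hq0 (pU_upd Ti).
  have {}C3 x : \sum_f bern t2 f * nrm (subv (opC ((tC (r0 dB dC (upd xb i x))).2.1 i f)
      (Sat i dB dC xb \d x PU (bern t2) (bern t2) (upd xb i x)))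
      (Sat i dB dC xb \d x PU (bern t2) \d f (upd xb i x)))
      <= (tC (r0 dB dC (upd xb i x))).1 i.
    by have := C3 x; rewrite eB0 hq0 (pU_upd Ti).
  have {}C4 x : \sum_f bern t2 f * nrm (subv (opC ((tC (r0 dB dC (upd xb i x))).2.2 i f)
      (Sat i dB dC xb \d x PU (bern t2) \d f (upd xb i x)))
      (Sat i dB dC xb \d x PU (bern t2) (bern t2) (upd xb i x)))
      <= (tC (r0 dB dC (upd xb i x))).1 i.
    by have := C4 x; rewrite eB0 hq0 (pU_upd Ti).
  pose FA := (tA (r1 dB dC xb)).2.1 i; pose GA := (tA (r1 dB dC xb)).2.2 i.
  pose FU := (tU (r1 dB dC xb)).2.1 i; pose GU := (tU (r1 dB dC xb)).2.2 i.
  pose FB x := (tB (r0 dB dC (upd xb i x))).2.1 i.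
  pose GB x := (tB (r0 dB dC (upd xb i x))).2.2 i.
  pose FC x := (tC (r0 dB dC (upd xb i x))).2.1 i.
  pose GC x := (tC (r0 dB dC (upd xb i x))).2.2 i.
  apply: (@one_env i dB dC xb FA GA FU GU FB GB FC GC cAx cUx cBx cCx) => //.
    exact: (chain_fwd hPX hPU q0 q1 qa aq al1 (prob_pA dB dC xb) prob_pU
      (prob_pBC fb dB) (prob_pBC gb dC) cUx cBx cCx A3 U3 B3 B4 C3 C4).
  exact: (chain_bwd hPX hPU q0 q1 qa aq al1 (prob_pA dB dC xb) prob_pU
      (prob_pBC fb dB) (prob_pBC gb dC) cAx cUx cBx cCx A4 U4 B3 B4 C3 C4).
have mixn : Eenv (fun dB dC xb => wt xb * nrm (ES dB dC xb))
  = Eenv (fun dB dC xb => wt xb * game_avg (fun x u f g =>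
      nrm (Sat i dB dC xb \d x \d u \d f \d g (upd xb i x)))).
  have := mix1 (fun=> 1).
  have -> : (fun dB dC xb => wt xb * (\sum_k 1 * sqn (ES dB dC xb k)))
     = (fun dB dC xb => wt xb * nrm (ES dB dC xb)).
    by do 3![apply: funext => ?]; rewrite nrmS.
  move=> ->; congr Eenv; do 3![apply: funext => ?]; congr (_ * game_avg _).
  by do 4![apply: funext => ?]; rewrite nrmS.
rewrite mix1 mixn -!EenvZ.
apply: le_trans (_ : Eenv (fun dB dC xb =>
   ((1 + om) / 2 + 3 * th) * (wt xb * game_avg (fun x u f g =>
      nrm (Sat i dB dC xb \d x \d u \d f \d g (upd xb i x))))
   + 6 / th * (wt xb * cost dB dC xb)) <= _).
  apply: Eenv_le => dB dC xb; apply: le_trans (ler_wpM2l (wt0 xb) (one dB dC xb)) _.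
  by rewrite mulrDr mulrCA [X in _ + X]mulrCA.
rewrite EenvD lerD2l !EenvZ ler_wpM2l //; first by rewrite divr_ge0 // ltW.
have -> : Eenv (fun dB dC xb => wt xb * cost dB dC xb)
  = 4 * (Eenv (fun dB dC xb => wt xb * (tA (r1 dB dC xb)).1 i)
    + Eenv (fun dB dC xb => wt xb * (tU (r1 dB dC xb)).1 i)
    + (4 / t2 / t2 * Eenv (fun dB dC xb => wt xb * (tB (r0 dB dC xb)).1 i)
      + 8 / t2 * Eenv (fun dB dC xb => wt xb * (tC (r0 dB dC xb)).1 i))).
  have q (F : {ffun 'I_l -> bool} -> {ffun 'I_l -> bool} -> {ffun 'I_l -> X} -> R) :
    Eenv (fun dB dC xb => wt xb * F dB dC xb)
    = Eenv (fun dB dC xb => wt xb * \sum_x PX x * F dB dC (upd xb i x)).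
    rewrite (Eenv_question i); congr Eenv; do 3![apply: funext => ?].
    by rewrite mulr_sumr; apply: eq_bigr => x _; rewrite hwt mulrCA.
  rewrite (q (fun dB dC xb => (tB (r0 dB dC xb)).1 i)).
  rewrite (q (fun dB dC xb => (tC (r0 dB dC xb)).1 i)).
  rewrite -!EenvZ -!EenvD -EenvZ; congr Eenv; do 3![apply: funext => ?].
  rewrite /cost /chain_cost; under eq_bigr => x _ do rewrite mulrDr.
  rewrite big_split /=.
  have E1 (F : X -> R) : \sum_x PX x * (4 * (F x / t2) / t2)
      = 4 / t2 / t2 * \sum_x PX x * F x.
    by rewrite mulr_sumr; apply: eq_bigr => x _; ring.
  have E2 (F : X -> R) : \sum_x PX x * (4 * (2 * F x) / t2) = 8 / t2 * \sum_x PX x * F x.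
    by rewrite mulr_sumr; apply: eq_bigr => x _; ring.
  rewrite E1 E2; ring.
have E0 (F : {ffun 'I_l -> bool} -> {ffun 'I_l -> bool} -> {ffun 'I_l -> X} -> R) :
    (forall dB dC xb, 0 <= F dB dC xb) -> 0 <= Eenv (fun dB dC xb => wt xb * F dB dC xb).
  move=> F0; have -> : 0 = Eenv (fun _ _ _ => 0 * 0) by rewrite EenvZ mul0r.
  by apply: Eenv_le => dB dC xb; rewrite mul0r mulr_ge0.
have -> : Eenv (fun dB dC xb => wt xb * ((tA (dB, dC, xb)).1 i + (tU (dB, dC, xb)).1 i
     + (tB (dB, dC, xb)).1 i + (tC (dB, dC, xb)).1 i))
  = Eenv (fun dB dC xb => wt xb * (tA (dB, dC, xb)).1 i)
    + Eenv (fun dB dC xb => wt xb * (tU (dB, dC, xb)).1 i)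
    + Eenv (fun dB dC xb => wt xb * (tB (dB, dC, xb)).1 i)
    + Eenv (fun dB dC xb => wt xb * (tC (dB, dC, xb)).1 i).
  by rewrite -!EenvD; congr Eenv; do 3![apply: funext => ?]; rewrite !mulrDr.
apply: env_cost_bound; try by apply: E0.
- exact: (coins_ge i true (F := fun dB dC xb => wt xb * (tA (dB, dC, xb)).1 i)
    (fun dB dC xb => mulr_ge0 (wt0 xb) (dA0 _ i))).
- exact: (coins_ge i true (F := fun dB dC xb => wt xb * (tU (dB, dC, xb)).1 i)
    (fun dB dC xb => mulr_ge0 (wt0 xb) (dU0 _ i))).
- exact: (coins_ge i false (F := fun dB dC xb => wt xb * (tB (dB, dC, xb)).1 i)
    (fun dB dC xb => mulr_ge0 (wt0 xb) (dB0 _ i))).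
- exact: (coins_ge i false (F := fun dB dC xb => wt xb * (tC (dB, dC, xb)).1 i)
    (fun dB dC xb => mulr_ge0 (wt0 xb) (dC0 _ i))).
Qed.

End Environment.

(** * Public and private inputs together give back the repeated game *)

Section Kernels.
Variable R : realType.
Variables (l : nat).

Lemma sum_pm_kernel (V V' : finType) (p : 'I_l -> V -> R) (q : 'I_l -> V' -> R)
    (kap : 'I_l -> V -> V' -> R) (h : {ffun 'I_l -> V'} -> R) :
  (forall j w, \sum_v p j v * kap j v w = q j w) ->
  \sum_y pm p y * (\sum_x pm (fun j => kap j (y j)) x * h x) = \sum_x pm q x * h x.
Proof.
move=> hq; under eq_bigr => y _ do rewrite mulr_sumr.
rewrite exchange_big; apply: eq_bigr => x _ /=.
under eq_bigr => y _ do rewrite mulrA.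
rewrite -mulr_suml; congr (_ * _).
rewrite /pm (sum_pm_prod p (fun j v => kap j v (x j))).
by apply: eq_bigr => j _; apply: hq.
Qed.

Lemma sum_pm_dirac (V : finType) (c : {ffun 'I_l -> V}) (h : {ffun 'I_l -> V} -> R) :
  \sum_y pm (fun j => dirac R (c j)) y * h y = h c.
Proof.
rewrite (bigD1 c) //= big1 ?addr0.
  by rewrite /pm big1 ?mul1r // => j _; rewrite /dirac eqxx.
move=> y ne; have [->|nz] := eqVneq (pm (fun j => dirac R (c j)) y) 0.
  by rewrite mul0r.
case/eqP: ne; apply/ffunP => j.
have := nz; rewrite /pm => /prodf_neq0 /(_ j isT); rewrite /dirac.
by have [->//|_] := eqVneq (y j) (c j); rewrite eqxx.
Qed.

End Kernels.

Section GlobalMixture.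
Variable R : realType.
Local Notation C := (complex R).
Local Notation "x %:C" := (real_complex R x).
Variables (X U : finType) (l : nat).
Variables (PX : X -> R) (PU : U -> R) (al : R).
Hypothesis hPX : isprob PX.
Hypothesis hPU : isprob PU.
Hypothesis hal : 0 < al < 1.

Lemma sum_bot_or (x : X) (w : option X) :
  \sum_b bern al b * dirac R (bot_or b x) w
   = if w is Some x' then (x' == x)%:R * (1 - al) else al.
Proof.
rewrite big_bool /= /dirac /bot_or; case: w => [x'|] /=.
  by rewrite mulr0 add0r mulrC; congr (_ %:R * _).
by rewrite mulr1 mulr0 addr0.
Qed.

Lemma sum_yof (x : {ffun 'I_l -> X}) (h : {ffun 'I_l -> option X} -> R) :
  \sum_f pm (fun=> bern al) f * h (yof x f)
   = \sum_y pm (fun j w => if w is Some x' then (x' == x j)%:R * (1 - al) else al) y * h y.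
Proof.
rewrite -(@sum_pm_kernel _ _ _ _ (fun=> bern al) _ (fun j b => dirac R (bot_or b (x j)))).
  apply: eq_bigr => f _; congr (_ * _); rewrite -[LHS]sum_pm_dirac.
  by apply: eq_bigr => y _; congr (_ * _); apply: eq_bigr => j _; rewrite ffunE.
by move=> j w; apply: sum_bot_or.
Qed.

Lemma sum_rep_dist (h : {ffun 'I_l -> X} -> {ffun 'I_l -> U} ->
     {ffun 'I_l -> option X} -> {ffun 'I_l -> option X} -> R) :
  \sum_x \sum_u \sum_y \sum_z rep_dist l (Galpha_dist PX PU al) x u y z * h x u y z
  = \sum_x pm (fun=> PX) x * \sum_u pm (fun=> PU) u *
     \sum_f pm (fun=> bern al) f * \sum_g pm (fun=> bern al) g * h x u (yof x f) (yof x g).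
Proof.
apply: eq_bigr => x _; rewrite mulr_sumr; apply: eq_bigr => u _.
rewrite mulrA; under [in RHS]eq_bigr => f _ do
  rewrite (sum_yof x (fun z => h x u (yof x f) z)).
rewrite (sum_yof x (fun y => \sum_z pm (fun j w => if w is Some x'
  then (x' == x j)%:R * (1 - al) else al) z * h x u y z)) mulr_sumr.
apply: eq_bigr => y _; rewrite mulrA mulr_sumr; apply: eq_bigr => z _.
rewrite mulrA; congr (_ * _); rewrite /pm -!big_split; apply: eq_bigr => j _ /=.
by rewrite /Galpha_dist mulrA [PU _ * _]mulrC.
Qed.

Variable Ts : pred 'I_l.

Lemma avg_pA dB dC (h : {ffun 'I_l -> X} -> R) :
  \sum_xb pm (fun=> PX) xb * (\sum_x pm (pA PX Ts dB dC xb) x * h x)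
   = \sum_x pm (fun=> PX) x * h x.
Proof.
apply: (@sum_pm_kernel _ _ _ _ (fun=> PX) (fun=> PX)
  (fun j w => if ~~ Ts j && (dB j && dC j) then PX else dirac R w)) => j w.
case: (~~ Ts j && _); first exact: avg_const.
by rewrite -[RHS](sum_dirac w PX); apply: eq_bigr => v _; rewrite mulrC /dirac eq_sym.
Qed.

Lemma avg_pU (h : {ffun 'I_l -> U} -> R) :
  \sum_ub pm (fun=> PU) ub * (\sum_u pm (pU PU Ts ub) u * h u)
   = \sum_u pm (fun=> PU) u * h u.
Proof.
apply: (@sum_pm_kernel _ _ _ _ (fun=> PU) (fun=> PU)
  (fun j w => if Ts j then dirac R w else PU)) => j w.
case: (Ts j); last exact: avg_const.
by rewrite -[RHS](sum_dirac w PU); apply: eq_bigr => v _; rewrite mulrC /dirac eq_sym.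
Qed.

Lemma avg_pBC (h : {ffun 'I_l -> bool} -> R) :
  \sum_fb pm (fun=> bern al) fb * (\sum_dB pm (fun=> bern (t1 al)) dB *
     (\sum_f pm (pBC al Ts fb dB) f * h f))
   = \sum_f pm (fun=> bern al) f * h f.
Proof.
transitivity (\sum_fb pm (fun=> bern al) fb *
  (\sum_f pm (fun j => if Ts j then dirac R (fb j) else bern al) f * h f)).
  apply: eq_bigr => fb _; congr (_ * _).
  apply: (@sum_pm_kernel _ _ _ _ (fun=> bern (t1 al)) (fun j => if Ts j then dirac R (fb j) else bern al)
    (fun j b => if Ts j then dirac R (fb j) else if b then dirac R true else bern (t2 al))) => j w.
  case: (Ts j); first by apply: avg_const; apply: prob_t1.
  have := coin_mix hal (fun f => (f == w)%:R).
  have E (p : bool -> R) : \sum_f p f * (f == w)%:R = p w.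
    rewrite (bigD1 w) //= eqxx mulr1 big1 ?addr0 // => f /negbTE ->.
    by rewrite mulr0.
  by rewrite E; under eq_bigr => b _ do rewrite E.
apply: (@sum_pm_kernel _ _ _ _ (fun=> bern al) (fun=> bern al)
  (fun j w => if Ts j then dirac R w else bern al)) => j w.
case: (Ts j); last by apply: avg_const; apply: isprob_bal.
by rewrite -[RHS](sum_dirac w (bern al)); apply: eq_bigr => v _; rewrite mulrC /dirac eq_sym.
Qed.

(** At each coordinate either Alice's question is the public one or the flag is bottom, so reading
    the question from [xb] agrees with reading it from her input. In its uses [d] is one of the two
    coins. *)
Lemma yof_supp dB dC d xb x fb f :
  pm (pA PX Ts dB dC xb) x != 0 -> pm (pBC al Ts fb d) f != 0 ->
  (forall j, dB j && dC j -> d j) -> yof xb f = yof x f.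
Proof.
move=> /prodf_neq0 hx /prodf_neq0 hf hd; apply/ffunP => j; rewrite !ffunE.
move: (hx j isT) (hf j isT); rewrite /pA /pBC; have [T|nT] := boolP (Ts j) => /=.
  by rewrite /dirac; have [->//|_] := eqVneq (x j) (xb j); rewrite eqxx.
case: ifP => [/hd -> _|_].
  by rewrite /dirac; case: (f j); rewrite ?eqxx.
by rewrite /dirac; have [->//|_] := eqVneq (x j) (xb j); rewrite eqxx.
Qed.

End GlobalMixture.

Section Unravel.
Variable R : realType.
Local Notation C := (complex R).
Local Notation "x %:C" := (real_complex R x).
Variables (X U : finType) (l : nat).
Variables (KA KE KB KC IA IU IB IC : finType).
Variables (LA : {ffun 'I_l -> X} -> KA -> IA -> C).
Variables (LU : {ffun 'I_l -> U} -> KE * (IB * IC) -> IU -> C).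
Variables (LB : {ffun 'I_l -> option X} -> KB -> IB -> C).
Variables (LC : {ffun 'I_l -> option X} -> KC -> IC -> C).
Variable v : IA * IU -> C.
Variables (PX : X -> R) (PU : U -> R) (al : R).
Hypothesis hPX : isprob PX.
Hypothesis hPU : isprob PU.
Hypothesis hal : 0 < al < 1.
Variable Ts : pred 'I_l.
Local Notation KA' := ({ffun 'I_l -> X} * KA)%type.
Local Notation KE' := ({ffun 'I_l -> U} * KE)%type.
Local Notation KB' := ({ffun 'I_l -> bool} * KB)%type.
Local Notation KC' := ({ffun 'I_l -> bool} * KC)%type.
Local Notation K4 := (KA' * (KE' * (KB' * KC')))%type.
Local Notation KK := (KA * (KE * (KB * KC)))%type.

Definition pack x u f g (k : KK) : K4 :=
  ((x, k.1), ((u, k.2.1), ((f, k.2.2.1), (g, k.2.2.2)))).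

Lemma sum_pack (F : K4 -> R) :
  \sum_k F k = \sum_x \sum_u \sum_f \sum_g \sum_k F (pack x u f g k).
Proof.
rewrite !pair_bigA /=.
pose t (e : {ffun 'I_l -> X} * {ffun 'I_l -> U} * {ffun 'I_l -> bool}
    * {ffun 'I_l -> bool} * KK) := pack e.1.1.1.1 e.1.1.1.2 e.1.1.2 e.1.2 e.2.
rewrite (reindex t) //=.
exists (fun k : K4 => (k.1.1, k.2.1.1, k.2.2.1.1, k.2.2.2.1,
   (k.1.2, (k.2.1.2, (k.2.2.1.2, k.2.2.2.2))))).
  by case=> -[[[x u] f] g] [a [e [b c]]].
by case=> -[x a] [[u e] [[f b] [g c]]].
Qed.

Lemma State_pack qA qU qB qC xb x u f g k :
  State LA LU LB LC v qA qU qB qC xb (pack x u f g k)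
  = (Num.sqrt (pm qC g))%:C * ((Num.sqrt (pm qB f))%:C * ((Num.sqrt (pm qU u))%:C *
      (Num.sqrt (pm qA x))%:C))
    * amp (LA x) (LU u) (LB (yof xb f)) (LC (yof xb g)) v k.
Proof.
have step (s r L Z Y : C) : Z = r * Y -> (s * L) * Z = (s * r) * (L * Y).
  by move=> ->; rewrite !mulrA; congr (_ * _); rewrite -!mulrA; congr (_ * _); rewrite mulrC.
rewrite /State /amp /opC mulr_sumr; apply: eq_bigr => c _; apply: (step _ _ _ _ _).
rewrite /opB mulr_sumr; apply: eq_bigr => b _; apply: (step _ _ _ _ _).
rewrite /op2 mulr_sumr; apply: eq_bigr => t _; apply: (step _ _ _ _ _).
by rewrite /op1 mulr_sumr; apply: eq_bigr => a _; rewrite mulrA.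
Qed.

Variables (ub : {ffun 'I_l -> U}) (fb gb : {ffun 'I_l -> bool}).
Local Notation Est := (ES LA LU LB LC v PX PU al Ts ub fb gb).

Lemma sum_ES dB dC xb (G : K4 -> R) :
  \sum_k G k * sqn (Est dB dC xb k)
  = \sum_x pm (pA PX Ts dB dC xb) x * \sum_u pm (pU PU Ts ub) u *
     \sum_f pm (pBC al Ts fb dB) f * \sum_g pm (pBC al Ts gb dC) g *
       \sum_k G (pack x u f g k) *
         sqn (amp (LA x) (LU u) (LB (yof x f)) (LC (yof x g)) v k).
Proof.
rewrite sum_pack; apply: eq_bigr => x _.
rewrite mulr_sumr; apply: eq_bigr => u _.
rewrite !mulr_sumr; apply: eq_bigr => f _.
rewrite !mulr_sumr; apply: eq_bigr => g _.
rewrite !mulr_sumr; apply: eq_bigr => k _.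
have a0 : 0 <= pm (pA PX Ts dB dC xb) x by apply: pm_ge0 => j; apply: prob_pA.
have u0 : 0 <= pm (pU PU Ts ub) u by apply: pm_ge0 => j; apply: prob_pU.
have b0 : 0 <= pm (pBC al Ts fb dB) f by apply: pm_ge0 => j; apply: prob_pBC.
have c0 : 0 <= pm (pBC al Ts gb dC) g by apply: pm_ge0 => j; apply: prob_pBC.
rewrite /ES State_pack !sqnM !sqn_real !sqr_sqrtr //.
have [->|nA] := eqVneq (pm (pA PX Ts dB dC xb) x) 0; first by rewrite !(mul0r, mulr0).
have [->|nB] := eqVneq (pm (pBC al Ts fb dB) f) 0; first by rewrite !(mul0r, mulr0).
have [->|nC] := eqVneq (pm (pBC al Ts gb dC) g) 0; first by rewrite !(mul0r, mulr0).
rewrite (yof_supp nA nB) => [|j /andP[] //].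
rewrite (yof_supp nA nC) => [|j /andP[] //].
by set a := pm _ _; set b := pm _ _; set c := pm _ _; set d := pm _ _; set s := sqn _;
  set t := G _; ring.
Qed.

End Unravel.

Section Reveal.
Variable R : realType.
Variables (X U : finType) (l : nat) (PX : X -> R) (PU : U -> R) (al : R).
Hypothesis hPX : isprob PX.
Hypothesis hPU : isprob PU.
Hypothesis hal : 0 < al < 1.
Variable Ts : pred 'I_l.

Lemma reveal_avg (h : {ffun 'I_l -> X} -> {ffun 'I_l -> U} ->
    {ffun 'I_l -> bool} -> {ffun 'I_l -> bool} -> R) :
  \sum_gb pm (fun=> bern al) gb * (\sum_fb pm (fun=> bern al) fb *
   (\sum_ub pm (fun=> PU) ub * Eenv PX al (fun dB dC xb =>
     \sum_x pm (pA PX Ts dB dC xb) x * (\sum_u pm (pU PU Ts ub) u *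
     (\sum_f pm (pBC al Ts fb dB) f * (\sum_g pm (pBC al Ts gb dC) g * h x u f g))))))
  = \sum_x pm (fun=> PX) x * (\sum_u pm (fun=> PU) u *
     (\sum_f pm (fun=> bern al) f * (\sum_g pm (fun=> bern al) g * h x u f g))).
Proof.
transitivity (\sum_gb pm (fun=> bern al) gb * (\sum_fb pm (fun=> bern al) fb *
   (\sum_dB pm (fun=> bern (t1 al)) dB * (\sum_dC pm (fun=> bern (t1 al)) dC *
    (\sum_x pm (fun=> PX) x * (\sum_u pm (fun=> PU) u *
     (\sum_f pm (pBC al Ts fb dB) f * (\sum_g pm (pBC al Ts gb dC) g * h x u f g)))))))).
  apply: eq_bigr => gb _; congr (_ * _); apply: eq_bigr => fb _; congr (_ * _).
  rewrite /Eenv [LHS]exchange_avg; apply: eq_bigr => dB _; congr (_ * _).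
  rewrite [LHS]exchange_avg; apply: eq_bigr => dC _; congr (_ * _).
  under eq_bigr => ub _ do rewrite (avg_pA hPX Ts dB dC).
  rewrite [LHS]exchange_avg; apply: eq_bigr => x _; congr (_ * _).
  exact: (avg_pU hPU Ts).
under eq_bigr => gb _ do under eq_bigr => fb _ do under eq_bigr => dB _ do rewrite exchange_avg.
under eq_bigr => gb _ do under eq_bigr => fb _ do rewrite exchange_avg.
under eq_bigr => gb _ do rewrite exchange_avg.
rewrite [LHS]exchange_avg; apply: eq_bigr => x _; congr (_ * _).
under eq_bigr => gb _ do under eq_bigr => fb _ do under eq_bigr => dB _ do rewrite exchange_avg.
under eq_bigr => gb _ do under eq_bigr => fb _ do rewrite exchange_avg.
under eq_bigr => gb _ do rewrite exchange_avg.
rewrite [LHS]exchange_avg; apply: eq_bigr => u _; congr (_ * _).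
under eq_bigr => gb _ do under eq_bigr => fb _ do under eq_bigr => dB _ do rewrite exchange_avg.
under eq_bigr => gb _ do rewrite (avg_pBC hal Ts).
rewrite [LHS]exchange_avg; apply: eq_bigr => f _; congr (_ * _).
exact: (avg_pBC hal Ts).
Qed.

End Reveal.

Section Round.
Variable R : realType.
Local Notation C := (complex R).
Variables (X U A S B D : finType) (l : nat).
Variable W : X -> U -> option X -> option X -> A -> S -> B -> D -> bool.
Variables (KA KE KB KC IA IU IB IC : finType).
Variables (la : KA -> {ffun 'I_l -> A}) (le : KE -> {ffun 'I_l -> S}).
Variables (lb : KB -> {ffun 'I_l -> B}) (lc : KC -> {ffun 'I_l -> D}).
Variables (LA : {ffun 'I_l -> X} -> KA -> IA -> C).
Variables (LU : {ffun 'I_l -> U} -> KE * (IB * IC) -> IU -> C).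
Variables (LB : {ffun 'I_l -> option X} -> KB -> IB -> C).
Variables (LC : {ffun 'I_l -> option X} -> KC -> IC -> C).
Variable v : IA * IU -> C.
Hypothesis cA : forall x, contr (LA x).
Hypothesis cU : forall x, contr (LU x).
Hypothesis cB : forall x, contr (LB x).
Hypothesis cC : forall x, contr (LC x).
Hypothesis nv : nrm v <= 1.
Variables (PX : X -> R) (PU : U -> R) (al om th : R).
Hypothesis hPX : isprob PX.
Hypothesis hPU : isprob PU.
Hypothesis hal : 0 < al < 1.
Hypothesis om01 : 0 <= om <= 1.
Hypothesis om_ge : qvalue (Galpha_dist PX PU al) W <= om.
Hypothesis th0 : 0 < th.
Hypothesis th1 : th <= 1.
Variables (Ts : pred 'I_l) (n : nat).
Hypothesis Tn : (#|Ts| <= n)%N.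
Variables (ub : {ffun 'I_l -> U}) (fb gb : {ffun 'I_l -> bool}).
Variable wt : {ffun 'I_l -> X} -> R.
Hypothesis wt01 : forall xb, 0 <= wt xb <= 1.
Hypothesis hwt : forall i xb y, ~~ Ts i -> wt (upd xb i y) = wt xb.
Local Notation ES := (ES LA LU LB LC v PX PU al Ts ub fb gb).
Local Notation Ee := (@Eenv R X l PX al).

Lemma Eenv_sum (I : finType) F : \sum_(i : I) Ee (F i)
  = Ee (fun dB dC xb => \sum_i F i dB dC xb).
Proof.
rewrite exchange_big; apply: eq_bigr => dB _ /=; rewrite -mulr_sumr; congr (_ * _).
rewrite exchange_big; apply: eq_bigr => dC _ /=; rewrite -mulr_sumr; congr (_ * _).
rewrite exchange_big; apply: eq_bigr => xb _ /=; by rewrite -mulr_sumr.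
Qed.

Lemma Eenv_const r : Ee (fun _ _ _ => r) = r.
Proof.
have ht : forall j : 'I_l, isprob (bern (t1 al)) by move=> j; apply: prob_t1.
by rewrite /Eenv !sum_pm_const.
Qed.

(** The summand [n] accounts for the coordinates in [Ts], where the payoff is only bounded by 1. In
    [step_cost], 6144 = 6 * 256 * 4: the factors of [combine_bounds], of [env_cost_bound] and of the
    four entropy budgets. *)
Definition step_rate : R := n%:R + l%:R * ((1 + om) / 2 + 3 * th).
Definition step_cost : R := 6144 / (th * al ^+ 2).

(* The entropy - p ln p is replaced by its tangent at c, which is linear in p
   and can therefore be averaged; c is chosen only after summing. *)
Lemma round_bound c : 0 < c ->
  \sum_i Ee (fun dB dC xb => wt xb * \sum_k pay R W la le lb lc i k * sqn (ES dB dC xb k))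
  <= step_rate * Ee (fun dB dC xb => wt xb * nrm (ES dB dC xb))
   + step_cost * (c - (1 + ln c) * Ee (fun dB dC xb => wt xb * nrm (ES dB dC xb))).
Proof.
move=> c0; set E := Ee (fun dB dC xb => wt xb * nrm _).
have wt0 xb : 0 <= wt xb by case/andP: (wt01 xb).
have a0 : 0 < al by case/andP: hal.
have E0 : 0 <= E.
  rewrite -(Eenv_const 0); apply: Eenv_le => // dB dC xb.
  by rewrite mulr_ge0 ?nrm_ge0.
have [Dst [D0 Dsum Dstep]] := env_step la le lb lc cA cU cB cC nv hPX hPU hal Ts
  ub fb gb om01 om_ge.
pose q2 := (1 + om) / 2 + 3 * th; pose co := 6 / th * (256 / al ^+ 2).
have q0 : 0 <= q2.
  by rewrite /q2; move: om01 th0 => /andP[h1 _] h2; lra.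
have co0 : 0 <= co by rewrite /co mulr_ge0 // divr_ge0 ?exprn_ge0 // ltW.
pose ED i := Ee (fun dB dC xb => wt xb * Dst dB dC xb i).
have ED0 i : 0 <= ED i.
  rewrite -(Eenv_const 0); apply: Eenv_le => // dB dC xb.
  by rewrite mulr_ge0.
apply: le_trans (_ : \sum_i ((Ts i)%:R * E + q2 * E + co * ED i) <= _).
  apply: ler_sum => i _; have [Ti|nTi] := boolP (Ts i); last first.
    rewrite mul0r add0r; apply: le_trans (Dstep i wt th nTi _ _ _ _) _ => //.
      by move=> xb y; apply: hwt.
    by rewrite [6 / th * (_ * Ee _)]mulrA.
  rewrite mul1r -addrA; apply: le_trans (_ : E <= _); last first.
    by rewrite lerDl; apply: addr_ge0; [exact: mulr_ge0 q0 E0 | exact: mulr_ge0 co0 (ED0 i)].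
  apply: Eenv_le => // dB dC xb; apply: ler_wpM2l => //.
  apply: ler_sum => k _; rewrite ler_piMl ?sqn_ge0 //.
  by case/andP: (pay_at_bounds R W la le lb lc i (k.1.1 i) (k.2.1.1 i) (k.2.2.1.1 i) (k.2.2.2.1 i) k).
rewrite !big_split /= -!mulr_suml -mulr_sumr.
apply: lerD; last first.
  rewrite /ED Eenv_sum.
  apply: le_trans (_ : co * (4 * (c - (1 + ln c) * E)) <= _); last first.
    rewrite /step_cost /co le_eqVlt; apply/orP; left; apply/eqP; field.
    by rewrite !gt_eqF.
  apply: ler_wpM2l => //.
  apply: le_trans (_ : Ee (fun dB dC xb => 4 * (c + - (1 + ln c) * (wt xb * nrm (ES dB dC xb)))) <= _).
    apply: Eenv_le => // dB dC xb; rewrite -mulr_sumr.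
    apply: le_trans (ler_wpM2l (wt0 xb) (Dsum dB dC xb)) _.
    have := kl_scaled (nrm_ge0 (ES dB dC xb)) (ltr01 : 0 < (1 : R)) c0.
    rewrite ln1 !mulr0 subr0 mulr1; set p := nrm _ => kl.
    apply: le_trans (_ : wt xb * (4 * (c - p * ln c - p)) <= _).
      by apply: ler_wpM2l => //; rewrite ler_pM2l //; move: kl; lra.
    have w1 : wt xb <= 1 by case/andP: (wt01 xb).
    apply: le_trans (_ : 4 * (wt xb * c - wt xb * p * ln c - wt xb * p) <= _).
      by rewrite le_eqVlt; apply/orP; left; apply/eqP; ring.
    rewrite ler_pM2l //; have : wt xb * c <= c by rewrite ler_piMl // ltW.
    by set x := wt xb * p; lra.
  rewrite EenvZ ler_pM2l // EenvD Eenv_const EenvZ -/E.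
  by rewrite mulNr.
rewrite /step_rate [leRHS]mulrDl -/q2; apply: lerD.
  apply: ler_wpM2r => //.
  apply: le_trans (_ : (#|Ts|)%:R <= _); last by rewrite ler_nat.
  rewrite -sum1_card natr_sum [leRHS]big_mkcond /=; apply: ler_sum => i _.
  by rewrite unfold_in; case: (Ts i).
by rewrite sumr_const card_ord -[q2 *+ l]mulr_natl.
Qed.

End Round.

(** * The moment recursion and its consequence *)

Section Masks.
Variable R : realType.
Local Notation C := (complex R).

(** Postselection without renormalisation. The result is again a contraction, so whatever holds for
    strategies applies to it. *)
Definition maskf (K I : finType) (p : pred K) (L : K -> I -> C) : K -> I -> C :=
  fun k i => (p k)%:R * L k i.

Lemma contr_maskf (K I : finType) (p : pred K) (L : K -> I -> C) :
  contr L -> contr (maskf p L).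
Proof.
move=> cL w; apply: le_trans (cL w); apply: ler_sum => k _.
have -> : app (maskf p L) w k = (p k)%:R * app L w k.
  by rewrite /app mulr_sumr; apply: eq_bigr => i _; rewrite mulrA.
by case: (p k); rewrite ?mul1r // mul0r sqn0 sqn_ge0.
Qed.

Lemma amp_maskf (KA IA IU KE IB IC KB KC : finType) (LA : KA -> IA -> C)
    (LU : KE * (IB * IC) -> IU -> C) (LB : KB -> IB -> C) (LC : KC -> IC -> C)
    (pa : pred KA) (pe : pred KE) (pb : pred KB) (pc : pred KC) (v : IA * IU -> C) k :
  amp (maskf pa LA) (maskf (fun k => pe k.1) LU) (maskf pb LB) (maskf pc LC) v k
  = [&& pc k.2.2.2, pb k.2.2.1, pe k.2.1 & pa k.1]%:R * amp LA LU LB LC v k.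
Proof.
have step (s r L Z Y : C) : Z = r * Y -> (s * L) * Z = (s * r) * (L * Y).
  by move=> ->; rewrite !mulrA; congr (_ * _); rewrite -!mulrA; congr (_ * _); rewrite mulrC.
rewrite -!mulnb !natrM /amp /opC mulr_sumr; apply: eq_bigr => c _; apply: (step _ _ _ _ _).
rewrite /opB mulr_sumr; apply: eq_bigr => b _; apply: (step _ _ _ _ _).
rewrite /op2 mulr_sumr; apply: eq_bigr => t _; apply: (step _ _ _ _ _).
by rewrite /op1 mulr_sumr; apply: eq_bigr => a _; rewrite mulrA.
Qed.

Lemma sqn_bool (b : bool) (z : C) : sqn (b%:R * z) = b%:R * sqn z.
Proof. by case: b; rewrite ?mul1r // !mul0r sqn0. Qed.

End Masks.

Section RevealAverage.
Variable R : realType.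
Variables (U : finType) (l : nat) (PU : U -> R) (al : R).
Hypothesis hPU : isprob PU.
Hypothesis hal : 0 < al < 1.
Implicit Types (F : {ffun 'I_l -> U} -> {ffun 'I_l -> bool} -> {ffun 'I_l -> bool} -> R).

(** Averages the values that the inputs of Barlie, Bob and Charlie are pinned to on the tuple; the
    coins and the public questions of Alice are averaged by [Eenv]. *)
Definition Reveal F : R := \sum_gb pm (fun=> bern al) gb *
  (\sum_fb pm (fun=> bern al) fb * (\sum_ub pm (fun=> PU) ub * F ub fb gb)).

Lemma isprob_pm (V : finType) (p : 'I_l -> V -> R) : (forall j, isprob (p j)) ->
  isprob (pm p).
Proof. by move=> hp; split=> [x|]; [apply: pm_ge0 | apply: sum_pm]. Qed.

Let hf : isprob (pm (fun=> bern al) : {ffun 'I_l -> bool} -> R).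
Proof. by apply: isprob_pm => _; apply: isprob_bal. Qed.
Let hu : isprob (pm (fun=> PU) : {ffun 'I_l -> U} -> R).
Proof. exact: isprob_pm. Qed.

Lemma Reveal_le F G : (forall ub fb gb, F ub fb gb <= G ub fb gb) -> Reveal F <= Reveal G.
Proof.
case: hf => f0 _; case: hu => u0 _ h.
apply: ler_sum => gb _; apply: ler_wpM2l => //.
apply: ler_sum => fb _; apply: ler_wpM2l => //.
by apply: ler_sum => ub _; apply: ler_wpM2l.
Qed.

Lemma Reveal_affine a b F : Reveal (fun ub fb gb => a + b * F ub fb gb) = a + b * Reveal F.
Proof.
have E (V : finType) (p : V -> R) (G : V -> R) : isprob p ->
    \sum_w p w * (a + b * G w) = a + b * \sum_w p w * G w.
  move=> hp; rewrite avgD // mulr_sumr; congr (_ + _).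
  by apply: eq_bigr => w _; rewrite mulrCA.
rewrite /Reveal.
under eq_bigr => gb _ do under eq_bigr => fb _ do rewrite E //.
under eq_bigr => gb _ do rewrite E //.
by rewrite E.
Qed.

Lemma Reveal_sum (I : finType) (F : I -> _) : \sum_i Reveal (F i)
  = Reveal (fun ub fb gb => \sum_i F i ub fb gb).
Proof.
rewrite exchange_big; apply: eq_bigr => dB _ /=; rewrite -mulr_sumr; congr (_ * _).
rewrite exchange_big; apply: eq_bigr => dC _ /=; rewrite -mulr_sumr; congr (_ * _).
by rewrite exchange_big; apply: eq_bigr => xb _ /=; rewrite -mulr_sumr.
Qed.

End RevealAverage.

Section StrategyValue.
Variable R : realType.
Local Notation C := (complex R).
Variables (X U : finType) (l : nat).
Variables (KA KE KB KC IA IU IB IC : finType).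
Variables (PX : X -> R) (PU : U -> R) (al : R).
Hypothesis hPX : isprob PX.
Hypothesis hPU : isprob PU.
Hypothesis hal : 0 < al < 1.
Local Notation KA' := ({ffun 'I_l -> X} * KA)%type.
Local Notation KE' := ({ffun 'I_l -> U} * KE)%type.
Local Notation KB' := ({ffun 'I_l -> bool} * KB)%type.
Local Notation KC' := ({ffun 'I_l -> bool} * KC)%type.
Local Notation K4 := (KA' * (KE' * (KB' * KC')))%type.
Local Notation KK := (KA * (KE * (KB * KC)))%type.
Local Notation fX := {ffun 'I_l -> X}.
Local Notation fU := {ffun 'I_l -> U}.
Local Notation fY := {ffun 'I_l -> option X}.
Local Notation payoff := (fX -> fU -> fY -> fY -> KK -> R).
Implicit Types (Gam : payoff) (f : fX -> fU -> fY -> fY -> KK -> C).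

Definition sval f Gam : R :=
  \sum_x \sum_u \sum_y \sum_z rep_dist l (Galpha_dist PX PU al) x u y z *
    \sum_k Gam x u y z k * sqn (f x u y z k).

Lemma sval_sum (I : finType) (p : pred I) f (Gam : I -> payoff) :
  \sum_(i | p i) sval f (Gam i) = sval f (fun x u y z k => \sum_(i | p i) Gam i x u y z k).
Proof.
rewrite /sval exchange_big; apply: eq_bigr => x _ /=.
rewrite exchange_big; apply: eq_bigr => u _ /=.
rewrite exchange_big; apply: eq_bigr => y _ /=.
rewrite exchange_big; apply: eq_bigr => z _ /=.
rewrite -mulr_sumr exchange_big; congr (_ * _); apply: eq_bigr => k _ /=.
by rewrite mulr_suml.
Qed.

Lemma rep_dist_ge0 x u y z : 0 <= rep_dist l (Galpha_dist PX PU al) x u y z.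
Proof. by apply: prodr_ge0 => j _; apply: galpha_ge0. Qed.

Lemma sval_le f Gam Gam' : (forall x u y z k, Gam x u y z k <= Gam' x u y z k) ->
  sval f Gam <= sval f Gam'.
Proof.
move=> h; do 4![apply: ler_sum => ? _]; apply: ler_wpM2l; first exact: rep_dist_ge0.
by apply: ler_sum => k _; apply: ler_wpM2r; rewrite ?sqn_ge0.
Qed.

Definition at_index (Gam : payoff) (k : K4) : R :=
  Gam k.1.1 k.2.1.1 (yof k.1.1 k.2.2.1.1) (yof k.1.1 k.2.2.2.1)
      (k.1.2, (k.2.1.2, (k.2.2.1.2, k.2.2.2.2))).

Variables (LA : fX -> KA -> IA -> C) (LU : fU -> KE * (IB * IC) -> IU -> C).
Variables (LB : fY -> KB -> IB -> C) (LC : fY -> KC -> IC -> C).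
Variable v : IA * IU -> C.

(** Reading the input registers and averaging over the public data restores the true law of the
    inputs, whatever [Ts] is. The moments can therefore be computed in the states [ES], with [Ts]
    adapted to each tuple. *)
Lemma sval_reveal (Ts : pred 'I_l) Gam :
  Reveal PU al (fun ub fb gb => Eenv PX al (fun dB dC xb =>
    \sum_k at_index Gam k * sqn (ES LA LU LB LC v PX PU al Ts ub fb gb dB dC xb k)))
  = sval (fun x u y z => amp (LA x) (LU u) (LB y) (LC z) v) Gam.
Proof.
pose w x u y z := \sum_k Gam x u y z k * sqn (amp (LA x) (LU u) (LB y) (LC z) v k).
rewrite [RHS](sum_rep_dist PX PU al w) -(reveal_avg hPX hPU hal Ts).
apply: eq_bigr => gb _; congr (_ * _); apply: eq_bigr => fb _; congr (_ * _).
apply: eq_bigr => ub _; congr (_ * _); congr Eenv.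
apply: funext => dB; apply: funext => dC; apply: funext => xb.
rewrite (sum_ES LA LU LB LC v hPX hPU hal).
do 4![apply: eq_bigr => ? _; congr (_ * _)].
by apply: eq_bigr => -[ka [ke [kb kc]]] _.
Qed.

End StrategyValue.

Section Recursion.
Variable R : realType.
Local Notation C := (complex R).
Variables (X U A S B D : finType) (l : nat).
Variable W : X -> U -> option X -> option X -> A -> S -> B -> D -> bool.
Variables (KA KE KB KC IA IU IB IC : finType).
Variables (la : KA -> {ffun 'I_l -> A}) (le : KE -> {ffun 'I_l -> S}).
Variables (lb : KB -> {ffun 'I_l -> B}) (lc : KC -> {ffun 'I_l -> D}).
Local Notation fX := {ffun 'I_l -> X}.
Local Notation fU := {ffun 'I_l -> U}.
Local Notation fY := {ffun 'I_l -> option X}.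
Local Notation KK := (KA * (KE * (KB * KC)))%type.
Variables (LA : fX -> KA -> IA -> C) (LU : fU -> KE * (IB * IC) -> IU -> C).
Variables (LB : fY -> KB -> IB -> C) (LC : fY -> KC -> IC -> C).
Variable v : IA * IU -> C.
Hypothesis cA : forall x, contr (LA x).
Hypothesis cU : forall x, contr (LU x).
Hypothesis cB : forall x, contr (LB x).
Hypothesis cC : forall x, contr (LC x).
Hypothesis nv : nrm v <= 1.
Variables (PX : X -> R) (PU : U -> R) (al om th : R).
Hypothesis hPX : isprob PX.
Hypothesis hPU : isprob PU.
Hypothesis hal : 0 < al < 1.
Hypothesis om01 : 0 <= om <= 1.
Hypothesis om_ge : qvalue (Galpha_dist PX PU al) W <= om.
Hypothesis th0 : 0 < th.
Hypothesis th1 : th <= 1.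
Local Notation half b := ((1 + (b)%:R) / 2 : R).
Local Notation sv := (sval PX PU al).

Definition amps x u y z := amp (LA x) (LU u) (LB y) (LC z) v.

Definition pw i (x : fX) (u : fU) (y z : fY) (k : KK) : R :=
  half (W (x i) (u i) (y i) (z i) (la k.1 i) (le k.2.1 i) (lb k.2.2.1 i) (lc k.2.2.2 i)).

Definition moment n : R := sv amps (fun x u y z k => (\sum_i pw i x u y z k) ^+ n).

Section Tuples.
Variables (n : nat) (T : {ffun 'I_n -> 'I_l}).
Local Notation OO := ({ffun 'I_n -> A} * {ffun 'I_n -> S} * {ffun 'I_n -> B}
  * {ffun 'I_n -> D})%type.
Implicit Type o : OO.

Definition outs (K V : finType) (lab : K -> {ffun 'I_l -> V}) (k : K) : {ffun 'I_n -> V} :=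
  [ffun j => lab k (T j)].

Definition outs_of (k : KK) : OO :=
  (outs la k.1, outs le k.2.1, outs lb k.2.2.1, outs lc k.2.2.2).

(* The strategy postselected on the outputs o in the coordinates T. *)
Definition fixed o x u y z : KK -> C :=
  amp (maskf [pred k | outs la k == o.1.1.1] (LA x))
      (maskf (fun k => [pred k | outs le k == o.1.1.2] k.1) (LU u))
      (maskf [pred k | outs lb k == o.1.2] (LB y))
      (maskf [pred k | outs lc k == o.2] (LC z)) v.

Lemma sqn_fixed o x u y z k :
  sqn (fixed o x u y z k) = (outs_of k == o)%:R * sqn (amps x u y z k).
Proof.
rewrite /fixed amp_maskf sqn_bool; congr (_%:R * _).
case: o => [[[oa os] ob] od] /=; rewrite /outs_of !xpair_eqE.
by case: (outs la _ == _); case: (outs le _ == _); case: (outs lb _ == _);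
  case: (outs lc _ == _).
Qed.

Definition tuple_pay o (x : fX) (u : fU) (y z : fY) : R :=
  \prod_j half (W (x (T j)) (u (T j)) (y (T j)) (z (T j))
     (o.1.1.1 j) (o.1.1.2 j) (o.1.2 j) (o.2 j)).

(** The possible outputs on the tuple partition the outcomes, so summing over [o] removes the
    postselection and turns the payoff for [o] into that for the actual outputs. *)
Lemma sum_fixed G :
  \sum_o sv (fixed o) (fun x u y z k => tuple_pay o x u y z * G x u y z k)
  = sv amps (fun x u y z k => (\prod_j pw (T j) x u y z k) * G x u y z k).
Proof.
rewrite /sval exchange_big; apply: eq_bigr => x _ /=.
rewrite exchange_big; apply: eq_bigr => u _ /=.
rewrite exchange_big; apply: eq_bigr => y _ /=.
rewrite exchange_big; apply: eq_bigr => z _ /=.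
rewrite -mulr_sumr exchange_big; congr (_ * _); apply: eq_bigr => k _ /=.
rewrite (bigD1 (outs_of k)) //= [X in _ + X]big1 ?addr0 => [|o /negbTE ne]; last first.
  by rewrite sqn_fixed eq_sym ne mul0r mulr0.
rewrite sqn_fixed eqxx mul1r; congr (_ * _ * _); apply: eq_bigr => j _.
by rewrite /pw /outs_of /= !ffunE.
Qed.

Definition Ts : pred 'I_l := [pred i | i \in codom T].

Lemma card_Ts : (#|Ts| <= n)%N.
Proof.
rewrite (eq_card (_ : Ts =i codom T)) => [|i]; last by rewrite unfold_in.
by apply: leq_trans (leq_image_card _ _) _; rewrite card_ord.
Qed.

Section Weights.
Variable o : OO.
Variables (ub : {ffun 'I_l -> U}) (fb gb : {ffun 'I_l -> bool}).

Definition wt (xb : fX) : R :=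
  tuple_pay o xb ub [ffun j => bot_or (fb j) (xb j)] [ffun j => bot_or (gb j) (xb j)].

Lemma tuple_pay01 x u y z : 0 <= tuple_pay o x u y z <= 1.
Proof.
have h (b : bool) : 0 <= half b <= 1 by case: b => /=; apply/andP; split; lra.
apply/andP; split; first by apply: prodr_ge0 => j _; case/andP: (h (W (x (T j)) (u (T j))
  (y (T j)) (z (T j)) (o.1.1.1 j) (o.1.1.2 j) (o.1.2 j) (o.2 j))).
by apply: prodr_ile1 => j _; apply: h.
Qed.

Lemma wt_upd i xb y : ~~ Ts i -> wt (upd xb i y) = wt xb.
Proof.
move=> nT; apply: eq_bigr => j _.
have ne : T j != i by apply: contraNneq nT => <-; apply: codom_f.
by rewrite !ffunE (negbTE ne).
Qed.

Definition fA x := maskf [pred k | outs la k == o.1.1.1] (LA x).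
Definition fE u := maskf (fun k : KE * (IB * IC) => [pred k | outs le k == o.1.1.2] k.1) (LU u).
Definition fB y := maskf [pred k | outs lb k == o.1.2] (LB y).
Definition fC z := maskf [pred k | outs lc k == o.2] (LC z).
Local Notation Eo := (ES fA fE fB fC v PX PU al Ts ub fb gb).

Lemma ES_supp dB dC xb k : Eo dB dC xb k != 0 -> forall j,
  [/\ k.1.1 (T j) = xb (T j), k.2.1.1 (T j) = ub (T j),
      k.2.2.1.1 (T j) = fb (T j) & k.2.2.2.1 (T j) = gb (T j)].
Proof.
move=> nz j; have Tj : Ts (T j) by apply: codom_f.
have dz (V : finType) (a b : V) : dirac R a b != 0 -> b = a.
  by rewrite /dirac; have [->//|_] := eqVneq b a; rewrite eqxx.
have supp (V : finType) (q : 'I_l -> V -> R) (c : {ffun 'I_l -> V}) x (s : C) :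
    q (T j) = dirac R (c (T j)) -> real_complex R (Num.sqrt (pm q x)) * s != 0 ->
    x (T j) = c (T j).
  move=> hq; have [->|] := eqVneq (pm q x) 0; first by rewrite sqrtr0 mul0r eqxx.
  by move=> /prodf_neq0 /(_ (T j) isT); rewrite hq => /dz.
split; move: nz; rewrite /ES.
- by rewrite StAE; apply: supp; rewrite /pA Tj.
- by rewrite StUE; apply: supp; rewrite /pU Tj.
- by rewrite StBE; apply: supp; rewrite /pBC Tj.
- by rewrite StCE; apply: supp; rewrite /pBC Tj.
Qed.

(** On the tuple, the inputs are pinned to public data and the outputs to [o], so the product of
    payoffs there is a number depending on the environment only. *)
Lemma weight_at_index G dB dC xb :
  \sum_k at_index (fun x u y z k => tuple_pay o x u y z * G x u y z k) k
     * sqn (Eo dB dC xb k)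
  = wt xb * \sum_k at_index G k * sqn (Eo dB dC xb k).
Proof.
rewrite mulr_sumr; apply: eq_bigr => k _; rewrite mulrA.
have [->|nz] := eqVneq (Eo dB dC xb k) 0; first by rewrite sqn0 !mulr0.
congr (_ * _); rewrite /at_index; congr (_ * _); apply: eq_bigr => j _.
have [h1 h2 h3 h4] := ES_supp nz j.
by rewrite !ffunE h1 h2 h3 h4.
Qed.

End Weights.

Lemma tuple_bound o c : 0 < c ->
  \sum_i sv (fixed o) (fun x u y z k => tuple_pay o x u y z * pw i x u y z k)
  <= step_rate l om th n * sv (fixed o) (fun x u y z k => tuple_pay o x u y z * 1)
   + step_cost al th * (c - (1 + ln c) *
        sv (fixed o) (fun x u y z k => tuple_pay o x u y z * 1)).
Proof.
move=> c0.
have E G : sv (fixed o) (fun x u y z k => tuple_pay o x u y z * G x u y z k)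
  = Reveal PU al (fun ub fb gb => Eenv PX al (fun dB dC xb => wt o ub fb gb xb *
     \sum_k at_index G k * sqn (ES (fA o) (fE o) (fB o) (fC o) v PX PU al Ts ub fb gb dB dC xb k))).
  rewrite -(sval_reveal hPX hPU hal (fA o) (fE o) (fB o) (fC o) v Ts).
  congr Reveal; apply: funext => ub; apply: funext => fb; apply: funext => gb.
  congr Eenv; apply: funext => dB; apply: funext => dC; apply: funext => xb.
  exact: weight_at_index.
under eq_bigr => i _ do rewrite E.
rewrite Reveal_sum !E; set N := (X in _ <= _ * X + _).
have -> : step_rate l om th n * N + step_cost al th * (c - (1 + ln c) * N)
  = step_cost al th * c + (step_rate l om th n - step_cost al th * (1 + ln c)) * N by ring.
rewrite -(Reveal_affine hPU hal); apply: Reveal_le => // ub fb gb.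
have cfA x : contr (fA o x) by apply: contr_maskf.
have cfE u : contr (fE o u) by apply: contr_maskf.
have cfB y : contr (fB o y) by apply: contr_maskf.
have cfC z : contr (fC o z) by apply: contr_maskf.
have := round_bound la le lb lc cfA cfE cfB cfC nv hPX hPU hal om01 om_ge th0 th1
  card_Ts ub fb gb (fun xb => tuple_pay01 o xb ub _ _) (@wt_upd o ub fb gb) c0.
have -> : Eenv PX al (fun dB dC xb => wt o ub fb gb xb *
    nrm (ES (fA o) (fE o) (fB o) (fC o) v PX PU al Ts ub fb gb dB dC xb))
  = Eenv PX al (fun dB dC xb => wt o ub fb gb xb *
     \sum_k at_index (fun _ _ _ _ _ => 1) k * sqn (ES (fA o) (fE o) (fB o) (fC o) v PX PU al Ts ub fb gb dB dC xb k)).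
  congr Eenv; apply: funext => dB; apply: funext => dC; apply: funext => xb.
  by congr (_ * _); apply: eq_bigr => k _; rewrite mul1r.
move=> h; apply: le_trans (le_trans _ h) _.
  apply: ler_sum => i _; apply: Eenv_le => // dB dC xb; apply: ler_wpM2l.
    by case/andP: (tuple_pay01 o xb ub [ffun j => bot_or (fb j) (xb j)] [ffun j => bot_or (gb j) (xb j)]).
  apply: ler_sum => k _; rewrite le_eqVlt; apply/orP; left; apply/eqP.
  by rewrite /at_index /pw /pay /pay_at /won_at /= !ffunE.
by set e := Eenv _ _ _; rewrite le_eqVlt; apply/orP; left; apply/eqP; ring.
Qed.

End Tuples.

(** The n-th power of the total payoff expands over all n-tuples, repetitions included; one more
    factor is a sum over a further coordinate. [tuple_bound] is summed with the same [c] over all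
    pairs of tuple and outputs, whose number is the power in the last term. *)
Lemma moment_step n c : 0 < c ->
  moment n.+1 <= step_rate l om th n * moment n + step_cost al th *
    ((l%:R * (#|A| * #|S| * #|B| * #|D|)%:R) ^+ n * c - (1 + ln c) * moment n).
Proof.
move=> c0.
have expand m x u y z k : (\sum_i pw i x u y z k) ^+ m
   = \sum_(T : {ffun 'I_m -> 'I_l}) \prod_j pw (T j) x u y z k.
  by rewrite -[in LHS](card_ord m) -prodr_const bigA_distr_bigA.
pose OO := ({ffun 'I_n -> A} * {ffun 'I_n -> S} * {ffun 'I_n -> B} * {ffun 'I_n -> D})%type.
pose N (T : {ffun 'I_n -> 'I_l}) (o : OO) := sv (fixed T o) (fun x u y z k => tuple_pay T o x u y z * 1).
have mn : moment n = \sum_T \sum_o N T o.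
  rewrite /moment.
  transitivity (\sum_(T : {ffun 'I_n -> 'I_l}) sv amps (fun x u y z k => (\prod_j pw (T j) x u y z k) * 1)).
    rewrite sval_sum; congr sval; do 5![apply: funext => ?]; rewrite expand.
    by apply: eq_bigr => T _; rewrite mulr1.
  by apply: eq_bigr => T _; rewrite /N (sum_fixed T (fun _ _ _ _ _ => 1)).
have ms : moment n.+1 = \sum_(T : {ffun 'I_n -> 'I_l}) \sum_o \sum_i sv (fixed T o)
    (fun x u y z k => tuple_pay T o x u y z * pw i x u y z k).
  rewrite /moment.
  transitivity (\sum_(T : {ffun 'I_n -> 'I_l}) \sum_i
     sv amps (fun x u y z k => (\prod_j pw (T j) x u y z k) * pw i x u y z k)).
    under eq_bigr => T _ do rewrite sval_sum.
    rewrite sval_sum; congr sval; do 5![apply: funext => ?]; rewrite exprSr expand mulr_suml.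
    by apply: eq_bigr => T _; rewrite mulr_sumr.
  by apply: eq_bigr => T _; rewrite [RHS]exchange_big; apply: eq_bigr => i _; rewrite sum_fixed.
rewrite ms; apply: le_trans (ler_sum _ (fun T _ => ler_sum _ (fun o _ => tuple_bound T o c0))) _.
have aff a (g : R) (F : {ffun 'I_n -> 'I_l} -> OO -> R) :
   \sum_T \sum_o (a + g * F T o) = a * (#|{ffun 'I_n -> 'I_l}| * #|{: OO}|)%:R + g * \sum_T \sum_o F T o.
  under eq_bigr => T _ do rewrite big_split /= sumr_const -mulr_sumr.
  by rewrite big_split /= sumr_const -mulr_sumr -mulrnA mulnC mulr_natr.
rewrite le_eqVlt; apply/orP; left; apply/eqP.
transitivity (\sum_T \sum_o (step_cost al th * c +
   (step_rate l om th n - step_cost al th * (1 + ln c)) * N T o)).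
  by apply: eq_bigr => T _; apply: eq_bigr => o _; rewrite /N; ring.
rewrite aff -mn !card_prod !card_ffun !card_ord -!expnMn natrX !natrM !exprMn.
by ring.
Qed.

End Recursion.

(** * From the recursion to exponential decay *)

Section Decay.
Variable R : realType.

Lemma ln2_ge : 1 / 2 <= ln 2 :> R.
Proof.
have := @ln_le_subr1 R (2^-1); rewrite invr_gt0 ltr0n => /(_ isT).
by rewrite lnV ?posrE ?ltr0n //; lra.
Qed.

(** Take ln y <= y - 1 at y = 1 / (1 - x / 2) and use (1 + x) (1 - x / 2) >= 1 on [0, 1]. *)
Lemma ln_half_ge (x : R) : 0 <= x <= 1 -> - x <= ln (1 - x / 2).
Proof.
move=> /andP[x0 x1]; have p : 0 < 1 - x / 2 by lra.
have := @ln_le_subr1 R ((1 - x / 2)^-1); rewrite invr_gt0 p => /(_ isT).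
rewrite lnV ?posrE // => h; rewrite lerNl; apply: le_trans h _.
rewrite lerBlDr -[leLHS]mul1r ler_pdivrMr //.
have -> : (x + 1) * (1 - x / 2) = 1 + x / 2 * (1 - x) by field.
by rewrite lerDl mulr_ge0 ?subr_ge0 // divr_ge0.
Qed.

(** Chosen so that the transport error is l eta / 8: [step_cost] at th = eta / 48 contributes 6144 *
    48, and - ln c is at most 10 kap L. *)
Definition rate_const : R := (10 * 48 * 48 * 1024)^-1.

Lemma rate_const_gt0 : 0 < rate_const.
Proof. by rewrite invr_gt0 !mulr_gt0 ?ltr0n. Qed.

Variables (l N : nat) (om eta al q : R) (M : nat -> R).
Hypothesis l0 : (0 < l)%N.
Hypothesis N2 : (2 <= N)%N.
Hypothesis om0 : 0 <= om.
Hypothesis eta0 : 0 < eta.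
Hypothesis ometa : om + eta <= 1.
Hypothesis al0 : 0 < al.
Hypothesis al1 : al <= 1.
Hypothesis M0 : M 0 <= 1.
Hypothesis Mlow : forall n, q * (l%:R * ((1 + om + eta) / 2)) ^+ n <= M n.
Hypothesis Mstep : forall n c, 0 < c -> M n.+1 <= step_rate l om (eta / 48) n * M n
  + step_cost al (eta / 48) * ((l%:R * N%:R) ^+ n * c - (1 + ln c) * M n).

Let L : R := ln N%:R.
Let kap : R := rate_const * (eta ^+ 2 * al ^+ 4 * l%:R) / L.
Let be : R := (1 + om + eta) / 2.

Let L2 : 1 / 2 <= L.
Proof.
have Np : 0 < N%:R :> R by rewrite ltr0n; apply: leq_trans N2.
by apply: le_trans ln2_ge _; rewrite /L ler_ln ?posrE ?ler_nat.
Qed.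

Let lR : 0 < l%:R :> R. Proof. by rewrite ltr0n. Qed.
Let be_half : 1 / 2 <= be. Proof. by rewrite /be; move: om0 eta0; lra. Qed.
Let be1 : be <= 1. Proof. by rewrite /be; move: ometa; lra. Qed.
Let eta1 : eta <= 1. Proof. by move: om0 ometa; lra. Qed.

Let kap0 : 0 <= kap.
Proof.
have Lp : 0 <= L by move: L2; lra.
by rewrite /kap !(mulr_ge0, invr_ge0, exprn_ge0) // ltW // rate_const_gt0.
Qed.

Let kapL : kap * L = rate_const * (eta ^+ 2 * al ^+ 4 * l%:R).
Proof. by rewrite /kap mulfVK // gt_eqF //; move: L2; lra. Qed.

(** The transport error is inversely proportional to al^2, so al^4 is replaced by the larger
    al^2. *)
Let kapL_le : kap * L <= rate_const * (eta ^+ 2 * al ^+ 2 * l%:R).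
Proof.
rewrite kapL; apply: ler_wpM2l; first exact: ltW rate_const_gt0.
apply: ler_wpM2r; first exact: ltW.
apply: ler_wpM2l; first by rewrite exprn_ge0 // ltW.
rewrite (_ : 4 = 2 + 2)%N // exprD ler_piMl ?exprn_ge0 ?(ltW al0) //.
by rewrite exprn_ile1 // ltW.
Qed.

Let kapL_le1 : kap * L <= rate_const * (eta * l%:R).
Proof.
apply: le_trans kapL_le _; apply: ler_wpM2l; first exact: ltW rate_const_gt0.
apply: ler_wpM2r; first exact: ltW.
rewrite expr2 -mulrA ler_piMr ?(ltW eta0) // mulr_ile1 ?exprn_ge0 ?exprn_ile1 ?(ltW eta0) ?(ltW al0) //.
Qed.

Hypothesis hq : powR (1 - eta / 2) kap < q.

Let q0 : 0 < q.
Proof. by apply: le_lt_trans hq; apply: powR_ge0. Qed.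

Let ln_q : - kap <= ln q.
Proof.
have p : 0 < 1 - eta / 2 by move: eta1; lra.
apply: le_trans (_ : ln (powR (1 - eta / 2) kap) <= _); last first.
  by rewrite ler_ln ?posrE ?powR_gt0 // ltW.
rewrite ln_powR -mulrN1; apply: ler_wpM2l => //.
have /ln_half_ge : 0 <= eta <= 1 by rewrite eta1 ltW.
by apply: le_trans; rewrite lerN2.
Qed.

Let Mpos n : 0 < M n.
Proof.
apply: lt_le_trans (Mlow n); rewrite mulr_gt0 // exprn_gt0 // mulr_gt0 //.
by move: be_half; rewrite /be; lra.
Qed.

(** With [c] the average weight of a pair, the tangent terms add up to - ln c times [M n]. The
    excesses over (1 + om) / 2 are eta / 16 from th, at most eta / 16 from n / l and at most eta / 8
    from the error, in total eta / 4. *)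
Let decay_step n : n%:R <= 4 * kap -> M n.+1 <= l%:R * (be - eta / 4) * M n.
Proof.
move=> hn; have lN : 0 < l%:R * N%:R :> R.
  by rewrite mulr_gt0 // ltr0n; apply: leq_trans N2.
have Np : 0 < N%:R :> R by rewrite ltr0n; apply: leq_trans N2.
pose c := M n / (l%:R * N%:R) ^+ n.
have c0 : 0 < c by rewrite divr_gt0 // exprn_gt0.
apply: le_trans (Mstep n c0) _.
have -> : (l%:R * N%:R) ^+ n * c = M n.
  by rewrite /c mulrC mulfVK // expf_neq0 // gt_eqF.
have bep : 0 < be by move: be_half; lra.
(* Each step of the recursion costs one L for the number of outputs and at most another for [be],
   since be >= 1 / 2 >= 1 / N. *)
have lnc : ln q - n%:R * (2 * L) <= ln c.
  have h : q * (be / N%:R) ^+ n <= c.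
    rewrite /c ler_pdivlMr ?exprn_gt0 //; apply: le_trans (Mlow n).
    rewrite -mulrA -exprMn le_eqVlt; apply/orP; left; apply/eqP; congr (_ * _ ^+ _).
    by rewrite /be; field; rewrite gt_eqF.
  have bN : 0 < be / N%:R by rewrite divr_gt0.
  apply: le_trans (_ : ln (q * (be / N%:R) ^+ n) <= _); last first.
    by rewrite ler_ln ?posrE // mulr_gt0 // exprn_gt0.
  rewrite lnM ?posrE ?exprn_gt0 // lnXn // ln_div ?posrE // -[X in _ <= _ + X]mulr_natl.
  rewrite lerD2l -mulrN ler_wpM2l //.
  have : - L <= ln be; last by rewrite -/L; lra.
  have : - ln 2 <= ln be.
    rewrite -lnV ?posrE // ler_ln ?posrE ?invr_gt0 //.
    by move: be_half; rewrite mul1r.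
  have : ln 2 <= L; last by lra.
  by rewrite /L ler_ln ?posrE // ler_nat.
set x := M n; have x0 : 0 <= x by apply/ltW/Mpos.
have -> : step_rate l om (eta / 48) n * x + step_cost al (eta / 48) * (x - (1 + ln c) * x)
  = (step_rate l om (eta / 48) n - step_cost al (eta / 48) * ln c) * x by ring.
apply: ler_wpM2r => //; rewrite /step_rate.
have cost : - (step_cost al (eta / 48) * ln c) <= l%:R * (eta / 8).
  rewrite -mulrN; apply: le_trans (_ : step_cost al (eta / 48) *
      (10 * (rate_const * (eta ^+ 2 * al ^+ 2 * l%:R))) <= _); last first.
    rewrite /step_cost /rate_const le_eqVlt; apply/orP; left; apply/eqP; field.
    by rewrite !gt_eqF.
  apply: ler_wpM2l.
    by rewrite /step_cost !(divr_ge0, mulr_ge0, exprn_ge0) // ltW.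
  (* - ln q <= kap <= 2 kap L because L >= 1 / 2, and 2 n L <= 8 kap L. *)
  apply: le_trans (_ : 10 * (kap * L) <= _); last by rewrite ler_pM2l.
  have h1 : n%:R * L <= 4 * (kap * L).
    by rewrite mulrA; apply: ler_wpM2r => //; move: L2; lra.
  have h2 : kap * (1 / 2) <= kap * L by apply: ler_wpM2l.
  move: lnc ln_q h1 h2; rewrite mulrCA; set t := n%:R * L; set s := kap * L; lra.
have hnl : n%:R <= l%:R * (eta / 16).
  apply: le_trans hn _; have h2 : kap * (1 / 2) <= kap * L by apply: ler_wpM2l.
  move: h2 kapL_le1; rewrite /rate_const [eta * _]mulrC.
  have -> : l%:R * (eta / 16) = l%:R * eta / 16 by rewrite mulrA.
  have : 0 <= l%:R * eta by rewrite mulr_ge0 // ltW.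
  by set t := l%:R * eta; set s := kap * L; lra.
move: cost hnl; set t := step_cost _ _ * _; rewrite /be.
have -> : l%:R * ((1 + om + eta) / 2 - eta / 4) = l%:R * ((1 + om) / 2 + 3 * (eta / 48))
   + 3 * (l%:R * (eta / 16)) by field.
have -> : l%:R * (eta / 8) = 2 * (l%:R * (eta / 16)) by field.
by set a := l%:R * (_ + _); set b := l%:R * _; lra.
Qed.

Lemma decay_absurd : False.
Proof.
(* More than 4 kap steps, each gaining a factor 1 - eta / 4, bring [q] down to exp (- eta kap),
   which is at most (1 - eta / 2)^kap. The last step starts from n0 - 1 <= 4 kap, as [decay_step]
   requires. *)
pose n0 := (Num.truncn (4 * kap)).+1.
have k40 : 0 <= 4 * kap by rewrite mulr_ge0.
have [tr1 tr2] := andP (Num.Theory.truncn_itv k40).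
have ga0 : 0 <= l%:R * (be - eta / 4).
  by rewrite mulr_ge0 ?ltW //; move: be_half eta1; lra.
have Mup n : (n <= n0)%N -> M n <= (l%:R * (be - eta / 4)) ^+ n.
  elim: n => [|n IH] hn; first by rewrite expr0.
  rewrite exprS; apply: le_trans (decay_step _) _.
    by apply: le_trans tr1; rewrite ler_nat.
  by apply: ler_wpM2l => //; apply: IH; apply: ltnW.
have lbe : 0 < l%:R * be by rewrite mulr_gt0 //; move: be_half; lra.
have h : q <= (1 - eta / 4) ^+ n0.
  rewrite -(ler_pM2r (exprn_gt0 n0 lbe)); apply: le_trans (Mlow n0) _.
  apply: le_trans (Mup n0 (leqnn _)) _; rewrite -exprMn.
  apply: lerXn2r; rewrite ?nnegrE //.
    by rewrite mulr_ge0 ?(ltW lbe) //; move: eta1; lra.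
  rewrite mulrCA; apply: ler_wpM2l; first exact: ltW.
  have : eta / 4 * be <= eta / 4 by rewrite ler_piMr // divr_ge0 // ltW.
  by rewrite mulrBl mul1r; lra.
have e4 : 1 - eta / 4 <= sequences.expR (- (eta / 4)) by apply: expR_ge1Dx.
have : q <= powR (1 - eta / 2) kap; last by rewrite leNgt hq.
apply: le_trans h _; apply: le_trans (_ : sequences.expR (- (eta / 4)) ^+ n0 <= _).
  by apply: lerXn2r; rewrite ?nnegrE ?expR_ge0 //; move: eta1; lra.
rewrite -expRM_natl /powR gt_eqF; last by move: eta1; lra.
rewrite ler_expR; apply: le_trans (_ : 4 * kap * - (eta / 4) <= _).
  by rewrite ler_wnM2r ?oppr_le0 ?divr_ge0 // ltW.
have -> : 4 * kap * - (eta / 4) = kap * - eta by field.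
by apply: ler_wpM2l => //; apply: ln_half_ge; rewrite eta1 ltW.
Qed.

End Decay.

(** * Bounds for the repeated game *)

Section Threshold.
Variable R : realType.

Section Bounds.
Variables (X U Y Z A S B D : finType).
Variable P : X -> U -> Y -> Z -> R.
Variable W : X -> U -> Y -> Z -> A -> S -> B -> D -> bool.
Hypothesis P0 : forall x u y z, 0 <= P x u y z.
Hypothesis P1 : \sum_x \sum_u \sum_y \sum_z P x u y z = 1.

Lemma qvalue_le1 : qvalue P W <= 1.
Proof.
apply: qvalue_le => // r.
case=> [? [? [? [? [? [? [? [? [la [le [lb [lc [LA [LU [LB [LC [v [[cA cU cB cC nv] ->]]]]]]]]]]]]]]]]]].
by rewrite -nv; apply: fwin_le_nrm.
Qed.

Lemma qvalue_ge0 : 0 <= qvalue P W.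
Proof.
have [[r hr]|ne] := pselect (exists r, valid_value P W r).
  apply: le_trans (valid_le_qvalue P0 P1 hr); case: (valid_amp hr).
  move=> ? [? [? [? [? [? [? [? [? [? [? [? [? [? [? [? [? [_ ->]]]]]]]]]]]]]]]]].
  exact: fwin_ge0.
by rewrite qvalueE sup_out // => -[[r hr] _]; apply: ne; exists r.
Qed.

End Bounds.

Variables (X U A S B D : finType) (PX : X -> R) (PU : U -> R) (al : R).
Variable W : X -> U -> option X -> option X -> A -> S -> B -> D -> bool.
Hypothesis hPX : isprob PX.
Hypothesis hPU : isprob PU.
Hypothesis hal : 0 < al < 1.
Local Notation P := (Galpha_dist PX PU al).

Lemma rep_dist_sum1 l : \sum_x \sum_u \sum_y \sum_z rep_dist l P x u y z = 1.
Proof.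
have := @sum_rep_dist R X U l PX PU al (fun _ _ _ _ => 1).
under eq_bigr => x _ do under eq_bigr => u _ do under eq_bigr => y _ do
  under eq_bigr => z _ do rewrite mulr1.
move=> ->; have hb j : 'I_l -> isprob (bern al) := fun=> isprob_bal hal.
rewrite !sum_pm_const //; by move=> j; apply: isprob_bal.
Qed.

Lemma svalZ (KA KE KB KC : finType) l (f : {ffun 'I_l -> X} -> {ffun 'I_l -> U} ->
     {ffun 'I_l -> option X} -> {ffun 'I_l -> option X} -> KA * (KE * (KB * KC)) -> complex R)
   Gam r : sval PX PU al f Gam * r = sval PX PU al f (fun x u y z k => Gam x u y z k * r).
Proof.
rewrite /sval mulr_suml; apply: eq_bigr => x _; rewrite mulr_suml; apply: eq_bigr => u _.
rewrite mulr_suml; apply: eq_bigr => y _; rewrite mulr_suml; apply: eq_bigr => z _.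
by rewrite -mulrA mulr_suml; congr (_ * _); apply: eq_bigr => k _; rewrite mulrAC.
Qed.

Lemma threshold_bound (eta : R) (l : nat) : 0 < eta ->
  qvalue (rep_dist l P) (rep_thr l ((qvalue P W + eta) * l%:R) W)
  <= powR (1 - eta / 2) (rate_const R * (eta ^+ 2 * al ^+ 4 * l%:R)
            / ln (#|A| * #|S| * #|B| * #|D|)%:R).
Proof.
move=> eta0; set om := qvalue P W; set N := (_ * #|D|)%N.
have rep0 x u y z : 0 <= rep_dist l P x u y z by apply: rep_dist_ge0.
have P0 x u y z : 0 <= P x u y z by apply: galpha_ge0.
have P1 : \sum_x \sum_u \sum_y \sum_z P x u y z = 1 by apply: galpha_sum1.
have om0 : 0 <= om by apply: qvalue_ge0.
have om1 : om <= 1 by apply: qvalue_le1.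
have triv e : e = 0 -> qvalue (rep_dist l P) (rep_thr l ((om + eta) * l%:R) W)
    <= powR (1 - eta / 2) e.
  by move=> ->; rewrite powRr0; apply: qvalue_le1 => //; apply: rep_dist_sum1.
(* If N <= 1 then [ln N] is 0, for N = 0 by convention, and division by 0 makes the exponent 0, so
   the bound is 1. *)
have [N2|N1] := leqP 2 N; last first.
  apply: triv; rewrite (_ : ln N%:R = 0) ?invr0 ?mulr0 //.
  by case: N N1 => [|[|//]] _; rewrite ?ln1 // ln0.
have [l0|l0] := posnP l; first by apply: triv; rewrite l0 !(mulr0, mul0r).
have lR : 0 < l%:R :> R by rewrite ltr0n.
apply: qvalue_le; first exact: powR_ge0.
move=> r [KA [KE [KB [KC [IA [IU [IB [IC [la [le [lb [lc [LA [LU [LB [LC [v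
  [[cA cU cB cC nv] ->]]]]]]]]]]]]]]]]]].
have nwon_le (x : {ffun 'I_l -> X}) u y z a s b c : (nwon W x u y z a s b c <= l)%N.
  by apply: leq_trans (max_card _) _; rewrite card_ord.
(* If om + eta > 1 the threshold exceeds l and no strategy ever reaches it. *)
have [hoe|hoe] := lerP (om + eta) 1; last first.
  rewrite [leLHS]big1 ?powR_ge0 // => x _; apply: big1 => u _; apply: big1 => y _.
  apply: big1 => z _; rewrite big1 ?mulr0 // => k _.
  rewrite /rep_thr lt_geF ?mul0r //.
  apply: le_lt_trans (_ : l%:R < _); first by rewrite ler_nat.
  by rewrite ltr_pMl.
rewrite leNgt; apply/negP => hq.
have [al0 al1] := andP hal.
apply: (decay_absurd (M := moment W la le lb lc LA LU LB LC v PX PU al) l0 N2 om0 eta0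
  hoe al0 (ltW al1) _ _ _ hq).
- rewrite /moment -(rep_dist_sum1 l); apply: ler_sum => x _; apply: ler_sum => u _.
  apply: ler_sum => y _; apply: ler_sum => z _; rewrite ler_piMr //.
  under eq_bigr => k _ do rewrite expr0 mul1r.
  by rewrite -nv; apply: amp_nrm.
- move=> n; rewrite /moment.
  rewrite (_ : fwin _ _ _ _ _ _ _ = sval PX PU al (amps LA LU LB LC v)
    (fun x u y z k => (rep_thr l ((om + eta) * l%:R) W x u y z (la k.1) (le k.2.1) (lb k.2.2.1) (lc k.2.2.2))%:R)) //.
  rewrite svalZ; apply: sval_le => // x u y z k; set s := \sum_i _.
  (* The total payoff is half of l plus the number of copies won, so reaching the threshold makes it
     at least l (1 + om + eta) / 2. *)
  have -> : s = (l%:R + (nwon W x u y z (la k.1) (le k.2.1) (lb k.2.2.1) (lc k.2.2.2))%:R) / 2.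
    rewrite /s -mulr_suml big_split /= sumr_const card_ord; congr ((_ + _) / _).
    rewrite /nwon -sum1_card natr_sum [RHS]big_mkcond /=; apply: eq_bigr => i _.
    by rewrite inE; case: (W _ _ _ _ _ _ _ _).
  case: (boolP (rep_thr _ _ _ _ _ _ _ _ _ _ _)) => [h|_] /=; last first.
    by rewrite mul0r exprn_ge0 // divr_ge0 ?addr_ge0 ?ler0n.
  rewrite mul1r; apply: lerXn2r; rewrite ?nnegrE.
  + by rewrite mulr_ge0 ?ler0n // divr_ge0 // !addr_ge0 // ltW.
  + by rewrite divr_ge0 ?addr_ge0 ?ler0n.
  rewrite mulrA ler_pM2r ?invr_gt0 // -addrA mulrDr mulr1 lerD2l mulrC; exact: h.
- move=> n c c0; have th0 : 0 < eta / 48 by rewrite divr_gt0.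
  have th1 : eta / 48 <= 1 by move: om0 hoe; lra.
  apply: (moment_step la le lb lc cA cU cB cC _ hPX hPU hal _ (lexx _) th0 th1) => //.
  + by rewrite nv.
  + by rewrite om0 om1.
Qed.

End Threshold.

Theorem theorem34 (R : realType) :
  exists c : R, 0 < c /\
  forall (X U A S B C : finType) (PX : X -> R) (PU : U -> R) (alpha eps : R)
    (V1 : X -> U -> A -> S -> bool)
    (V2 : X -> U -> option X -> option X -> A -> S -> B -> C -> bool),
    (forall x, 0 <= PX x) -> \sum_(x : X) PX x = 1 ->
    (forall u, 0 <= PU u) -> \sum_(u : U) PU u = 1 ->
    0 < alpha < 1 ->
    qvalue (Galpha_dist PX PU alpha) (Galpha_pred V1 V2) = 1 - eps ->
    (forall l : nat,
       qvalue (rep_dist l (Galpha_dist PX PU alpha))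
              (rep_all l (Galpha_pred V1 V2))
       <= powR (1 - eps / 2)
            (c * (eps ^+ 2 * alpha ^+ 4 * l%:R)
               / ln (#|A| * #|S| * #|B| * #|C|)%:R))
    /\
    (forall (eta : R) (l : nat), 0 < eta ->
       qvalue (rep_dist l (Galpha_dist PX PU alpha))
              (rep_thr l ((1 - eps + eta) * l%:R) (Galpha_pred V1 V2))
       <= powR (1 - eta / 2)
            (c * (eta ^+ 2 * alpha ^+ 4 * l%:R)
               / ln (#|A| * #|S| * #|B| * #|C|)%:R)).
Proof.
exists (rate_const R); split; first exact: rate_const_gt0.
move=> X U A S B C PX PU alpha eps V1 V2 PX0 PX1 PU0 PU1 hal hom.
have thr eta l := @threshold_bound R X U A S B C PX PU alpha (Galpha_pred V1 V2)
  (conj PX0 PX1) (conj PU0 PU1) hal eta l.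
rewrite hom in thr; split=> // l.
have eps0 : 0 <= eps.
  have : qvalue (Galpha_dist PX PU alpha) (Galpha_pred V1 V2) <= 1.
    by apply: qvalue_le1; [move=> *; apply: galpha_ge0 | apply: galpha_sum1].
  by rewrite hom; lra.
(* The threshold bound needs a positive excess; for eps = 0 the base of the power is 1. *)
have [e0|ne0] := eqVneq eps 0.
  rewrite e0 mul0r subr0 powR1; apply: qvalue_le1; last exact: rep_dist_sum1.
  by move=> *; apply: rep_dist_ge0.
(* Winning all copies is the threshold game with eta = eps. *)
have -> : rep_all l (Galpha_pred V1 V2)
    = rep_thr l ((1 - eps + eps) * l%:R) (Galpha_pred V1 V2).
  do 8![apply: funext => ?]; rewrite /rep_all /rep_thr subrK mul1r ler_nat.
  rewrite eqn_leq [X in X && _](_ : _ = true) //.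
  by apply: leq_trans (max_card _) _; rewrite card_ord.
by apply: thr; rewrite lt_neqAle eq_sym ne0.
Qed.
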